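(* Let $R$ be a finite ring. Then the co-maximal graph $C_\Gamma(R)$ is projective if and only if $R$ is isomorphic to one of the following rings: $$\mathbb{Z}_2\times\mathbb{Z}_4,\qquad \mathbb{Z}_2\times\frac{\mathbb{Z}_2[x]}{(x^2)},\qquad \mathbb{Z}_5.$$
   Context: All rings are commutative with non-zero identity. $\mathbb{Z}_n$ is the ring of integers modulo $n$. The co-maximal graph $C_\Gamma(R)$ is the simple graph with vertex set $R$ in which two distinct vertices $x,y$ are adjacent if and only if $Rx+Ry=R$. The nonorientable genus (crosscap number) of a finite simple graph is the minimum non-negative integer $k$ such that the graph can be embedded in the sphere with $k$ crosscaps (the case $k=0$ being the sphere itself). A graph is projective if its nonorientable genus equals $1$ (so planar graphs are not projective). *)

(* Defs.v *)
From HB Require Import structures.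
From mathcomp Require Import all_boot all_order all_algebra generic_quotient.
From mathcomp Require Import all_classical all_reals all_analysis.
From mathcomp Require Import ring lra.
Import Order.TTheory GRing.Theory Num.Theory.
Import numFieldNormedType.Exports.

Set Implicit Arguments.
Unset Strict Implicit.
Unset Printing Implicit Defensive.

Local Open Scope classical_set_scope.
Local Open Scope ring_scope.
Local Open Scope quotient_scope.

Record sgraph (V : finType) := SGraph {
  adj :> rel V;
  adj_sym : symmetric adj;
  adj_irrefl : irreflexive adj }.

Section ComaximalGraph.
Variable R : finComNzRingType.

Definition comaximal (x y : R) : bool :=
  [forall z : R, exists a : R, exists b : R, z == a * x + b * y].

Definition comaximal_adj : rel R := [rel x y | (x != y) && comaximal x y].

Lemma comaximal_adj_sym : symmetric comaximal_adj.
Proof.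
move=> x y; rewrite /comaximal_adj /= eq_sym; congr andb.
by apply/forallP/forallP => h z; have /existsP[a /existsP[b /eqP ->]] := h z;
  apply/existsP; exists b; apply/existsP; exists a; rewrite addrC.
Qed.

Lemma comaximal_adj_irrefl : irreflexive comaximal_adj.
Proof. by move=> x; rewrite /comaximal_adj /= eqxx. Qed.

Definition comaximal_graph : sgraph R :=
  SGraph comaximal_adj_sym comaximal_adj_irrefl.

End ComaximalGraph.

Section Surfaces.
Variable K : realType.

Definition dot (x y : 'rV[K]_3) : K := \sum_(j < 3) x 0 j * y 0 j.

(* The sphere with k crosscaps: k open round caps are removed from the unit
   sphere, and antipodal points of each of the k resulting rims are identified.
   The caps have equally spaced centers on the equator and angular radius
   pi / (2 k): distinct centers are at angular distance at least 2 pi / k, so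
   the closed caps are pairwise disjoint (see rim_disjoint). For k = 0 nothing
   is removed, since cap indices range over i < k. *)
Definition cap_angle (k i : nat) : K := 2 * pi * i%:R / k%:R.

Definition cap_center (k i : nat) : 'rV[K]_3 :=
  \row_j [:: cos (cap_angle k i); sin (cap_angle k i); 0]`_j.

Definition cap_height (k : nat) : K := cos (pi / (2 * k%:R)).

Definition holed_sphere (k : nat) : set 'rV[K]_3 :=
  [set x | dot x x = 1 /\
           forall i, (i < k)%N -> dot x (cap_center k i) <= cap_height k].

Definition on_rim (k i : nat) (x : 'rV[K]_3) : Prop :=
  dot x (cap_center k i) = cap_height k.

(* The rim is a circle with center cap_height k *: cap_center k i. *)
Definition rim_antipode (k i : nat) (x : 'rV[K]_3) : 'rV[K]_3 :=
  (2 * cap_height k) *: cap_center k i - x.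

Definition glued (k : nat) (x y : holed_sphere k) : bool :=
  `[< x = y \/ exists i, [/\ (i < k)%N, on_rim k i (set_val x) &
                            set_val y = rim_antipode k i (set_val x)] >].

Lemma dotE x y : dot x y = x 0 0 * y 0 0 + x 0 1 * y 0 1 + x 0 2%:R * y 0 2%:R.
Proof.
rewrite /dot !big_ord_recr big_ord0 /= add0r.
by congr (_ * _ + _ * _ + _ * _); congr (_ 0 _); apply/val_inj.
Qed.

Lemma dot_center k i x :
  dot x (cap_center k i) =
  x 0 0 * cos (cap_angle k i) + x 0 1 * sin (cap_angle k i).
Proof. by rewrite dotE !mxE /= mulr0 addr0. Qed.

Lemma dot_antipode k i x : on_rim k i x ->
  dot (rim_antipode k i x) (cap_center k i) = cap_height k.
Proof.
rewrite /on_rim /rim_antipode !dot_center !mxE /= => rx.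
have c2s2 := cos2Dsin2 (cap_angle k i).
move: (cos _) (sin _) (cap_height k) rx c2s2 => c s h rx c2s2.
have -> : (2 * h * c - x 0 0) * c + (2 * h * s - x 0 1) * s =
  2 * h * (c ^+ 2 + s ^+ 2) - (x 0 0 * c + x 0 1 * s) by ring.
by rewrite c2s2 rx; ring.
Qed.

Lemma rim_antipodeK k i x : rim_antipode k i (rim_antipode k i x) = x.
Proof. by rewrite /rim_antipode opprB addrC subrK. Qed.

Lemma rim_disjoint k i j x : dot x x = 1 -> (i < k)%N -> (j < k)%N ->
  on_rim k i x -> on_rim k j x -> i = j.
Proof.
wlog ij : i j / (j < i)%N => [wl|] xx ik jk xi xj.
  have [ij|ij|//] := ltngtP i j; last exact: wl.
  by apply/esym/wl.
exfalso; move: xx xi xj; rewrite /on_rim !dot_center dotE.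
move: (x 0 0) (x 0 1) (x 0 2%:R) => x0 x1 x2 xx xi xj.
have k0 : 0 < k%:R :> K by rewrite ltr0n (leq_ltn_trans _ ik).
pose m : K := pi * (i%:R + j%:R) / k%:R.
pose d : K := pi * (i%:R - j%:R) / k%:R.
have mdi : cap_angle k i = m + d by rewrite /cap_angle /m /d; field; lra.
have mdj : cap_angle k j = m - d by rewrite /cap_angle /m /d; field; lra.
rewrite mdi cosD sinD in xi; rewrite mdj cosB sinB in xj.
have p0 : 0 < pi :> K := pi_gt0 K.
have ji : j%:R + 1 <= i%:R :> K by rewrite natr1 ler_nat.
have iK : i%:R + 1 <= k%:R :> K by rewrite natr1 ler_nat.
have j0 : 0 <= j%:R :> K by [].
have dl : 0 <= d - pi / k%:R.
  have -> : d - pi / k%:R = pi * (i%:R - j%:R - 1) / k%:R by rewrite /d; field; lra.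
  by rewrite divr_ge0 ?mulr_ge0 ?(ltW k0) ?(ltW p0)//; lra.
have dr : 0 <= pi - pi / k%:R - d.
  have -> : pi - pi / k%:R - d = pi * (k%:R - 1 - i%:R + j%:R) / k%:R.
    by rewrite /d; field; lra.
  by rewrite divr_ge0 ?mulr_ge0 ?(ltW k0) ?(ltW p0)//; lra.
pose e : K := pi / (2 * k%:R).
have e2 : pi / k%:R = 2 * e by rewrite /e; field; lra.
have e0 : 0 < e by rewrite /e divr_gt0// mulr_gt0.
have lt1 : cos d < cos e by rewrite ltr_cos ?in_itv /=; lra.
have lt2 : cos (pi - e) < cos d by rewrite ltr_cos ?in_itv /=; lra.
have coE : cos (pi - e) = - cos e by rewrite cosB cospi sinpi; ring.
rewrite {}coE in lt2; rewrite /cap_height -/e in xi xj.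
have key : cos d * (x0 * cos m + x1 * sin m) = cos e by lra.
have m1 := cos2Dsin2 m.
move: (cos d) (cos e) (cos m) (sin m) lt1 lt2 key m1 => D E c s lt1 lt2 key m1.
have lag : (x0 * c + x1 * s) ^+ 2 <= 1.
  have -> : (x0 * c + x1 * s) ^+ 2 =
    (x0 ^+ 2 + x1 ^+ 2) * (c ^+ 2 + s ^+ 2) - (x0 * s - x1 * c) ^+ 2 by ring.
  rewrite m1 mulr1; have := sqr_ge0 (x0 * s - x1 * c).
  by have := sqr_ge0 x2; rewrite !expr2 in xx *; lra.
have : E ^+ 2 <= D ^+ 2.
  rewrite -key exprMn -[leRHS]mulr1; apply: ler_wpM2l => //; exact: sqr_ge0.
by apply/negP; rewrite -ltNge; nra.
Qed.

Lemma glued_refl k : reflexive (@glued k).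
Proof. by move=> x; apply/asboolP; left. Qed.

Lemma glued_sym k : symmetric (@glued k).
Proof.
suff imp x y : @glued k x y -> glued y x by move=> x y; apply/idP/idP; apply: imp.
case/asboolP => [->|[i [ik xi yE]]]; apply/asboolP; first by left.
by right; exists i; rewrite yE rim_antipodeK; split => //; exact: dot_antipode.
Qed.

Lemma glued_trans k : transitive (@glued k).
Proof.
move=> y x z /asboolP[->//|[i [ik xi yE]]] /asboolP[<-|[j [jk yj zE]]].
  by apply/asboolP; right; exists i.
apply/asboolP; left; apply: val_inj.
have yi : on_rim k i (set_val y) by rewrite yE; exact: dot_antipode.
have [yy _] : holed_sphere k (set_val y) by apply: set_mem; exact: valP.
have ij := rim_disjoint yy ik jk yi yj.
by move: zE; rewrite -ij yE rim_antipodeK.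
Qed.

Definition glued_equiv k : equiv_rel (holed_sphere k) :=
  EquivRel (@glued k) (@glued_refl k) (@glued_sym k) (@glued_trans k).

Definition crosscap_surface (k : nat) : topologicalType :=
  quotient_topology {eq_quot (glued_equiv k)}.

Definition simple_arc (X : topologicalType) (a b : X) (A : set X) : Prop :=
  exists g : K -> X,
    [/\ {within `[0, 1], continuous g}, set_inj `[0, 1] g,
        g 0 = a, g 1 = b & g @` `[0, 1] = A].

(* Vertices are drawn as distinct points, and edges as simple arcs between their
   end points, meeting the vertices and the other edges in end points only. *)
Definition embeds (V : finType) (G : sgraph V) (X : topologicalType) : Prop :=
  exists (v : V -> X) (A : V -> V -> set X),
    [/\ injective v,
        forall x y, A x y = A y x,
        forall x y, G x y -> simple_arc (v x) (v y) (A x y),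
        forall x y z, G x y -> A x y (v z) -> z = x \/ z = y &
        forall x y z w, G x y -> G z w -> [set x; y] <> [set z; w] ->
          A x y `&` A z w `<=` range v].

Definition has_nonorientable_genus (V : finType) (G : sgraph V) (k : nat) : Prop :=
  embeds G (crosscap_surface k) /\
  forall j : nat, embeds G (crosscap_surface j) -> (k <= j)%N.

Definition projective (V : finType) (G : sgraph V) : Prop :=
  has_nonorientable_genus G 1.

End Surfaces.

Definition ring_isomorphic (R S : nzRingType) : Prop :=
  exists f : {rmorphism R -> S}, bijective f.

(* Main.v *)
From HB Require Import structures.
Require Import Defs.
From mathcomp Require Import all_boot all_order all_algebra generic_quotient.
From mathcomp Require all_fingroup all_solvable.
From mathcomp Require Import all_classical all_reals all_analysis.
From mathcomp Require Import ring lra zify.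

(** The sphere has no subdivision of K_5, and the projective plane none of K_{3,5} and
    K_7. The last two graphs cut the finite rings down to a few small ones; among these,
    the planar ones and those of the theorem are told apart by K_5 and by explicit
    drawings.

    Obstructions. A point of the sphere, or of the projective plane, lifts to a unit
    vector, unique up to sign in the second case. The drawing of an edge is replaced by
    a polygon with short steps between lifted points, moved slightly so that no three of
    the vectors are dependent. Vertex-disjoint edges are a positive distance apart, so
    their polygons do not cross, and whether two geodesic segments cross can be read
    from signs of determinants. If a polygon is replaced by the segment between its
    ends, its number of crossings with another polygon changes mod 2 by terms that
    depend on one edge and one end of the other, and, in the projective plane, by the
    product of two bits that tell which of the two segments between the ends is
    homologous to the polygon (cross_straighten). In the sum over all pairs of
    independent edges of K_5 or K_{3,3} the terms of the first kind cancel (parity), and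
    the geodesic drawings of these two graphs have an odd number of independent
    crossings, by a finite check on signs (XS_K5, Xtw_K33). On the sphere the bits
    vanish, so no subdivision of K_5 embeds. In the projective plane the bits of every
    subdivision of K_{3,3} satisfy a quadratic equation that fails as soon as two of its
    rows differ by a constant (K33_parallel_rows); by the pigeonhole principle K_{3,5}
    and K_7 contain such a K_{3,3}.

    Embeddings. Vertices are placed in the directions of integer vectors, edges are
    geodesic segments, and disjointness is again a matter of signs of determinants
    (geodesic_embedding). This gives the join of an edge and a path on the sphere, and
    K_6 with two more vertices of degree two on the projective plane.

    Rings. Units are adjacent to everything, so three units and five more elements form
    a K_{3,5}: a ring with at least eight elements has at most two units. With a single
    unit the ring is Boolean; then either it has eight elements and its graph is planar,
    or 1 is a sum of four orthogonal idempotents and the graph contains a subdivided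
    K_{3,5}. With two units, an idempotent f whose corner fR is smallest among those
    with two units has a local corner with at most four elements, and the complementary
    corner is Boolean with at most two elements, by another K_{3,5}; this is the common
    shape (frame) of the two rings of order eight. Below eight elements, rings of order
    at most four and of order six have planar graphs, the ring of order seven has the
    graph K_7, and the ring of order five has the graph K_5, which is projective. *)

Set Implicit Arguments.
Unset Strict Implicit.
Unset Printing Implicit Defensive.

Import Order.TTheory GRing.Theory Num.Theory.
Import numFieldNormedType.Exports.

(** * Parity of crossings for sign vectors of points in general position *)

(** The sign pattern (true for negative) of six nonzero numbers such that x * y - z * w
    + u * v = 0: the three terms cannot all have the same sign. *)
Definition gp (x y z w u v : bool) :=
  ~~ ((x (+) y == ~~ (z (+) w)) && (x (+) y == u (+) v)).

(** Signs of determinants, abstracted: chi is the orientation of three of the signed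
    points J, opp the antipodal map, and key forgets the sign. In general position, chi
    is alternating, changes sign with each point, and obeys the three-term
    Grassmann-Pluecker relations; everything in this part follows from that. *)
Section Chirotope.
Variables (I : eqType) (J : Type) (key : J -> I) (opp : J -> J).
Variable chi : J -> J -> J -> bool.
Implicit Types (a b c d e x o : J) (s t : seq J).

Definition apart s := uniq (map key s).

Hypothesis keyN : forall a, key (opp a) = key a.
Hypothesis chiC : forall a b c, apart [:: a; b; c] -> chi b a c = ~~ chi a b c.
Hypothesis chiA : forall a b c, apart [:: a; b; c] -> chi a c b = ~~ chi a b c.
Hypothesis chiN : forall a b c, apart [:: a; b; c] ->
  chi (opp a) b c = ~~ chi a b c.
Hypothesis chiGP : forall a b c d e, apart [:: a; b; c; d; e] ->
  gp (chi a b c) (chi a d e) (chi a b d) (chi a c e) (chi a b e) (chi a c d).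

Lemma apart_perm s t : perm_eq (map key s) (map key t) -> apart s -> apart t.
Proof. by move=> /perm_uniq; rewrite /apart => ->. Qed.

Lemma chi_perm a b c : apart [:: a; b; c] ->
  ((chi a c b = ~~ chi a b c) * (chi b a c = ~~ chi a b c) *
  (chi b c a = chi a b c) * (chi c a b = chi a b c) *
  (chi c b a = ~~ chi a b c))%type.
Proof.
move=> u.
have u2 : apart [:: b; a; c].
  by apply: apart_perm u; apply/permPl/(perm_catCA [:: _] [:: _]).
have u3 : apart [:: a; c; b].
  by apply: apart_perm u; apply/permPl/(perm_catl [:: _])/permPl/(perm_catC [:: _] [:: _]).
have u4 : apart [:: b; c; a].
  by apply: apart_perm u; apply/permPl/(perm_catC [:: _] [:: _; _]).
rewrite (chiC u) (chiA u) (chiC u3) (chiA u2) (chiC u4) (chiA u2) (chiA u).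
by rewrite (chiC u) !negbK.
Qed.

Lemma chi_opp a b c : apart [:: a; b; c] ->
  ((chi (opp a) b c = ~~ chi a b c) * (chi a (opp b) c = ~~ chi a b c) *
   (chi a b (opp c) = ~~ chi a b c))%type.
Proof.
move=> u; have [[[[u1 u2] u3] u4] u5] := chi_perm u.
rewrite chiN //; split; first split=> //.
  have v : apart [:: b; a; c].
    by apply: apart_perm u; apply/permPl/(perm_catCA [:: _] [:: _]).
  have v' : apart [:: opp b; a; c] by rewrite /apart /= keyN.
  by have [[[[_ ->] _] _] _] := chi_perm v'; rewrite chiN // u2 !negbK.
have v : apart [:: c; a; b].
  by apply: apart_perm u; apply/permPl/(perm_catC [:: _; _] [:: _]).
have v' : apart [:: opp c; a; b] by rewrite /apart /= keyN.
by have [[[[_ _] ->] _] _] := chi_perm v'; rewrite chiN // u4.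
Qed.

Lemma apart5 a b c d e : apart [:: a; b; c; d; e] ->
  (apart [:: a; b; c] * apart [:: a; b; d] * apart [:: a; b; e] *
   apart [:: a; c; d] * apart [:: a; c; e] * apart [:: a; d; e] *
   apart [:: b; c; d] * apart [:: b; c; e] * apart [:: b; d; e] *
   apart [:: c; d; e])%type.
Proof.
rewrite /apart /= !inE !negb_or.
by case/and5P=> /and4P[-> -> -> ->] /and3P[-> -> ->] /andP[-> ->] -> _.
Qed.

Lemma apart4 a b c d : apart [:: a; b; c; d] ->
  (apart [:: a; b; c] * apart [:: a; b; d] * apart [:: a; c; d] *
   apart [:: b; c; d])%type.
Proof.
rewrite /apart /= !inE !negb_or.
by case/and4P=> /and3P[-> -> ->] /andP[-> ->] -> _.
Qed.

(** The relations on five points, with every triple in increasing order; in this form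
    they enter the finite checks below. *)
Lemma chiGP5 a b c d e : apart [:: a; b; c; d; e] ->
  [/\ gp (chi a b c) (chi a d e) (chi a b d) (chi a c e) (chi a b e) (chi a c d),
      gp (chi a b c) (chi b d e) (chi a b d) (chi b c e) (chi a b e) (chi b c d),
      gp (chi a b c) (chi c d e) (chi a c d) (chi b c e) (chi a c e) (chi b c d),
      gp (chi a b d) (chi c d e) (chi a c d) (chi b d e) (chi a d e) (chi b c d) &
      gp (chi a b e) (chi c d e) (chi a c e) (chi b d e) (chi a d e) (chi b c e)].
Proof.
move=> u; have [[[[[[[[[u1 u2] u3] u4] u5] u6] u7] u8] u9] u10] := apart5 u.
have gpb : apart [:: b; a; c; d; e].
  by apply: apart_perm u; apply/permPl/(perm_catCA [:: _] [:: _]).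
have gpc : apart [:: c; a; b; d; e].
  by apply: apart_perm u; apply/permPl/(perm_catCA [:: _; _] [:: _]).
have gpd : apart [:: d; a; b; c; e].
  by apply: apart_perm u; apply/permPl/(perm_catCA [:: _; _; _] [:: _]).
have gpe : apart [:: e; a; b; c; d].
  by apply: apart_perm u; apply/permPl/(perm_catC [:: _; _; _; _] [:: _]).
move: (chiGP u) (chiGP gpb) (chiGP gpc) (chiGP gpd) (chiGP gpe).
rewrite !(chi_perm u1) !(chi_perm u2) !(chi_perm u3) !(chi_perm u4).
rewrite !(chi_perm u5) !(chi_perm u6) !(chi_perm u7) !(chi_perm u8).
rewrite !(chi_perm u9) !(chi_perm u10) /gp.
move=> h1 h2 h3 h4 h5; split; [move: h1|move: h2|move: h3|move: h4|move: h5];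
by do 6?[case: (chi _ _ _)].
Qed.

(** Whether the geodesic segments ab and cd on the sphere cross: each separates the ends
    of the other, and the third condition rules out that ab meets the antipode of cd. *)
Definition XS a b c d :=
  [&& chi b c d == ~~ chi a c d, chi a b d == ~~ chi a b c
    & chi b c d != chi a b d].

Definition in_tri a b e x :=
  [&& chi x b e == chi a b e, chi a x e == chi a b e & chi a b x == chi a b e].

(** A segment crosses the boundary of a triangle an odd number of times exactly if one
    of its ends is inside. Five points have ten orientations, so this is a finite check. *)
Lemma XS_triangle a b e c d : apart [:: a; b; e; c; d] ->
  XS a b c d (+) XS b e c d (+) XS a e c d = in_tri a b e c (+) in_tri a b e d.
Proof.
move=> u; have [[[[[[[[[u1 u2] u3] u4] u5] u6] u7] u8] u9] u10] := apart5 u.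
case: (chiGP5 u); rewrite /XS /in_tri.
rewrite ?(chi_perm u1) ?(chi_perm u2) ?(chi_perm u3) ?(chi_perm u4).
rewrite ?(chi_perm u5) ?(chi_perm u6) ?(chi_perm u7) ?(chi_perm u8).
rewrite ?(chi_perm u9) ?(chi_perm u10) /gp.
move: (chi a b e) (chi a b c) (chi a b d) (chi a e c) (chi a e d).
move: (chi a c d) (chi b e c) (chi b e d) (chi b c d) (chi e c d).
by clear; move=> [] [] [] [] [] [] [] [] [] [].
Qed.

Lemma XS_sym a b c d : apart [:: a; b; c; d] -> XS a b c d = XS c d a b.
Proof.
move=> u; have [[[u1 u2] u3] u4] := apart4 u; rewrite /XS.
rewrite ?(chi_perm u1) ?(chi_perm u2) ?(chi_perm u3) ?(chi_perm u4).
by do 4![case: (chi _ _ _)].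
Qed.

Lemma XS_opp a b c d : apart [:: a; b; c; d] ->
  XS (opp a) (opp b) c d = XS a b (opp c) (opp d).
Proof.
move=> u; have [[[u1 u2] u3] u4] := apart4 u.
rewrite /XS !(chi_opp u3) !(chi_opp u4).
have u1' : apart [:: opp a; b; c] by rewrite /apart /= keyN.
have u2' : apart [:: opp a; b; d] by rewrite /apart /= keyN.
have u3' : apart [:: a; opp c; d] by rewrite /apart /= !keyN.
have u4' : apart [:: b; opp c; d] by rewrite /apart /= !keyN.
rewrite ?(chi_opp u1) ?(chi_opp u2) (chi_opp u1') (chi_opp u2') (chi_opp u3') (chi_opp u4').
rewrite ?(chi_opp u1) ?(chi_opp u2) ?(chi_opp u3) ?(chi_opp u4).
by do 4![case: (chi _ _ _)].
Qed.

(** The geodesic drawing of K_5 on five points of the sphere in general position has an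
    odd number of crossings of independent edges. *)
Lemma XS_K5 a b c d e : apart [:: a; b; c; d; e] ->
  \big[addb/false]_(X <- [:: XS a b c d; XS a c b d; XS a d b c;
     XS a b c e; XS a c b e; XS a e b c; XS a b d e; XS a d b e; XS a e b d;
     XS a c d e; XS a d c e; XS a e c d; XS b c d e; XS b d c e; XS b e c d]) X.
Proof.
move=> u; have [[[[[[[[[u1 u2] u3] u4] u5] u6] u7] u8] u9] u10] := apart5 u.
case: (chiGP5 u); rewrite !big_cons big_nil /XS.
rewrite ?(chi_perm u1) ?(chi_perm u2) ?(chi_perm u3) ?(chi_perm u4).
rewrite ?(chi_perm u5) ?(chi_perm u6) ?(chi_perm u7) ?(chi_perm u8).
rewrite ?(chi_perm u9) ?(chi_perm u10) /gp.
move: (chi a b c) (chi a b d) (chi a b e) (chi a c d) (chi a c e).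
move: (chi a d e) (chi b c d) (chi b c e) (chi b d e) (chi c d e).
by clear; move=> [] [] [] [] [] [] [] [] [] [].
Qed.

Variable tw : bool.

(** In the projective plane (tw holds) the segment cd has two lifts to the sphere, and
    ab may cross either one. *)
Definition Xtw a b c d := XS a b c d (+) tw && XS a b (opp c) (opp d).

Lemma Xtw_sym a b c d : apart [:: a; b; c; d] -> Xtw a b c d = Xtw c d a b.
Proof.
move=> u; rewrite /Xtw XS_sym // -XS_opp //; congr (_ (+) _ && _).
by rewrite XS_sym // /apart /= !keyN.
Qed.

Definition in_tw a b e x := in_tri a b e x (+) tw && in_tri a b e (opp x).

Lemma Xtw_triangle a b e c d : apart [:: a; b; e; c; d] ->
  Xtw a b c d = Xtw b e c d (+) Xtw a e c d (+) (in_tw a b e c (+) in_tw a b e d).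
Proof.
move=> u; have v : apart [:: a; b; e; opp c; opp d] by rewrite /apart /= !keyN.
have := XS_triangle u; have := XS_triangle v; rewrite /Xtw /in_tw.
case: tw => /=; last first.
  move=> _; case: (XS a b c d) => /= E; rewrite ?addbF -E;
  by case: (XS b e c d) (XS a e c d) => [] [].
rewrite (addbACA (in_tri _ _ _ _)) => <- <-.
by do 6![case: (XS _ _ _ _)].
Qed.

Fixpoint crossings1 a b d t :=
  if t is d' :: t' then Xtw a b d d' (+) crossings1 a b d' t' else false.

Fixpoint crossings c s d t :=
  if s is c' :: s' then crossings1 c c' d t (+) crossings c' s' d t else false.

Definition stepwise c s := path (fun a b => key a != key b) c s.

Definition keydisj s t := all (fun a => all (fun b => key a != key b) t) s.

Arguments keydisj : simpl never.

Lemma keydisj_consr s d t :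
  keydisj s (d :: t) = keydisj s [:: d] && keydisj s t.
Proof.
rewrite /keydisj -all_predI; apply: eq_all => a /=; by rewrite andbT.
Qed.

(** The triangle law along a polygon; the inner points cancel. *)
Lemma cross1_triangle a b e d t : apart [:: a; b; e] -> stepwise d t ->
    keydisj [:: a; b; e] (d :: t) ->
  crossings1 a b d t = crossings1 b e d t (+) crossings1 a e d t
     (+) (in_tw a b e d (+) in_tw a b e (last d t)).
Proof.
move=> u; elim: t d => [|d' t IH] d /=; first by rewrite addbb.
case/andP => dd' lt; rewrite keydisj_consr (keydisj_consr _ d') => /and3P[sd sd' st].
rewrite IH; [|exact: lt|by rewrite (keydisj_consr _ d') sd' st].
rewrite (@Xtw_triangle a b e d d'); last first.
  move: u sd sd' dd'; rewrite /keydisj /apart /= !inE !negb_or !andbT /=.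
  by case/andP=> /andP[-> ->] -> /and3P[-> -> ->] /and3P[-> -> ->] ->.
move: (Xtw _ _ _ _) (Xtw _ _ _ _) (crossings1 _ _ _ _) (crossings1 _ _ _ _).
move: (in_tw _ _ _ d) (in_tw _ _ _ d') (in_tw _ _ _ (last _ _)).
by move=> [] [] [] [] [] [] [].
Qed.

(** Up to parity, the number of triangles of the cone with apex o over the polygon that
    contain x. *)
Fixpoint winding o c s x :=
  if s is c' :: s' then in_tw c c' o x (+) winding o c' s' x else false.

(** Each step of the polygon is one side of a triangle with apex o. In the sum of the
    triangle laws the sides through o cancel, except the first and the last. *)
Lemma cross_cone o c s d t : stepwise c s -> stepwise d t ->
    keydisj [:: o] (c :: s) -> keydisj (o :: c :: s) (d :: t) ->
  crossings c s d t = crossings1 c o d t (+) crossings1 (last c s) o d t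
     (+) (winding o c s d (+) winding o c s (last d t)).
Proof.
move=> + lt; elim: s c => [|c' s IH] c /=; first by rewrite !addbb.
case/andP => cc' ls; rewrite /keydisj /= !andbT => /and3P[oc oc' os].
case/and4P => od cd c'd sd.
rewrite IH //=; last 2 first.
- by rewrite /keydisj /= oc' os.
- by rewrite /keydisj /= od c'd sd.
rewrite (@cross1_triangle c c' o) //; last 2 first.
- by rewrite /apart /= !inE negb_or cc' ![_ == key o]eq_sym oc oc'.
- by rewrite /keydisj /= cd c'd od.
move: (crossings1 _ _ _ _) (crossings1 _ _ _ _) (crossings1 _ _ _ _).
move: (in_tw _ _ _ d) (in_tw _ _ _ (last _ _)).
move: (winding _ _ _ d) (winding _ _ _ (last d t)).
by move=> [] [] [] [] [] [] [].
Qed.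

(** The segments from b and from its antipode to o form half a great circle, a closed
    line of the projective plane. A path crosses this line an odd number of times
    exactly if its lift passes from one side of the great circle to the other. *)
Lemma cross1_line b o d t : tw -> key b != key o -> stepwise d t ->
    keydisj [:: b; o] (d :: t) ->
  crossings1 (opp b) o d t (+) crossings1 b o d t = chi b o d (+) chi b o (last d t).
Proof.
move=> htw bo; elim: t d => [|d' t IH] d /=; first by rewrite addbb.
case/andP => dd' lt; rewrite keydisj_consr (keydisj_consr _ d') => /and3P[sd sd' st].
have {}IH := IH _ lt; rewrite keydisj_consr sd' st in IH.
rewrite addbACA IH // /Xtw htw /=.
have u : apart [:: b; o; d; d'].
  move: sd sd' dd'; rewrite /keydisj /apart /= !inE !negb_or !andbT bo /=.
  by case/andP=> -> -> /andP[-> ->] ->.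
have v : apart [:: b; o; opp d; d'] by rewrite /apart /= keyN.
have [[[u1 u2] u3] u4] := apart4 u; have [[[v1 v2] v3] v4] := apart4 v.
rewrite /XS ?(chi_opp v1) ?(chi_opp v2) ?(chi_opp v3) ?(chi_opp v4).
have w : apart [:: opp b; o; opp d; d'] by rewrite /apart /= !keyN.
have [[[w1 w2] w3] w4] := apart4 w.
rewrite ?(chi_opp w1) ?(chi_opp w2) ?(chi_opp w3) ?(chi_opp w4).
rewrite ?(chi_opp v1) ?(chi_opp v2) ?(chi_opp v3) ?(chi_opp v4).
have x : apart [:: opp b; o; d; d'] by rewrite /apart /= !keyN.
have [[[x1 x2] x3] x4] := apart4 x.
rewrite ?(chi_opp x1) ?(chi_opp x2) ?(chi_opp x3) ?(chi_opp x4).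
rewrite ?(chi_opp u1) ?(chi_opp u2) ?(chi_opp u3) ?(chi_opp u4).
move: (chi b o (last _ _)); move: (chi _ _ _) (chi _ _ _) (chi _ _ _) (chi _ _ _).
by move=> [] [] [] [] [].
Qed.

Definition sgn (y : bool) a := if y then opp a else a.

Lemma key_sgn y a : key (sgn y a) = key a.
Proof. by case: y => //=; rewrite keyN. Qed.

Lemma in_tw_opp a b e x : tw -> apart [:: a; b; e; x] ->
  in_tw a b e (opp x) = in_tw a b e x.
Proof.
rewrite /in_tw => -> /= u; rewrite addbC; congr (_ (+) _).
have [[[u1 u2] u3] u4] := apart4 u.
have v : apart [:: a; b; e; opp x] by rewrite /apart /= keyN.
have [[[v1 v2] v3] v4] := apart4 v.
have w : apart [:: a; b; e; opp (opp x)] by rewrite /apart /= !keyN.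
have [[[w1 w2] w3] w4] := apart4 w.
rewrite /in_tri ?(chi_perm w1) ?(chi_perm w2) ?(chi_perm w3) ?(chi_perm w4).
rewrite ?(chi_opp v1) ?(chi_opp v2) ?(chi_opp v3) ?(chi_opp v4).
rewrite ?(chi_opp u1) ?(chi_opp u2) ?(chi_opp u3) ?(chi_opp u4).
rewrite ?(chi_perm u1) ?(chi_perm u2) ?(chi_perm u3) ?(chi_perm u4).
by rewrite !negbK.
Qed.

Lemma winding_opp o c s x : tw -> stepwise c s ->
    keydisj [:: o] (c :: s) -> keydisj (o :: c :: s) [:: x] ->
  winding o c s (opp x) = winding o c s x.
Proof.
move=> htw; elim: s c => [|c' s IH] c //=.
rewrite /keydisj /= !andbT => /andP[cc' ls] /and3P[oc oc' os] /and4P[ox cx c'x sx].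
rewrite IH //=; last 2 first.
- by rewrite /keydisj /= oc' os.
- by rewrite /keydisj /= ox c'x sx.
congr (_ (+) _); apply: in_tw_opp => //.
by rewrite /apart /= !inE !negb_or cc' ![_ == key o]eq_sym oc oc' cx c'x ox.
Qed.

(** The cost, near x, of replacing the polygon from c to c1 (up to the sign y) by a
    segment. It depends on the polygon and on x only, which is why such terms can cancel
    when all edges of a graph are considered together. *)
Definition defect o c s y c1 x :=
  winding o c s x (+) winding o c [:: c1] x (+) y && chi c1 o x.

Lemma all_last (p : pred J) c s : all p (c :: s) -> p (last c s).
Proof. by elim: s c => [|c' s IH] c /= /andP[// pc]; apply: IH. Qed.

Lemma keydisj_last s d t :
  keydisj s (d :: t) -> keydisj s [:: last d t].
Proof. by apply: sub_all => a /all_last /= ->. Qed.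

(** The polygon and the segment that replaces it bound cones with the same apex o, so by
    cross_cone they differ by winding numbers at the two ends of the other polygon. If y
    holds then the cones end at antipodal points; the difference is a projective line,
    and by cross1_line it depends on whether the other lift ends on the same side,
    whence y && z. *)
Lemma cross_straighten o c s (y : bool) c1 d t (z : bool) d1 :
    (y -> tw) -> (z -> tw) -> last c s = sgn y c1 -> last d t = sgn z d1 ->
    stepwise c s -> stepwise d t -> key c != key c1 ->
    keydisj [:: o] (c :: s) -> keydisj (o :: c :: s) (d :: t) ->
  crossings c s d t = crossings1 c c1 d t (+) (y && z) (+)
     (defect o c s y c1 d (+) defect o c s y c1 d1).
Proof.
move=> hy hz cE dE lc ld cc1 so sd.
have oc1 : key o != key c1.
  by have /andP[/(@all_last (fun b => key o != key b)) + _] := so; rewrite cE key_sgn.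
have oc : key o != key c by have /andP[/andP[] ] := so.
have c1d : all (fun b => key c1 != key b) (d :: t).
  move: sd; rewrite /keydisj => /andP[_ /all_last].
  by rewrite cE; apply: sub_all => b; rewrite key_sgn.
have od : all (fun b => key o != key b) (d :: t) by have /andP[] := sd.
have cd : all (fun b => key c != key b) (d :: t) by have /and3P[] := sd.
have so1 : keydisj [:: o] [:: c; c1] by rewrite /keydisj /= oc oc1.
have sd1 : keydisj [:: o; c; c1] (d :: t) by rewrite /keydisj /= in od cd c1d *; rewrite od cd c1d.
have := @cross_cone o c [:: c1] d t; rewrite (cross_cone lc ld so sd) cE.
rewrite [stepwise c [:: c1]]/= cc1 => /(_ isT ld so1 sd1) /=.
rewrite [X in X = _]addbF => ->; rewrite !addbF dE /defect.
have wl o' c' s' : stepwise c' s' -> keydisj [:: o'] (c' :: s') ->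
    keydisj (o' :: c' :: s') (d :: t) ->
    winding o' c' s' (sgn z d1) = winding o' c' s' d1.
  move=> l1 l2 /keydisj_last; rewrite dE; case: (z) hz => //= /(_ isT) htw h3.
  apply: winding_opp => //; move: h3; apply: sub_all => b; by rewrite /= keyN.
rewrite wl //.
have := wl o c [:: c1]; rewrite /= cc1 !addbF => ->//.
have cc1o : apart [:: c1; o; d1].
  rewrite /apart /= !inE negb_or eq_sym oc1 /=.
  have := all_last c1d; have := all_last od; rewrite dE !key_sgn.
  by move=> /= -> ->.
case: (y) hy cE => /= [/(_ isT) htw|_] cE.
  have c1o : key c1 != key o by rewrite eq_sym.
  have sco : keydisj [:: c1; o] (d :: t) by rewrite /keydisj /= in od c1d *; rewrite od c1d.
  have := cross1_line htw c1o ld sco; rewrite dE.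
  have -> : chi c1 o (sgn z d1) = z (+) chi c1 o d1.
    by case: (z) => //=; rewrite (chi_opp cc1o).
  move: (crossings1 (opp c1) o d t) (crossings1 c1 o d t) (crossings1 c o d t) => X Y Z E.
  have -> : X = Y (+) (chi c1 o d (+) (z (+) chi c1 o d1)) by rewrite -E addbC addbK.
  move: (in_tw _ _ _ _) (in_tw _ _ _ _) (winding _ _ _ _) (winding _ _ _ _).
  by case: X Y Z (z) (chi _ _ _) (chi _ _ _) {E} => [] [] [] [] [] [] [] [] [] [].
move: (crossings1 (opp c1) o d t) (crossings1 c1 o d t) (crossings1 c o d t) => X Y Z.
move: (in_tw _ _ _ _) (in_tw _ _ _ _) (winding _ _ _ _) (winding _ _ _ _).
by case: Y Z => [] [] [] [] [] [].
Qed.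

(** Four points of the projective plane: the crossings of the three pairs of opposite
    sides sum to a value that depends on the orientations of the triangles alone. *)
Lemma Xtw_apart4 a b c d : tw -> apart [:: a; b; c; d] ->
  Xtw a c b d (+) Xtw a d b c =
  ~~ (Xtw a b c d (+) (chi b c d (+) chi a c d) (+) (chi a b d (+) chi a b c)).
Proof.
move=> htw u; have [[[u1 u2] u3] u4] := apart4 u; rewrite /Xtw htw /=.
have E a1 b1 c1 d1 : apart [:: a1; b1; c1; d1] ->
    XS a1 b1 c1 d1 (+) XS a1 b1 (opp c1) (opp d1) =
    (chi b1 c1 d1 (+) chi a1 c1 d1) && (chi a1 b1 d1 (+) chi a1 b1 c1).
  move=> v; have [[[v1 v2] v3] v4] := apart4 v; rewrite /XS.
  have w3 : apart [:: a1; opp c1; d1] by rewrite /apart /= !keyN.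
  have w4 : apart [:: b1; opp c1; d1] by rewrite /apart /= !keyN.
  rewrite ?(chi_opp w3) ?(chi_opp w4).
  rewrite ?(chi_opp v1) ?(chi_opp v2) ?(chi_opp v3) ?(chi_opp v4).
  by do 4![case: (chi _ _ _)].
have p : apart [:: a; c; b; d].
  by apply: apart_perm u; apply/permPl/(perm_catl [:: _])/permPl/(perm_catCA [:: _] [:: _]).
have q : apart [:: a; d; b; c].
  by apply: apart_perm u; apply/permPl/(perm_catl [:: _])/permPl/(perm_catC [:: _; _] [:: _]).
rewrite !E // ?(chi_perm u1) ?(chi_perm u2) ?(chi_perm u3) ?(chi_perm u4).
by do 4![case: (chi _ _ _)].
Qed.

(** For two rows c and c', Xtw_apart4 trades the six crossings between their edges for
    the crossings of the segment cc' with the triangle of the columns, up to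
    orientations and three negations. The three segments cc' form a triangle as well,
    and two triangles cross an even number of times. Every orientation appears twice,
    and what remains are nine negations. *)
Lemma Xtw_K33 a a' a'' b b' b'' : tw -> apart [:: a; a'; a''; b; b'; b''] ->
  \big[addb/false]_(X <- [::
    Xtw a b a' b'; Xtw a b' a' b; Xtw a b a' b''; Xtw a b'' a' b;
    Xtw a b' a' b''; Xtw a b'' a' b';
    Xtw a b a'' b'; Xtw a b' a'' b; Xtw a b a'' b''; Xtw a b'' a'' b;
    Xtw a b' a'' b''; Xtw a b'' a'' b';
    Xtw a' b a'' b'; Xtw a' b' a'' b; Xtw a' b a'' b''; Xtw a' b'' a'' b;
    Xtw a' b' a'' b''; Xtw a' b'' a'' b']) X.
Proof.
move=> htw u.
have regroup (x1 x2 x3 y1 y2 y3 z1 z2 z3 : bool) :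
    (x1 (+) (z1 (+) y1)) (+) (x2 (+) (z2 (+) y2)) (+) (x3 (+) (z3 (+) y3)) =
    (x1 (+) x2 (+) x3) (+) ((y1 (+) y2 (+) y3) (+) (z1 (+) z2 (+) z3)).
  by case: x1 x2 x3 y1 y2 y3 z1 z2 z3 => [] [] [] [] [] [] [] [] [].
have pair c c' : apart [:: c; c'; b; b'] -> apart [:: c; c'; b; b''] ->
    apart [:: c; c'; b'; b''] ->
  \big[addb/false]_(X <- [:: Xtw c b c' b'; Xtw c b' c' b; Xtw c b c' b'';
    Xtw c b'' c' b; Xtw c b' c' b''; Xtw c b'' c' b']) X =
  ~~ ((Xtw c c' b b' (+) Xtw c c' b b'' (+) Xtw c c' b' b'') (+)
   ((chi c b b' (+) chi c b b'' (+) chi c b' b'') (+)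
    (chi c' b b' (+) chi c' b b'' (+) chi c' b' b''))).
  move=> u4 u5 u6; rewrite !big_cons big_nil.
  have -> (x1 x2 x3 x4 x5 x6 : bool) :
      x1 (+) (x2 (+) (x3 (+) (x4 (+) (x5 (+) (x6 (+) false))))) =
      (x1 (+) x2) (+) ((x3 (+) x4) (+) (x5 (+) x6)) by rewrite addbF !addbA.
  rewrite (Xtw_apart4 htw u4) (Xtw_apart4 htw u5) (Xtw_apart4 htw u6) -regroup.
  move: (chi c c' b) (chi c c' b') (chi c c' b'').
  move: (Xtw c c' b b' (+) _) (Xtw c c' b b'' (+) _) (Xtw c c' b' b'' (+) _).
  by move=> [] [] [] [] [] [].
have e1 := @pair a a'; have e2 := @pair a a''; have e3 := @pair a' a''.
move: e1 e2 e3 (u); rewrite /apart /= !inE !negb_or.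
move=> + + + /and5P[/and5P[h1 h2 h3 h4 h5] /and4P[h6 h7 h8 h9] /and3P[h10 h11 h12]
  /andP[h13 h14] h15].
rewrite ?h1 ?h2 ?h3 ?h4 ?h5 ?h6 ?h7 ?h8 ?h9 ?h10 ?h11 ?h12 ?h13 ?h14 ?h15.
move=> /(_ isT isT isT) e1 /(_ isT isT isT) e2 /(_ isT isT isT) e3.
have split6 (x1 x2 x3 x4 x5 x6 : bool) (r : seq bool) :
    \big[addb/false]_(X <- [:: x1, x2, x3, x4, x5, x6 & r]) X =
    \big[addb/false]_(X <- [:: x1; x2; x3; x4; x5; x6]) X
      (+) \big[addb/false]_(X <- r) X.
  by rewrite -big_cat.
rewrite split6 e1 split6 e2 e3.
have tri c c' : apart [:: a; a'; a''; c; c'] -> 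
  Xtw a a' c c' = Xtw a' a'' c c' (+) Xtw a a'' c c' (+) (in_tw a a' a'' c (+) in_tw a a' a'' c').
  exact: Xtw_triangle.
have [v1 v2 v3] : [/\ apart [:: a; a'; a''; b; b'], apart [:: a; a'; a''; b; b''] & apart [:: a; a'; a''; b'; b'']].
  rewrite /apart /= !inE !negb_or.
  by rewrite ?h1 ?h2 ?h3 ?h4 ?h5 ?h6 ?h7 ?h8 ?h9 ?h10 ?h11 ?h12 ?h13 ?h14 ?h15.
rewrite (tri _ _ v1) (tri _ _ v2) (tri _ _ v3).
move: (chi a b b' (+) chi a b b'' (+) chi a b' b'') => q1.
move: (chi a' b b' (+) chi a' b b'' (+) chi a' b' b'') => q2.
move: (chi a'' b b' (+) chi a'' b b'' (+) chi a'' b' b'') => q3.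
have sum0 (x1 x2 x3 z1 z2 z3 i1 i2 i3 : bool) :
  ((x1 (+) z1 (+) (i1 (+) i2)) (+) (x2 (+) z2 (+) (i1 (+) i3))
     (+) (x3 (+) z3 (+) (i2 (+) i3))) = (x1 (+) x2 (+) x3) (+) (z1 (+) z2 (+) z3).
  by case: x1 x2 x3 z1 z2 z3 i1 i2 i3 => [] [] [] [] [] [] [] [] [].
rewrite sum0; move: (_ (+) _ (+) Xtw a' _ _ _) (_ (+) _ (+) Xtw a _ _ _).
by case: q1 q2 q3 => [] [] [] [] [].
Qed.

Lemma keydisjC s t : keydisj s t = keydisj t s.
Proof.
elim: s => [|a s IH]; first by rewrite /keydisj /= all_predT.
rewrite keydisj_consr -IH /keydisj /=; congr (_ && _).
by apply: eq_all => b; rewrite andbT eq_sym.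
Qed.

Lemma cross_sym c s d t : stepwise c s -> stepwise d t ->
  keydisj (c :: s) (d :: t) -> crossings c s d t = crossings d t c s.
Proof.
have seg a b d1 t1 : key a != key b -> stepwise d1 t1 ->
    keydisj [:: a; b] (d1 :: t1) -> crossings1 a b d1 t1 = crossings d1 t1 a [:: b].
  move=> ab; elim: t1 d1 => [|d2 t1 IH] d1 //= /andP[d12 l].
  rewrite keydisj_consr (keydisj_consr _ d2) => /and3P[sd1 sd2 st].
  rewrite -IH //; last by rewrite (keydisj_consr _ d2) sd2.
  rewrite addbF; congr (_ (+) _); apply: Xtw_sym.
  move: sd1 sd2; rewrite /keydisj /apart /= !inE !negb_or ab d12 !andbT.
  by move=> /andP[-> ->] /andP[-> ->].
have nilr d1 t1 a : crossings d1 t1 a [::] = false by elim: t1 d1 => [|d2 t1 IH] d1 //=.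
have consr d1 t1 a b r : crossings d1 t1 a (b :: r) = crossings d1 t1 a [:: b] (+) crossings d1 t1 b r.
  by elim: t1 d1 => [|d2 t1 IH] d1 //=; rewrite IH addbF addbACA.
move=> + ld; elim: s c => [|c' s IH] c; first by rewrite nilr.
rewrite consr => /andP[cc' lc] /and3P[sc sc' ss] /=.
rewrite seg //; last by apply/and3P.
by rewrite IH //; apply/andP.
Qed.

Lemma keydisj_cat1 o s t : keydisj (o :: s) t = keydisj [:: o] t && keydisj s t.
Proof. by rewrite /keydisj /= andbT. Qed.

(** Both polygons straightened, one after the other. *)
Lemma cross_eq o c s (y : bool) c1 d t (z : bool) d1 :
    (y -> tw) -> (z -> tw) -> last c s = sgn y c1 -> last d t = sgn z d1 ->
    stepwise c s -> stepwise d t -> key c != key c1 -> key d != key d1 ->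
    keydisj [:: o] (c :: s) -> keydisj [:: o] (d :: t) ->
    keydisj (c :: s) (d :: t) ->
  crossings c s d t = Xtw c c1 d d1 (+) (y && z) (+)
     ((defect o c s y c1 d (+) defect o c s y c1 d1) (+)
      (defect o d t z d1 c (+) defect o d t z d1 c1)).
Proof.
move=> hy hz cE dE lc ld cc1 dd1 oc od cd.
have c1d : keydisj [:: c1] (d :: t).
  have := keydisj_last (s := d :: t) (d := c) (t := s).
  rewrite keydisjC => /(_ cd); rewrite cE keydisjC /keydisj /=.
  by rewrite key_sgn.
have oc1 : keydisj [:: o] [:: c1].
  by have := keydisj_last oc; rewrite cE /keydisj /= key_sgn.
have cd' : keydisj [:: c; c1] (d :: t).
  rewrite keydisj_cat1 c1d andbT; move: cd; rewrite keydisj_cat1.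
  by case/andP.
have od1 : keydisj [:: o; c; c1] (d :: t) by rewrite keydisj_cat1 od.
have oc' : keydisj [:: o] [:: c; c1].
  by move: oc; rewrite keydisj_consr => /andP[c0 _]; rewrite (keydisj_consr _ c) c0.
have lcc1 : stepwise c [:: c1] by rewrite /stepwise /= cc1.
rewrite (@cross_straighten o c s y c1 d t z d1) //; last by rewrite keydisj_cat1 od.
have -> : crossings1 c c1 d t = crossings d t c [:: c1].
  by rewrite cross_sym ?[keydisj (d :: t) _]keydisjC //= addbF.
rewrite (@cross_straighten o d t z d1 c [:: c1] false c1) //; last first.
  by rewrite keydisj_cat1 oc' keydisjC.
rewrite andbF addbF /= addbF (@Xtw_sym d d1); last first.

  have := keydisj_last c1d; have := keydisj_last cd'; rewrite dE.
  move: cd'; rewrite keydisj_consr /keydisj /apart /= !key_sgn !inE !negb_or !andbT.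
  by move=> /andP[/andP[h1 h2] _] /andP[h3 _] h4; rewrite dd1 cc1 ![_ == key c]eq_sym ![_ == key c1]eq_sym h1 h2 h3 h4.
move: (Xtw _ _ _ _) (y && z) (defect _ _ _ _ _ d) (defect _ _ _ _ _ d1).
move: (defect _ _ _ _ _ c) (defect _ _ _ _ _ c1).
by move=> [] [] [] [] [] [].
Qed.

(** The edge-vertex pairs at which straightening all the pairs of L leaves a defect. *)
Definition ends (L : seq ((nat * nat) * (nat * nat))) :=
  flatten [seq [:: (p.1, p.2.1); (p.1, p.2.2); (p.2, p.1.1); (p.2, p.1.2)]
              | p <- L].

(** The parity argument of van Kampen: if every pair of edges in L is drawn without
    crossing and every edge-vertex pair occurs twice in ends L, then the defects cancel,
    and the segments between the vertices cross according to the bits y alone. *)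
Lemma parity (v : nat -> J) (s : nat * nat -> seq J) (y : nat * nat -> bool)
    o (E : seq (nat * nat)) (L : seq ((nat * nat) * (nat * nat)))
    (D : seq ((nat * nat) * nat)) :
  (forall e : nat * nat, e \in E -> [/\ y e -> tw, last (v e.1) (s e) = sgn (y e) (v e.2),
     stepwise (v e.1) (s e), key (v e.1) != key (v e.2) &
     keydisj [:: o] (v e.1 :: s e)]) ->
  (forall p, p \in L -> [/\ p.1 \in E, p.2 \in E,
     keydisj (v p.1.1 :: s p.1) (v p.2.1 :: s p.2) &
     crossings (v p.1.1) (s p.1) (v p.2.1) (s p.2) = false]) ->
  perm_eq (ends L) (D ++ D) ->
  \big[addb/false]_(p <- L) (y p.1 && y p.2) =
  \big[addb/false]_(p <- L) Xtw (v p.1.1) (v p.1.2) (v p.2.1) (v p.2.2).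
Proof.
move=> hE hL hD.
pose g (q : (nat * nat) * nat) :=
  defect o (v q.1.1) (s q.1) (y q.1) (v q.1.2) (v q.2).
have g0 : \big[addb/false]_(q <- ends L) g q = false.
  by rewrite (perm_big _ hD) big_cat /= addbb.
rewrite /ends big_flatten big_map in g0.
transitivity (\big[addb/false]_(p <- L)
    (Xtw (v p.1.1) (v p.1.2) (v p.2.1) (v p.2.2) (+)
     \big[addb/false]_(q <- [:: (p.1, p.2.1); (p.1, p.2.2); (p.2, p.1.1);
                                (p.2, p.1.2)]) g q)); last first.
  by rewrite big_split /= g0 addbF.
apply: eq_big_seq => p /hL[/hE[h1 h2 h3 h4 h5] /hE[k1 k2 k3 k4 k5] sp].
rewrite (cross_eq h1 k1 h2 k2 h3 k3 h4 k4 h5 k5 sp) !big_cons big_nil addbF /g /=.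
move: (Xtw _ _ _ _) (_ && _) (defect _ _ _ _ _ _) (defect _ _ _ _ _ _).
move: (defect _ _ _ _ _ _) (defect _ _ _ _ _ _).
by move=> [] [] [] [] [] [].
Qed.

End Chirotope.
Arguments keydisj {I J} key s t : simpl never.

(** * Vectors in general position *)

Local Open Scope ring_scope.

Section Vectors.
Variable K : realType.
Implicit Types a b c d e p q : 'rV[K]_3.

Definition det3 a b c : K :=
  a 0 0 * (b 0 1 * c 0 2%:R - b 0 2%:R * c 0 1)
  - a 0 1 * (b 0 0 * c 0 2%:R - b 0 2%:R * c 0 0)
  + a 0 2%:R * (b 0 0 * c 0 1 - b 0 1 * c 0 0).

Lemma det3C a b c : det3 b a c = - det3 a b c.
Proof. by rewrite /det3; ring. Qed.

Lemma det3A a b c : det3 a c b = - det3 a b c.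
Proof. by rewrite /det3; ring. Qed.

Lemma det3N a b c : det3 (- a) b c = - det3 a b c.
Proof. by rewrite /det3 !mxE; ring. Qed.

(** The three-term Grassmann-Pluecker relation. *)
Lemma det3P a b c d e : det3 a b c * det3 a d e - det3 a b d * det3 a c e
  + det3 a b e * det3 a c d = 0.
Proof. by rewrite /det3; ring. Qed.

Lemma gpP (x1 x2 z1 z2 u1 u2 : K) : x1 * x2 - z1 * z2 + u1 * u2 = 0 ->
  x1 != 0 -> x2 != 0 -> z1 != 0 -> z2 != 0 -> u1 != 0 -> u2 != 0 ->
  gp (x1 < 0) (x2 < 0) (z1 < 0) (z2 < 0) (u1 < 0) (u2 < 0).
Proof.
have sgM (x y : K) : x != 0 -> y != 0 -> (x * y < 0) = (x < 0) (+) (y < 0).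
  move=> x0 y0; have [xp|xn] := ltP 0 x.
    by rewrite pmulr_rlt0 // [x < 0]ltNge (ltW xp).
  have {}xn : x < 0 by rewrite lt_neqAle x0.
  by rewrite nmulr_rlt0 // xn addTb -leNgt lt_neqAle eq_sym y0.
move=> E x10 x20 z10 z20 u10 u20; rewrite /gp -!sgM //.
have : x1 * x2 != 0 by rewrite mulf_neq0.
have : z1 * z2 != 0 by rewrite mulf_neq0.
have : u1 * u2 != 0 by rewrite mulf_neq0.
move: (x1 * x2) (z1 * z2) (u1 * u2) E => x z u E u0 z0 x0.
apply/negP => /andP[].
have [xn|xp] := ltP x 0; have [zn|zp] := ltP z 0; have [un|up] := ltP u 0 => //= _ _.
  by lra.
have {}up : 0 < u by rewrite lt_neqAle eq_sym u0.
have {}xp : 0 < x by rewrite lt_neqAle eq_sym x0.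
by lra.
Qed.

Definition cross_prod a b : 'rV[K]_3 :=
  \row_j [:: a 0 1 * b 0 2%:R - a 0 2%:R * b 0 1;
             a 0 2%:R * b 0 0 - a 0 0 * b 0 2%:R;
             a 0 0 * b 0 1 - a 0 1 * b 0 0]`_j.

Lemma ord3P (j : 'I_3) : [\/ j = 0, j = 1 | j = 2%:R].
Proof.
by case: j => -[|[|[|//]]] ?; [constructor 1|constructor 2|constructor 3]; apply: val_inj.
Qed.

Lemma row3P a b : a 0 0 = b 0 0 -> a 0 1 = b 0 1 -> a 0 2%:R = b 0 2%:R -> a = b.
Proof. by move=> h0 h1 h2; apply/rowP => j; case: (ord3P j) => ->. Qed.

Lemma det3_cr a b p : det3 a b p = dot (cross_prod a b) p.
Proof. by rewrite /det3 !dotE !mxE /=; ring. Qed.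

Lemma mx_norm_ltP a (e : K) : `|a| < e <-> 0 < e /\ forall j, `|a 0 j| < e.
Proof.
have -> : (`|a| < e) = (ball_ (fun x : 'rV[K]_3 => `|x|) 0 e (- a)) :> Prop.
  by rewrite /ball_ /= opprK add0r.
rewrite -mx_norm_ball; split => [[e0 h]|[e0 h]]; first split=> [//|j].
  by have := h 0 j; rewrite /ball /= !mxE sub0r opprK.
split=> [//|i j]; by rewrite /ball /= !mxE sub0r opprK ord1.
Qed.

(** On the curve p + (t, t^2, t^3) a plane through the origin gives a nonzero polynomial
    equation in t, so some small t avoids finitely many planes. *)
Lemma avoid_planes (N : seq 'rV[K]_3) p (e : K) : 0 < e -> all (predC1 0) N ->
  exists q, `|p - q| < e /\ all (fun n => dot n q != 0) N.
Proof.
move=> e0 hN.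
pose Q n : {poly K} := Poly [:: dot n p; n 0 0; n 0 1; n 0 2%:R].
have Q0 n : n != 0 -> Q n != 0.
  apply: contraNneq => Qn; apply/eqP; have h i : (Q n)`_i = 0 by rewrite Qn coef0.
  by apply: row3P; rewrite mxE; [have := h 1%N|have := h 2%N|have := h 3%N];
    rewrite coef_Poly.
have QE n t : (Q n).[t] = dot n (p + \row_j t ^+ j.+1).
  rewrite horner_Poly /= !dotE !mxE /=; ring.
pose R := \prod_(n <- N) Q n.
have R0 : R != 0.
  rewrite /R prodf_seq_neq0; apply: sub_all hN => n /= n0; exact: Q0.
(* More sample points, all of them small, than the polynomial has roots. *)
pose s := [seq Num.min e 1 / (k.+2)%:R | k <- iota 0 (size R)].
have m0 : 0 < Num.min e 1 by rewrite lt_min e0 ltr01.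
have us : uniq s.
  rewrite map_inj_uniq ?iota_uniq // => i j /(mulfI (lt0r_neq0 m0)) /invr_inj /eqP.
  by rewrite eqr_nat => /eqP [].
have : ~~ all (root R) s.
  apply/negP => h; have := max_poly_roots R0 h us.
  by rewrite size_map size_iota ltnn.
case/allPn => t /mapP[k _ tE] tR.
have t0 : 0 < t by rewrite tE divr_gt0.
have tm : t < Num.min e 1.
  by rewrite tE ltr_pdivrMr // ltr_pMr // ltr1n.
have te : t < e by rewrite (lt_le_trans tm) // ge_min lexx.
have t1 : t < 1 by rewrite (lt_le_trans tm) // ge_min lexx orbT.
exists (p + \row_j t ^+ j.+1); split.
  rewrite opprD addrA subrr add0r normrN; apply/mx_norm_ltP; split => // j.
  rewrite mxE ger0_norm ?exprn_ge0 ?(ltW t0) // exprS.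
  by rewrite (le_lt_trans _ te) // ger_pMr // exprn_ile1 ?ltW.
apply/allP => n nN; rewrite -QE; apply: contra tR => /eqP Qt.
by rewrite /R /root horner_prod prodf_seq_eq0; apply/hasP; exists n => //=; rewrite Qt.
Qed.

Definition e1 : 'rV[K]_3 := \row_j [:: 1; 0; 0]`_j.
Definition e2 : 'rV[K]_3 := \row_j [:: 0; 1; 0]`_j.

Lemma cr_e a : a != 0 -> (cross_prod a e1 != 0) || (cross_prod a e2 != 0).
Proof.
apply: contraNT; rewrite negb_or !negbK => /andP[/eqP h1 /eqP h2].
have h (c : 'rV[K]_3) j : c = 0 -> c 0 j = 0 by move=> ->; rewrite mxE.
move: (h _ 1 h1) (h _ 2%:R h1) (h _ 0 h2) (h _ 2%:R h2); rewrite !mxE /= => q1 q2 q3 q4.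
by apply/eqP/row3P; rewrite mxE; lra.
Qed.

Lemma cr_e12 : cross_prod e1 e2 != 0.
Proof.
apply/eqP => /rowP/(_ 2%:R); rewrite !mxE /= => /eqP.
by rewrite !mul0r subr0 mulr1 oner_eq0.
Qed.

(** The points are chosen in turn, off the planes through two earlier points. The two
    basis vectors are put in front of the sequence so that no point is zero or a
    multiple of an earlier one. *)
Lemma generic_seq (p : nat -> 'rV[K]_3) (e : K) : 0 < e ->
  exists P : nat -> 'rV[K]_3, (forall i, `|p i - P i| < e) /\
    forall i j k, (i < j < k)%N -> det3 (P i) (P j) (P k) != 0.
Proof.
move=> e0.
have [f fP] : exists f : seq 'rV[K]_3 * 'rV[K]_3 -> 'rV[K]_3, forall Lx,
    `|Lx.2 - f Lx| < e /\
    all (fun n => dot n (f Lx) != 0) [seq n <- [seq cross_prod a b | a <- Lx.1, b <- Lx.1] | n != 0].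
  have : forall Lx : seq 'rV[K]_3 * 'rV[K]_3, exists q, `|Lx.2 - q| < e /\
    all (fun n => dot n q != 0) [seq n <- [seq cross_prod a b | a <- Lx.1, b <- Lx.1] | n != 0].
    by move=> Lx; apply: avoid_planes => //; apply: filter_all.
  by move=> /choice[f fP]; exists f.
pose L := fix L n := if n is n'.+1 then rcons (L n') (f (L n', p n')) else [:: e1; e2].
pose P n := f (L n, p n).
have LS m n : (m <= n)%N -> {subset L m <= L n}.
  elim: n => [|n IH]; first by rewrite leqn0 => /eqP ->.
  rewrite leq_eqVlt => /predU1P[->//|mn] x xm.
  by rewrite /= mem_rcons inE IH ?orbT.
have PL m n : (m < n)%N -> P m \in L n.
  by move=> mn; apply: (LS m.+1) => //=; rewrite mem_rcons inE eqxx.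
have EL n : (e1 \in L n) && (e2 \in L n).
  by rewrite !(LS 0%N n) //= !inE eqxx ?orbT.
have av n a b : a \in L n -> b \in L n -> cross_prod a b != 0 -> det3 a b (P n) != 0.
  move=> aL bL ab; rewrite det3_cr; have [_ /allP] := fP (L n, p n).
  by apply; rewrite mem_filter ab; apply/allpairsP; exists (a, b).
have Pn0 n : P n != 0.
  have /andP[h1 h2] := EL n; have := av n _ _ h1 h2 cr_e12.
  by apply: contraNneq => ->; rewrite /det3 !mxE; apply/eqP; ring.
have crP i j : (i < j)%N -> cross_prod (P i) (P j) != 0.
  move=> ij; have /andP[h1 h2] := EL j.
  have h c : c \in L j -> cross_prod (P i) c != 0 -> cross_prod (P i) (P j) != 0.
    move=> cL hc; have := av j _ _ (PL _ _ ij) cL hc; apply: contra => /eqP h.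
    by rewrite det3A det3_cr h !dotE !mxE !mul0r !addr0 oppr0.
  by case/orP: (cr_e (Pn0 i)); apply: h.
exists P; split=> [i|i j k /andP[ij jk]]; first by have [] := fP (L i, p i).
by apply: av; [apply: PL (ltn_trans ij jk)|apply: PL|apply: crP].
Qed.

Lemma generic_approx (I : countType) (p : I -> 'rV[K]_3) (e : K) : 0 < e ->
  exists P : I -> 'rV[K]_3, (forall i, `|p i - P i| < e) /\
    forall i j k, uniq [:: i; j; k] -> det3 (P i) (P j) (P k) != 0.
Proof.
move=> e0; have [P [Pp Pd]] := @generic_seq (fun n => oapp p 0 (unpickle n)) e e0.
exists (P \o pickle); split=> [i|i j k]; first by have := Pp (pickle i); rewrite pickleK.
rewrite -(map_inj_uniq (pcan_inj pickleK)) /= !inE.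
move: (pickle i) (pickle j) (pickle k) => {i j k} i j k.
have sw a b c : det3 a b c != 0 ->
    [/\ det3 a c b != 0, det3 b a c != 0, det3 b c a != 0, det3 c a b != 0 &
        det3 c b a != 0].
  move=> h; have h1 : det3 b a c != 0 by rewrite det3C oppr_eq0.
  have h2 : det3 a c b != 0 by rewrite det3A oppr_eq0.
  have h3 : det3 b c a != 0 by rewrite det3A oppr_eq0.
  have h4 : det3 c a b != 0 by rewrite det3C oppr_eq0.
  by split=> //; rewrite det3C oppr_eq0.
have H l m n (h : (l < m < n)%N) := sw _ _ _ (Pd l m n h).
rewrite negb_or !neq_ltn andbT => /andP[/andP[/orP[ij|ji] /orP[ik|ki]] /orP[jk|kj]];
  try by [apply: Pd; rewrite ?ij ?ji ?ik ?ki ?jk ?kj].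
- by have := H i k j; rewrite ik kj => /(_ isT); case.
- by have := H k i j; rewrite ki ij => /(_ isT); case.
- by have := H j i k; rewrite ji ik => /(_ isT); case.
- by have := ltn_trans ik (ltn_trans kj ji); rewrite ltnn.
- by have := H j k i; rewrite jk ki => /(_ isT); case.
- by have := H k j i; rewrite kj ji => /(_ isT); case.
Qed.

End Vectors.

Section SignedPoints.
Variables (K : realType) (I : eqType) (P : I -> 'rV[K]_3).
Implicit Types a b c d e : I * bool.
Hypothesis genP : forall i j k, uniq [:: i; j; k] -> det3 (P i) (P j) (P k) != 0.

Definition vec (a : I * bool) := if a.2 then - P a.1 else P a.1.
Definition sopp (a : I * bool) := (a.1, ~~ a.2).
Definition schi a b c := det3 (vec a) (vec b) (vec c) < 0.

Lemma vecN a : vec (sopp a) = - vec a.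
Proof. by case: a => i []; rewrite /vec /= ?opprK. Qed.

Lemma det3_vec a b c : apart (@fst I bool) [:: a; b; c] -> det3 (vec a) (vec b) (vec c) != 0.
Proof.
have nN (x y z : 'rV[K]_3) : (det3 (- x) y z == 0) = (det3 x y z == 0 :> K) by rewrite det3N oppr_eq0.
have nN2 (x y z : 'rV[K]_3) : (det3 x (- y) z == 0) = (det3 x y z == 0 :> K).
  by rewrite det3C oppr_eq0 nN det3C oppr_eq0.
have nN3 (x y z : 'rV[K]_3) : (det3 x y (- z) == 0) = (det3 x y z == 0 :> K).
  by rewrite det3A oppr_eq0 nN2 det3A oppr_eq0.
by move=> /genP; rewrite /vec; case: ifP => _; case: ifP => _; case: ifP => _;
  rewrite ?nN ?nN2 ?nN3.
Qed.

Lemma ltN0 (x : K) : x != 0 -> (- x < 0) = ~~ (x < 0).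
Proof. by move=> x0; rewrite oppr_lt0 -leNgt lt_neqAle eq_sym x0. Qed.

Lemma schiC a b c : apart (@fst I bool) [:: a; b; c] -> schi b a c = ~~ schi a b c.
Proof. by move=> u; rewrite /schi det3C ltN0 // det3_vec. Qed.

Lemma schiA a b c : apart (@fst I bool) [:: a; b; c] -> schi a c b = ~~ schi a b c.
Proof. by move=> u; rewrite /schi det3A ltN0 // det3_vec. Qed.

Lemma schiN a b c : apart (@fst I bool) [:: a; b; c] -> schi (sopp a) b c = ~~ schi a b c.
Proof. by move=> u; rewrite /schi vecN det3N ltN0 // det3_vec. Qed.

Lemma schiGP a b c d e : apart (@fst I bool) [:: a; b; c; d; e] ->
  gp (schi a b c) (schi a d e) (schi a b d) (schi a c e) (schi a b e) (schi a c d).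
Proof.
move=> u; have [[[[[[[[[u1 u2] u3] u4] u5] u6] _] _] _] _] := apart5 u.
by apply: gpP; rewrite ?det3P // det3_vec.
Qed.

(** By Cramer's rule four vectors satisfy a linear relation whose coefficients are
    determinants, and the definition of XS fixes the signs of these. *)
Lemma XS_cross a b c d : apart (@fst I bool) [:: a; b; c; d] -> XS schi a b c d ->
  exists l m n r : K, [/\ 0 < l, 0 < m, 0 < n & 0 < r] /\
    l *: vec a + m *: vec b = n *: vec c + r *: vec d.
Proof.
move=> u; have [[[u1 u2] u3] u4] := apart4 u; rewrite /XS /schi.
have := det3_vec u1; have := det3_vec u2; have := det3_vec u3; have := det3_vec u4.
set D1 := det3 (vec b) _ _; set D2 := det3 (vec a) (vec c) _.
set D3 := det3 (vec a) (vec b) (vec d); set D4 := det3 _ _ (vec c) => h1 h2 h3 h4.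
have E : D1 *: vec a - D2 *: vec b = D4 *: vec d - D3 *: vec c.
  by apply: row3P; rewrite !mxE /D1 /D2 /D3 /D4 /det3; ring.
have [n1|p1] := ltP D1 0; have [n2|p2] := ltP D2 0; have [n3|p3] := ltP D3 0;
 have [n4|p4] := ltP D4 0 => // _.
- exists (- D1), D2, D3, (- D4); split.
    by split; rewrite ?oppr_gt0 // lt_neqAle eq_sym ?h2 ?h3.
  by rewrite !scaleNr addrC -opprB E opprB.
- exists D1, (- D2), (- D3), D4; split.
    by split; rewrite ?oppr_gt0 // lt_neqAle eq_sym ?h1 ?h4.
  by rewrite !scaleNr E addrC.
Qed.

End SignedPoints.

(** * Polygons with short steps that stay apart do not cross *)

Section Noncrossing.
Variable K : realType.

(** If two short segments meet in a common ray then their ends lie almost on a common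
    ray. The norm is the maximum norm, in which unit vectors have length between 1/2 and
    1. *)
Lemma short_cross (a b c d : 'rV[K]_3) (l m n r e : K) : 0 < e -> e <= 1 / 16 ->
    0 < l -> 0 < m -> 0 < n -> 0 < r -> l *: a + m *: b = n *: c + r *: d ->
    `|a| <= 1 + e -> 1 / 2 - e <= `|c| -> `|a - b| <= e -> `|c - d| <= e ->
  exists t, [/\ 0 < t, t <= 8 & `|a - t *: c| <= 9 * e].
Proof.
move=> e0 e1 l0 m0 n0 r0 E ha hc hab hcd.
pose s := l + m; have s0 : 0 < s by rewrite addr_gt0.
pose t := (n + r) / s; have t0 : 0 < t by rewrite divr_gt0 // addr_gt0.
have D : a - t *: c = (m / s) *: (a - b) + (r / s) *: (d - c).
  have sv (x : 'rV[K]_3) : s^-1 *: (s *: x) = x by rewrite scalerA mulVf ?scale1r ?lt0r_neq0.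
  apply: (can_inj sv).
  have sM x (v : 'rV[K]_3) : s *: ((x / s) *: v) = x *: v.
    by rewrite scalerA mulrCA mulfV ?mulr1 ?lt0r_neq0.
  rewrite /t scalerBr scalerDr !sM; apply/rowP => j.
  by move/rowP: E => /(_ j); rewrite !mxE /s => E; lra.
have bnd : `|a - t *: c| <= e + t * e.
  rewrite D; apply: le_trans (ler_normD _ _) _; rewrite (normrZ (m / s)) (normrZ (r / s)).
  have ms : 0 <= m / s by rewrite divr_ge0 ?ltW.
  have rs : 0 <= r / s by rewrite divr_ge0 ?ltW.
  have ms1 : m / s <= 1 by rewrite ler_pdivrMr // mul1r lerDr ltW.
  have rst : r / s <= t by rewrite ler_pM2r ?invr_gt0 // lerDr ltW.
  rewrite (distrC d c) (ger0_norm ms) (ger0_norm rs); apply: lerD.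
    by rewrite -[leRHS]mul1r ler_pM.
  by rewrite ler_pM.
have tc : t * `|c| <= `|a| + (e + t * e).
  have -> : t * `|c| = `|t *: c| by rewrite normrZ ger0_norm ?ltW.
  rewrite -[t *: c](subKr a); apply: le_trans (ler_normB _ _) _; lra.
have t8 : t <= 8 by nra.
by exists t; split => //; apply: le_trans bnd _; nra.
Qed.

Definition sgv (s : bool) (p : 'rV[K]_3) := if s then - p else p.

Lemma normr_sgv s p : `|sgv s p| = `|p|.
Proof. by case: s => //=; rewrite normrN. Qed.

Lemma sgvB s p q : sgv s (p - q) = sgv s p - sgv s q.
Proof. by case: s => //=; rewrite opprB opprK addrC. Qed.

Lemma sgvK s t p : sgv s (sgv t p) = sgv (s (+) t) p.
Proof. by case: s t => [] [] //=; rewrite opprK. Qed.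

Lemma sgvZ s t p : sgv s (t *: p) = t *: sgv s p.
Proof. by case: s => //=; rewrite scalerN. Qed.

Variable (tw : bool).

(** Distance from p to the rays of q, and of its antipode in the projective plane; rays
    rather than points, because segments that cross only have a ray in common. *)
Definition hsep (dl : K) p q := forall s : bool, (s -> tw) -> forall t : K, 0 < t ->
  dl <= `|p - t *: sgv s q|.

Variables (I : countType) (pt : I -> 'rV[K]_3).
Hypothesis pt_le : forall i, `|pt i| <= 1.
Hypothesis pt_ge : forall i, 1 / 2 <= `|pt i|.

Variables (e : K) (P : I -> 'rV[K]_3).
Hypothesis e0 : 0 < e.
Hypothesis e1 : e <= 1 / 48.
Hypothesis Ppt : forall i, `|pt i - P i| < e.
Hypothesis genP : forall i j k, uniq [:: i; j; k] -> det3 (P i) (P j) (P k) != 0.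

Let J := (I * bool)%type.
Implicit Types a b c d : J.

Definition nearby (i j : I) := exists s : bool, (s -> tw) /\ `|pt i - sgv s (pt j)| < e.

Definition step a b := `|vec P a - vec P b| <= 3 * e.

Lemma vec_sgv a : vec P a = sgv a.2 (P a.1).
Proof. by []. Qed.

(** A sequence of points that are close up to sign lifts to a polygon on the sphere: the
    signs are determined one after the other. *)
Lemma lift_signs i (s : seq I) (y : bool) : (y -> tw) ->
    path (fun i j => `[< nearby i j >]) i s ->
  exists s' : seq J, [/\ map fst s' = s, all (fun a => a.2 ==> tw) s' &
    path step (i, y) s'].
Proof.
elim: s i y => [|j s IH] i y hy; first by exists [::].
move=> /= /andP[/asboolP[z [hz zP]] ps].
have hyz : y (+) z -> tw by case: y z hy hz {zP} => [] [] //= h1 h2 _; auto.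
have [s' [s1 s2 s3]] := IH j (y (+) z) hyz ps.
exists ((j, y (+) z) :: s'); split => /=; rewrite ?s1 ?s2 ?s3 ?andbT //.
  exact/implyP.
rewrite /step !vec_sgv /= -sgvK -sgvB normr_sgv.
have -> : P i - sgv z (P j) = (P i - pt i) + (pt i - sgv z (pt j)) + sgv z (pt j - P j).
  by rewrite sgvB !addrA !addrNK.
apply: le_trans (ler_normD _ _) _; apply: le_trans (lerD (ler_normD _ _) (lexx _)) _.
rewrite normr_sgv distrC; have := Ppt i; have := Ppt j; lra.
Qed.

Lemma XS_far a b c d (dl : K) : 56 * e < dl -> apart (@fst I bool) [:: a; b; c; d] ->
    (a.2 ==> tw) -> (c.2 ==> tw) -> step a b -> step c d -> hsep dl (pt a.1) (pt c.1) ->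
  XS (schi P) a b c d = false.
Proof.
move=> edl ap ha hc sab scd far; apply/negP => /(XS_cross genP ap).
case=> l [m [n [r [[l0 m0 n0 r0] E]]]].
have e3 : 0 < 3 * e by rewrite mulr_gt0.
have nP i : `|P i| <= 1 + 3 * e.
  have -> : P i = pt i - (pt i - P i) by rewrite subKr.
  by apply: le_trans (ler_normB _ _) _; have := pt_le i; have := Ppt i; lra.
have nP2 i : 1 / 2 - 3 * e <= `|P i|.
  have := lerB_dist (pt i) (P i); have := pt_ge i; have := Ppt i; lra.
have e16 : 3 * e <= 1 / 16 by have := e1; lra.
have va : `|vec P a| <= 1 + 3 * e by rewrite vec_sgv normr_sgv.
have vc : 1 / 2 - 3 * e <= `|vec P c| by rewrite vec_sgv normr_sgv.
have [t [t0 t8 tP]] := short_cross e3 e16 l0 m0 n0 r0 E va vc sab scd.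
have hs : a.2 (+) c.2 -> tw.
  by move: ha hc; case: a.2 => /=; case: c.2 => /=.
have := far _ hs t t0; apply/negP; rewrite -ltNge.
have -> : pt a.1 - t *: sgv (a.2 (+) c.2) (pt c.1) =
    (pt a.1 - P a.1) + sgv a.2 (vec P a - t *: vec P c) - t *: sgv (a.2 (+) c.2) (pt c.1 - P c.1).
  rewrite !vec_sgv sgvB sgvZ !sgvK addbb /= sgvB scalerBr.
  by rewrite opprB !addrA !addrNK.
apply: le_lt_trans (ler_normB _ _) _; apply: le_lt_trans (lerD (ler_normD _ _) (lexx _)) _.
rewrite normrZ !normr_sgv (ger0_norm (ltW t0)).
have h1 := Ppt a.1; have h2 := Ppt c.1.
have h3 : t * `|pt c.1 - P c.1| <= 8 * e by rewrite ler_pM // ltW.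
lra.
Qed.

Lemma step_opp a b : step a b -> step (sopp a) (sopp b).
Proof. by rewrite /step !vecN -opprD normrN. Qed.

Lemma cross_far c s d t (dl : K) : 56 * e < dl ->
    stepwise (@fst I bool) c s -> stepwise (@fst I bool) d t ->
    keydisj (@fst I bool) (c :: s) (d :: t) ->
    all (fun a => a.2 ==> tw) (c :: s) -> all (fun a => a.2 ==> tw) (d :: t) ->
    path step c s -> path step d t ->
    (forall a b, a \in c :: s -> b \in d :: t -> hsep dl (pt a.1) (pt b.1)) ->
  crossings (@sopp I) (schi P) tw c s d t = false.
Proof.
move=> edl.
have X0 a b d1 d2 : apart (@fst I bool) [:: a; b; d1; d2] -> a.2 ==> tw -> d1.2 ==> tw ->
    step a b -> step d1 d2 -> hsep dl (pt a.1) (pt d1.1) -> Xtw (@sopp I) (schi P) tw a b d1 d2 = false.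
  move=> ap ha hd sab sd far; rewrite /Xtw (XS_far edl ap) //=.
  case: (boolP tw) => //= htw; apply: (@XS_far _ _ _ _ dl) => //.
  - by rewrite htw implybT.
  - exact: step_opp.
have c0 a b d1 t1 : a.1 != b.1 -> a.2 ==> tw -> step a b -> stepwise (@fst I bool) d1 t1 ->
    keydisj (@fst I bool) [:: a; b] (d1 :: t1) -> all (fun a => a.2 ==> tw) (d1 :: t1) ->
    path step d1 t1 -> (forall b, b \in d1 :: t1 -> hsep dl (pt a.1) (pt b.1)) ->
    crossings1 (@sopp I) (schi P) tw a b d1 t1 = false.
  move=> ab ha sab; elim: t1 d1 => [|d2 t1 IH] d1 //= /andP[d12 ld].
  rewrite keydisj_consr (keydisj_consr _ _ d2) => /and3P[s1 s2 st] /and3P[hd1 hd2 ht] /andP[s12 sd] far.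
  rewrite X0 // ?IH ?hd2 //.
  - by rewrite keydisj_consr s2.
  - by rewrite /= hd2 ht.
  - by move=> x xd; apply: far; rewrite inE xd orbT.
  - move: s1 s2; rewrite /keydisj /apart /= !inE !negb_or !andbT => /andP[-> ->] /andP[-> ->].
    by rewrite ab d12.
  - by apply: far; rewrite inE eqxx.
elim: s c => [|c' s IH] c //= /andP[cc' lc] ld /and3P[sc sc' ss] /and3P[hc hc' hs] hd /andP[st sts] std far.
rewrite c0 //=; last 2 first.
- exact/and3P.
- by move=> b; apply: far; rewrite inE eqxx.
apply: IH => //; first exact/andP.
- by rewrite /= hc' hs.
- by move=> a b ha; apply: far; rewrite inE ha orbT.
Qed.

End Noncrossing.

(** * Lifting points and arcs of the sphere and the projective plane *)

Local Open Scope classical_set_scope.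
Local Open Scope quotient_scope.

Section Interval.
Variable K : realType.

(** A transitive relation that holds around every point of the interval holds between
    its ends: at the supremum of the points reached from 0, the local property leads
    further unless the supremum is 1. *)
Lemma interval_induction (Q : K -> K -> Prop) :
    (forall a b c, a <= b -> b <= c -> Q a b -> Q b c -> Q a c) ->
    (forall t : K, 0 <= t <= 1 -> exists2 h : K, 0 < h & forall a b : K, 0 <= a -> a <= t ->
       t <= b -> b <= 1 -> t - h < a -> b < t + h -> Q a b) ->
  Q 0 1.
Proof.
move=> Qtr Qloc; pose S := [set t : K | 0 <= t <= 1 /\ Q 0 t].
have S0 : S 0.
  by split; [rewrite lexx ler01|have [h h0 H] := Qloc 0 (introT andP (conj (lexx _) ler01)); apply: H; lra].
have ubS : ubound S 1 by move=> t [/andP[]].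
have hub : has_ubound S by exists 1.
have hS : has_sup S by split; [exists 0|].
have s0 : 0 <= sup S by exact: ub_le_sup.
have s1 : sup S <= 1 by apply: ge_sup => //; exists 0.
have [h h0 H] := Qloc (sup S) (introT andP (conj s0 s1)).
have [t [/andP[t0 t1] Qt] ht] := sup_adherent h0 hS.
have ts : t <= sup S by apply: ub_le_sup => //; split => //; rewrite t0 t1.
(* A point beyond the supremum, unless the supremum is 1. *)
pose b := Num.min 1 (sup S + h / 2).
have sb : sup S <= b by rewrite le_min s1 lerDl divr_ge0 ?ltW.
have b1 : b <= 1 by rewrite ge_min lexx.
have bh : b < sup S + h by rewrite gt_min; apply/orP; right; lra.
have Qb : Q 0 b by apply: Qtr (Qt) (H _ _ t0 ts sb b1 ht bh) => //; exact: le_trans ts sb.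
have bS : b <= sup S by apply: ub_le_sup => //; split => //; rewrite b1 (le_trans s0 sb).
have b1E : b = 1.
  move: bS; rewrite [b <= _]ge_min => /orP[h1|h1]; last by lra.
  by apply/eqP; rewrite eq_le b1 (le_trans h1 sb).
by rewrite -b1E.
Qed.

(** Compactness of the interval, in the form of a uniform lower bound. *)
Lemma interval_uniform (R : K -> K -> Prop) :
    (forall d d' t, d' <= d -> R d t -> R d' t) ->
    (forall t : K, 0 <= t <= 1 -> exists2 d : K, 0 < d & exists2 h : K, 0 < h &
       forall t' : K, 0 <= t' <= 1 -> `|t' - t| < h -> R d t') ->
  exists2 d : K, 0 < d & forall t : K, 0 <= t <= 1 -> R d t.
Proof.
move=> Rle Rloc.
apply: (@interval_induction (fun a b => exists2 d : K, 0 < d &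
  forall t : K, a <= t <= b -> R d t)).
  move=> a b c ab bc [d d0 H] [d' d'0 H']; exists (Num.min d d').
    by rewrite lt_min d0.
  move=> t /andP[at_ tc]; have [tb|bt] := leP t b.
    by apply: Rle (H t _); rewrite ?ge_min ?lexx ?at_.
  by apply: Rle (H' t _); rewrite ?ge_min ?lexx ?orbT ?tc ?ltW.
move=> t t01; have [d d0 [h h0 H]] := Rloc t t01; exists h => //.
move=> a b a0 at_ tb b1 ha hb; exists d => // t' /andP[at' tb']; apply: H.
  by rewrite (le_trans a0 at') (le_trans tb' b1).
by rewrite ltr_norml; apply/andP; split; lra.
Qed.

End Interval.

(** The sphere and the projective plane are treated together: tw, read as a number, is
    the number of crosscaps. *)
Section Lift.
Variables (K : realType) (tw : bool).
Let X := crosscap_surface K tw.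

(** A single crosscap has the cap of angular radius pi / 2, so what remains of the
    sphere is a closed hemisphere. *)
Lemma holedP (x : 'rV[K]_3) :
  holed_sphere tw x <-> dot x x = 1 /\ (tw -> x 0 0 <= 0).
Proof.
have cap i : (i < tw)%N -> tw /\ i = 0%N by case: tw i => [] [].
rewrite /holed_sphere /=; split => -[xx h]; split => //.
  move=> htw; have := h 0%N; rewrite dot_center /cap_angle /cap_height htw /= => /(_ isT).
  by rewrite mulr0 mul0r cos0 sin0 mulr0 addr0 !mulr1 cos_pihalf.
move=> i /cap[htw ->]; rewrite dot_center /cap_angle /cap_height htw /=.
by rewrite mulr0 mul0r cos0 sin0 mulr0 addr0 !mulr1 cos_pihalf h.
Qed.

(** The antipode on the rim is the antipode on the sphere, and two points of a
    hemisphere that are opposite lie on its rim. *)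
Lemma gluedP (x y : holed_sphere (K := K) tw) :
  glued x y <-> exists s : bool, (s -> tw) /\ set_val x = sgv s (set_val y).
Proof.
have /holedP [xx hx] : holed_sphere tw (set_val x) by apply: set_mem; exact: valP.
have /holedP [yy hy] : holed_sphere tw (set_val y) by apply: set_mem; exact: valP.
have rimE i (z : 'rV[K]_3) : (i < tw)%N ->
    [/\ tw, (on_rim tw i z <-> z 0 0 = 0) & rim_antipode tw i z = - z].
  case: (tw) i => [] [] // _.
  rewrite /on_rim /rim_antipode dot_center /cap_height /cap_angle /=.
  rewrite mulr0 mul0r cos0 sin0 mulr0 addr0 !mulr1 cos_pihalf mulr0 scale0r sub0r.
  by split.
split => [/asboolP[->|[i [ik xi yE]]]|[[] /= [htw E]]].
- by exists false.
- have [htw _ aE] := rimE i (set_val x) ik; exists true; split => //=.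
  by rewrite yE aE opprK.
- apply/asboolP; right; exists 0%N; have k0 : (0 < tw)%N by rewrite htw.
  have [_ rE aE] := rimE 0%N (set_val x) k0; split => //; last by rewrite aE E opprK.
  apply/rE; have := hx (htw isT); have := hy (htw isT); rewrite E mxE; lra.
- by apply/asboolP; left; apply: val_inj.
Qed.

Definition slift (x : X) : 'rV[K]_3 := set_val (repr x).

Lemma lift_unit x : dot (slift x) (slift x) = 1.
Proof.
have /holedP[] // : holed_sphere tw (slift x) by apply: set_mem; exact: valP.
Qed.

Lemma lift_pi (p : holed_sphere tw) : exists s : bool, (s -> tw) /\
  slift (\pi_X p) = sgv s (set_val p).
Proof.
apply/gluedP; have : \pi_X (repr (\pi_X p)) = \pi_X p :> X by rewrite reprK.
by move=> /eqmodP.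
Qed.

Lemma slift_inj (x z : X) (s : bool) : (s -> tw) -> slift x = sgv s (slift z) -> x = z.
Proof.
move=> hs E; rewrite -[x]reprK -[z]reprK; apply/eqmodP.
by apply/gluedP; exists s.
Qed.

Definition lclose (e : K) (x z : X) :=
  exists s : bool, (s -> tw) /\ `|slift x - sgv s (slift z)| < e.

Lemma lclose_refl e (x : X) : 0 < e -> lclose e x x.
Proof. by move=> e0; exists false; rewrite /= subrr normr0. Qed.

Lemma lclose_sym e (x z : X) : lclose e x z -> lclose e z x.
Proof.
case=> s [hs h]; exists s; split => //.
by rewrite -(normr_sgv s) sgvB sgvK addbb /= distrC.
Qed.

Lemma open_close e (x : X) : 0 < e -> open [set z | lclose e x z].
Proof.
move=> e0.
pose W := [set w : 'rV[K]_3 | exists s : bool, (s -> tw) /\ `|slift x - sgv s w| < e].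
have oW : open W.
  have -> : W = ball (slift x) e `|` [set w | tw /\ ball (- slift x) e w].
    rewrite -ball_normE; apply/seteqP; split => w /=.
      move=> [[] [hs h]]; [right; split; first exact: hs|by left].
      by move: h; rewrite /= opprK -normrN opprD.
    case=> [h|[htw h]]; first by exists false.
    by exists true; split => //=; rewrite opprK -normrN opprD.
  apply: openU; first exact: ball_open.
  case: (tw) => /=; last by rewrite (_ : [set _ | _] = set0) ?open0 // -subset0 => w [].
  by rewrite (_ : [set w | _] = ball (- slift x) e); [exact: ball_open|apply/seteqP; split => w //= []].
have addT (s s' : bool) : (s -> tw) -> (s' -> tw) -> s (+) s' -> tw.
  by case: s s' => [] [] //= h1 h2 _; auto.
exists W => //; apply/seteqP; split => p /= [s [hs h]].
  have [s' [hs' E]] := lift_pi p; exists (s (+) s'); split; first exact: addT.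
  by rewrite E sgvK -addbA addbb addbF.
have [s' [hs' E]] := lift_pi p; exists (s (+) s'); split; first exact: addT.
by rewrite -sgvK -E.
Qed.

Lemma near_close e (x : X) : 0 < e -> nbhs x [set z | lclose e x z].
Proof. by move=> e0; apply: open_nbhs_nbhs; split; [exact: open_close|exact: lclose_refl]. Qed.

Lemma dot_norm_le (p : 'rV[K]_3) : dot p p = 1 -> `|p| <= 1.
Proof.
rewrite dotE => E; rewrite leNgt; apply/negP => h.
have : ~ (`|p| < `|p|) by rewrite ltxx.
apply; apply/mx_norm_ltP; split; first exact: lt_trans h.
have sq (a : K) : a * a <= 1 -> `|a| < `|p|.
  move=> a1; apply: le_lt_trans h; rewrite -[leRHS]sqrtr1 -sqrtr_sqr ler_wsqrtr //.
have := sqr_ge0 (p 0 0); have := sqr_ge0 (p 0 1); have := sqr_ge0 (p 0 2%:R).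
by rewrite !expr2 => h0 h1 h2 j; apply: sq; case: (ord3P j) => ->; lra.
Qed.

Lemma dot_norm_lt (p : 'rV[K]_3) (r : K) : `|p| < r -> dot p p < 3 * r ^+ 2.
Proof.
case/mx_norm_ltP => r0 h; rewrite dotE.
have sq j : p 0 j * p 0 j < r ^+ 2.
  have := h j; rewrite ltr_norml => /andP[h1 h2].
  have : 0 < (r - p 0 j) * (r + p 0 j) by rewrite mulr_gt0; lra.
  by rewrite expr2; lra.
by have := sq 0; have := sq 1; have := sq 2%:R; lra.
Qed.

Lemma dot_norm_ge (p : 'rV[K]_3) : dot p p = 1 -> 1 / 2 <= `|p|.
Proof.
by move=> E; rewrite leNgt; apply/negP => /dot_norm_lt; rewrite E; nra.
Qed.

(** For unit vectors the distance from p to the ray of q is comparable with the distance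
    from p to q; the factor 8 covers the change between the Euclidean and the maximum
    norm. *)
Lemma unit_hsep (p q : 'rV[K]_3) (d : K) : dot p p = 1 -> dot q q = 1 -> 0 < d ->
    (forall s : bool, (s -> tw) -> d <= `|p - sgv s q|) -> hsep tw (d / 8) p q.
Proof.
move=> pp qq d0 h s hs t t0.
have {h} := h s hs; have {qq} : dot (sgv s q) (sgv s q) = 1.
  by rewrite -qq; case: s {hs} => //=; rewrite !dotE !mxE !mulrNN.
move: (sgv s q) => {hs}q qq h; rewrite leNgt; apply/negP => /dot_norm_lt.
have d2 : d <= 2.
  by apply: le_trans h _; apply: le_trans (ler_normB _ _) _;
     have := dot_norm_le pp; have := dot_norm_le qq; lra.
have : d ^+ 2 <= dot (p - q) (p - q).
  apply: le_trans (_ : `|p - q| ^+ 2 <= _).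
    by rewrite ler_pXn2r ?nnegrE // ltW.
  rewrite leNgt; apply/negP => hh.
  have hp : 0 <= dot (p - q) (p - q) by rewrite dotE !addr_ge0 // -expr2 sqr_ge0.
  pose r := Num.sqrt (dot (p - q) (p - q)).
  have rE : r ^+ 2 = dot (p - q) (p - q) by rewrite sqr_sqrtr.
  have r0 : 0 <= r := sqrtr_ge0 _.
  have pr : r < `|p - q|.
    by move: hh; rewrite -rE ltr_pXn2r ?nnegrE.
  have : ~ (`|p - q| < `|p - q|) by rewrite ltxx.
  apply; apply/mx_norm_ltP; split => [|j]; first exact: le_lt_trans pr.
  apply: le_lt_trans pr; rewrite -(ler_pXn2r (n := 2)) ?nnegrE // real_normK ?num_real // rE dotE.
  have := sqr_ge0 ((p - q) 0 0); have := sqr_ge0 ((p - q) 0 1); have := sqr_ge0 ((p - q) 0 2%:R).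
  by rewrite !expr2; case: (ord3P j) => ->; lra.
have pqE : dot (p - q) (p - q) = 2 - 2 * dot p q.
  have -> : dot (p - q) (p - q) = dot p p + dot q q - 2 * dot p q by rewrite !dotE !mxE; ring.
  by rewrite pp qq; ring.
have ptqE : dot (p - t *: q) (p - t *: q) = (1 - t) ^+ 2 + t * (2 - 2 * dot p q).
  have -> : dot (p - t *: q) (p - t *: q) = dot p p + t ^+ 2 * dot q q - 2 * t * dot p q.
    by rewrite !dotE !mxE; ring.
  by rewrite pp qq; ring.
rewrite ptqE pqE; move: (2 - 2 * dot p q) => w dw.
have d24 : d ^+ 2 <= 4 by nra.
have -> : 3 * (d / 8) ^+ 2 = 3 / 64 * d ^+ 2 by field.
have w0 : 0 < d ^+ 2 by rewrite exprn_gt0.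
move: (d ^+ 2) dw d24 w0 => D Dw D4 D0.
(* Since |p - t q|^2 = (1 - t)^2 + t |p - q|^2, the second term is large if t is at
   least 1/2, and otherwise the first one is. *)
have [th|th] := leP (1 / 2) t.
  have : 1 / 2 * D <= t * w by rewrite ler_pM // ltW.
  by have := sqr_ge0 (1 - t); lra.
have tw0 : 0 <= t * w by rewrite mulr_ge0; lra.
have : (1 / 2) ^+ 2 <= (1 - t) ^+ 2 by rewrite ler_pXn2r ?nnegrE //; lra.
by rewrite [(1 / 2) ^+ 2]expr2; lra.
Qed.

Lemma lift_far (x z : X) : x <> z ->
  exists2 d : K, 0 < d & forall s : bool, (s -> tw) -> d <= `|slift x - sgv s (slift z)|.
Proof.
move=> xz.
have pos (s : bool) : (s -> tw) -> 0 < `|slift x - sgv s (slift z)|.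
  by move=> hs; rewrite normr_gt0 subr_eq0; apply/eqP => /(slift_inj hs).
case: (boolP tw) => htw; last first.
  exists (`|slift x - slift z|); first exact: (pos false).
  by case=> // /(_ isT).
exists (Num.min `|slift x - slift z| `|slift x + slift z|).
  by rewrite lt_min (pos false) //=; have := pos true (fun=> htw); rewrite /= opprK.
by case=> /= _; rewrite ?opprK ge_min lexx ?orbT.
Qed.

Definition away (d : K) (x z : X) :=
  forall s : bool, (s -> tw) -> d <= `|slift x - sgv s (slift z)|.

Lemma away_sym d x z : away d x z -> away d z x.
Proof.
by move=> h s hs; rewrite -(normr_sgv s) sgvB sgvK addbb /= distrC; apply: h.
Qed.

Lemma away_close d e x x' z : away d x z -> lclose e x x' -> away (d - e) x' z.
Proof.
move=> h [s [hs hc]] s' hs'.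
have hss : s (+) s' -> tw by case: s s' hs hs' {hc} => [] [] //= h1 h2 _; auto.
have := h _ hss; rewrite -(normr_sgv s (slift x' - _)) sgvB sgvK => h1.
have := lerB_dist (slift x - sgv (s (+) s') (slift z)) (slift x - sgv s (slift x')).
by rewrite opprB [_ - _ + (_ - _)]addrC addrA subrK; lra.
Qed.

Variables (g : K -> X).
Hypothesis gc : {within `[0, 1], continuous g}.

Lemma arc_close t e : 0 <= t <= 1 -> 0 < e ->
  exists2 h : K, 0 < h & forall t' : K, 0 <= t' <= 1 -> `|t' - t| < h -> lclose e (g t) (g t').
Proof.
move=> t01 e0; have tI : `[0, 1]%classic t by rewrite /= in_itv.
have /subspace_continuousP/(_ _ tI) := gc.
move=> /(_ _ (near_close (g t) e0)); rewrite nbhs_simpl /within /= => /nbhs_ballP[h /= h0 H].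
exists h => // t' t'01 tt'; apply: H; last by rewrite in_itv.
by rewrite -ball_normE /= distrC.
Qed.

(** An arc is followed by close points, however small the required distance. *)
Lemma arc_chain e : 0 < e -> exists s : seq X,
  [/\ path (fun x z => `[< lclose e x z >]) (g 0) s, last (g 0) s = g 1 &
     all (fun z => `[< exists2 t, 0 <= t <= 1 & z = g t >]) s].
Proof.
move=> e0.
apply: (@interval_induction _ (fun a b => exists s : seq X,
  [/\ path (fun x z => `[< lclose e x z >]) (g a) s, last (g a) s = g b &
     all (fun z => `[< exists2 t, 0 <= t <= 1 & z = g t >]) s])).
  move=> a b c _ _ [s [s1 s2 s3]] [s' [s1' s2' s3']]; exists (s ++ s').
  by rewrite cat_path last_cat all_cat s1 s2 s3 s1'.
move=> t t01; have [h h0 H] := arc_close t01 e0; exists h => //.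
move=> a b a0 at_ tb b1 ha hb; exists [:: g t; g b].
have b01 : 0 <= b <= 1 by rewrite b1 andbT (le_trans a0) // (le_trans at_ tb).
split=> //=; last first.
  by rewrite andbT; apply/andP; split; apply/asboolP; [exists t|exists b].
rewrite andbT; apply/andP; split; apply/asboolP.
  apply: lclose_sym; apply: H; first by rewrite a0 (le_trans at_); have /andP[] := t01.
  by rewrite ltr_norml; apply/andP; split; lra.
by apply: H => //; rewrite ltr_norml; apply/andP; split; lra.
Qed.

End Lift.

Section TwoArcs.
Variables (K : realType) (tw : bool).
Let X := crosscap_surface K tw.

(** Compactness, applied to one arc after the other. *)
Lemma arcs_away (g h : K -> X) :
    {within `[0, 1], continuous g} -> {within `[0, 1], continuous h} ->
    (forall t s : K, 0 <= t <= 1 -> 0 <= s <= 1 -> g t <> h s) ->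
  exists2 d : K, 0 < d & forall t s : K, 0 <= t <= 1 -> 0 <= s <= 1 ->
    away d (g t) (h s).
Proof.
move=> gc hc gh.
have aw d d' (x z : X) : d' <= d -> away d x z -> away d' x z.
  by move=> dd H s hs; apply: le_trans dd (H s hs).
have one t : 0 <= t <= 1 ->
    exists2 d : K, 0 < d & forall s : K, 0 <= s <= 1 -> away d (g t) (h s).
  move=> t01; apply: interval_uniform => [d d' s|s s01]; first exact: aw.
  have [d d0 H] := lift_far (gh t s t01 s01); exists (d / 2); first by rewrite divr_gt0.
  have d20 : 0 < d / 2 by rewrite divr_gt0.
  have [r r0 Hr] := arc_close hc s01 d20; exists r => // s' s'01 ss'.
  have := away_close (away_sym H) (Hr s' s'01 ss').
  by rewrite (_ : d - d / 2 = d / 2); [exact: away_sym|lra].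
have := @interval_uniform K (fun d t => forall s : K, 0 <= s <= 1 -> away d (g t) (h s)).
case=> [d d' t dd H s s01|t t01|d d0 H]; last by exists d => // t s t01; apply: H.
  exact: aw (H s s01).
have [d d0 H] := one t t01; have d20 : 0 < d / 2 by rewrite divr_gt0.
exists (d / 2) => //; have [r r0 Hr] := arc_close gc t01 d20.
exists r => // t' t'01 tt' s s01.
have := away_close (H s s01) (Hr t' t'01 tt').
by rewrite (_ : d - d / 2 = d / 2); [|lra].
Qed.

End TwoArcs.

(** * From an embedding to polygons *)

Lemma fin_uniform (K : realType) (T : finType) (R : K -> T -> Prop) :
    (forall d d' t, d' <= d -> R d t -> R d' t) ->
    (forall t, exists2 d : K, 0 < d & R d t) ->
  exists2 d : K, 0 < d & forall t, R d t.
Proof.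
move=> Rle Rex; suff [d d0 H] : exists2 d : K, 0 < d & forall t, t \in enum T -> R d t.
  by exists d => // t; apply: H; rewrite mem_enum.
elim: (enum T) => [|t s [d d0 H]]; first by exists 1.
have [d' d'0 H'] := Rex t; exists (Num.min d d'); first by rewrite lt_min d0.
move=> t'; rewrite inE => /predU1P[->|ts]; first by apply: Rle H'; rewrite ge_min lexx orbT.
by apply: Rle (H _ ts); rewrite ge_min lexx.
Qed.

Section Drawing.
Variables (K : realType) (tw : bool) (V : finType) (G : sgraph V).
Let X := crosscap_surface K tw.

(** Vertex-disjoint edges have disjoint arcs: a common point would be a vertex, hence an
    end of both. *)
Lemma edges_away (v : V -> X) (A : V -> V -> set X) :
    (forall x y, G x y -> simple_arc K (v x) (v y) (A x y)) ->
    (forall x y z, G x y -> A x y (v z) -> z = x \/ z = y) ->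
    (forall x y z w, G x y -> G z w -> [set x; y] <> [set z; w] ->
      A x y `&` A z w `<=` range v) ->
  exists2 d : K, 0 < d & forall x y z w, G x y -> G z w ->
    ~~ has (mem [:: x; y]) [:: z; w] ->
    forall p q, A x y p -> A z w q -> away d p q.
Proof.
move=> arc ends meet.
pose R (d : K) (t : V * V * (V * V)) :=
  G t.1.1 t.1.2 -> G t.2.1 t.2.2 -> ~~ has (mem [:: t.1.1; t.1.2]) [:: t.2.1; t.2.2] ->
  forall p q, A t.1.1 t.1.2 p -> A t.2.1 t.2.2 q -> away d p q.
have Rle d d' t : d' <= d -> R d t -> R d' t.
  by move=> dd H g1 g2 dj p q Ap Aq s hs; apply: le_trans dd (H g1 g2 dj p q Ap Aq s hs).
suff Rex t : exists2 d : K, 0 < d & R d t.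
  have [d d0 H] := fin_uniform Rle Rex.
  by exists d => // x y z w; apply: (H (x, y, (z, w))).
case: t => -[x y] [z w]; rewrite /R /= => {Rle R}.
case: (boolP [&& G x y, G z w & ~~ has (mem [:: x; y]) [:: z; w]]); last first.
  by move=> nH; exists 1 => // g1 g2 dj; move: nH; rewrite g1 g2 dj.
case/and3P => g1 g2 dj.
have [g [gc _ _ _ gA]] := arc _ _ g1; have [h [hc _ _ _ hA]] := arc _ _ g2.
have [t s t01 s01 E|d d0 H] := arcs_away gc hc; last first.
  exists d => // _ _ _ p q; rewrite -gA -hA => -[t tI <-] [s sI <-].
  by apply: H; rewrite /= in_itv /= in tI sI.
have A1 : A x y (g t) by rewrite -gA; exists t; rewrite //= in_itv.
have A2 : A z w (g t) by rewrite -hA E; exists s; rewrite //= in_itv.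
move: dj; rewrite /= !inE !negb_or ![_ == x]eq_sym ![_ == y]eq_sym => /and3P[/andP[xz yz] /andP[xw yw] _].
have [|u _ uE] := meet x y z w g1 g2 _ (g t) (conj A1 A2).
  move=> /seteqP[/(_ x (or_introl erefl))[] /eqP]; first by rewrite (negPf xz).
  by rewrite (negPf xw).
rewrite -uE in A1 A2.
by case: (ends _ _ _ g1 A1) => uE1; case: (ends _ _ _ g2 A2) => uE2; subst u;
  move: xz xw yz yw; rewrite ?uE1 ?uE2 eqxx.
Qed.

Lemma edge_chains (v : V -> X) (A : V -> V -> set X) (e : K) : 0 < e ->
    (forall x y, G x y -> simple_arc K (v x) (v y) (A x y)) ->
  exists c : V * V -> seq X, forall x y, G x y ->
    [/\ path (fun p q => `[< lclose e p q >]) (v x) (c (x, y)),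
       last (v x) (c (x, y)) = v y & all (fun p => `[< A x y p >]) (c (x, y))].
Proof.
move=> e0 arc.
have /choice[c cP] : forall t : V * V, exists c : seq X, G t.1 t.2 ->
    [/\ path (fun p q => `[< lclose e p q >]) (v t.1) c,
       last (v t.1) c = v t.2 & all (fun p => `[< A t.1 t.2 p >]) c].
  move=> [x y]; case: (boolP (G x y)) => [g|_]; last by exists [::].
  have [h [hc _ h0 h1 hA]] := arc _ _ g; have [s [s1 s2 s3]] := arc_chain hc e0.
  exists s => _ /=; rewrite -h0 -h1; split=> //; apply: sub_all s3 => p /asboolP[t t01 ->].
  by apply/asboolP; rewrite -hA; exists t; rewrite //= in_itv.
by exists c => x y; apply: (cP (x, y)).
Qed.

(** What the parity argument needs to know about an embedding. A path x :: s of the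
    graph becomes a polygon from the lift of x to the lift of its last vertex, up to the
    sign y x s, and polygons of disjoint paths do not cross. The extra point o, a vertex
    of no polygon, is the apex of the cones. *)
Lemma drawing (x0 : V) : embeds K G X ->
  exists (I : countType) (P : I -> 'rV[K]_3) (iv : V -> I) (o : I)
         (y : V -> seq V -> bool) (ch : V -> seq V -> seq (I * bool)),
  [/\ forall i j k, uniq [:: i; j; k] -> det3 (P i) (P j) (P k) != 0,
      injective iv,
      forall x s, path G x s ->
        [/\ y x s -> tw,
            last (iv x, false) (ch x s) = sgn (@sopp I) (y x s) (iv (last x s), false),
            stepwise (@fst I bool) (iv x, false) (ch x s) &
            keydisj (@fst I bool) [:: (o, false)] ((iv x, false) :: ch x s)] &
      forall x s x' s', path G x s -> path G x' s' -> s != [::] -> s' != [::] ->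
        ~~ has (mem (x :: s)) (x' :: s') ->
        keydisj (@fst I bool) ((iv x, false) :: ch x s) ((iv x', false) :: ch x' s') /\
        crossings (@sopp I) (schi P) tw (iv x, false) (ch x s) (iv x', false) (ch x' s') = false].
Proof.
move=> [v [A [vI As arc ends meet]]].
have [d d0 far] := edges_away arc ends meet.
(* Small enough for short_cross with steps of length 3 * e, and for the distance d,
   which drops to d / 8 on passing from points to rays. *)
pose e := Num.min (1 / 48) (d / 8 / 57).
have e0 : 0 < e by rewrite lt_min !divr_gt0.
have e48 : e <= 1 / 48 by rewrite ge_min lexx.
have ed : 56 * e < d / 8.
  have : e <= d / 8 / 57 by rewrite ge_min lexx orbT.
  have : 0 < d / 8 by rewrite divr_gt0.
  by move: (d / 8) => D D0; lra.
have [c cP] := edge_chains e0 arc.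
(* Indices of points: vertices, the points of the chain of each edge by number, and None
   for the apex, placed over an arbitrary vertex before the perturbation. *)
pose I : countType := option (V + V * V * nat)%type.
pose iv (x : V) : I := Some (inl x).
pose ptX (i : I) : X := match i with None => v x0 | Some (inl x) => v x
  | Some (inr (t, n)) => nth (v x0) (c t) n end.
pose pt i := slift (ptX i).
have pt_le i : `|pt i| <= 1 by apply: dot_norm_le; exact: lift_unit.
have pt_ge i : 1 / 2 <= `|pt i| by apply: dot_norm_ge; exact: lift_unit.
have [P [Ppt genP]] := generic_approx pt e0.
pose idx x y : seq I :=
  rcons [seq Some (inr (x, y, n)) | n <- iota 0 (size (c (x, y)))] (iv y).
pose fix idxp x (s : seq V) := if s is z :: s' then idx x z ++ idxp z s' else [::].
have ptX_idx x z : map ptX (idx x z) = rcons (c (x, z)) (v z).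
  rewrite map_rcons -map_comp; congr rcons.
  exact: (mkseq_nth (v x0)).
have idx_near x z : G x z -> path (fun i j => `[< nearby tw pt e i j >]) (iv x) (idx x z).
  move=> g; have [c1 c2 c3] := cP _ _ g.
  rewrite -(@path_map _ _ ptX (fun p q => `[< lclose e p q >])) ptX_idx rcons_path c1 c2.
  by rewrite andTb; apply/asboolP; apply: lclose_refl.
have idx_step x z : G x z -> path (fun i j => i != j) (iv x) (idx x z).
  move=> g; rewrite rcons_path; apply/andP; split.
    move: (size _) => n; case: n => [//|n] /=; move: 0%N => m.
    by elim: n m => [//|n IH] m /=; rewrite IH andbT; apply/eqP => -[/n_Sn].
  case: (size _) => [|n] /=; last by rewrite last_map.
  by apply/eqP => -[xz]; move: g; rewrite xz adj_irrefl.
have idx_over x z : G x z -> all (fun i => `[< A x z (ptX i) >]) (iv x :: idx x z).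
  move=> g; have [c1 c2 c3] := cP _ _ g; have [h [hc _ h0 h1 hA]] := arc _ _ g.
  rewrite /= -(all_map ptX (fun p => `[< A x z p >])) ptX_idx all_rcons c3 andbT.
  apply/andP; split; apply/asboolP; rewrite -hA; [exists 0|exists 1]; rewrite //= in_itv /= ?lexx ?ler01 //.
have idx_last x z : last (iv x) (idx x z) = iv z by rewrite last_rcons.
have idxp_last x s : last (iv x) (idxp x s) = iv (last x s).
  by elim: s x => [//|z s IH] x /=; rewrite last_cat idx_last.
have idxp_near x s : path G x s -> path (fun i j => `[< nearby tw pt e i j >]) (iv x) (idxp x s).
  by elim: s x => [//|z s IH] x /= /andP[g gs]; rewrite cat_path idx_near // idx_last IH.
have idxp_step x s : path G x s -> path (fun i j => i != j) (iv x) (idxp x s).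
  by elim: s x => [//|z s IH] x /= /andP[g gs]; rewrite cat_path idx_step // idx_last IH.
have idxp_over x s i : path G x s -> s != [::] -> i \in iv x :: idxp x s ->
    exists z w, [/\ z \in x :: s, w \in x :: s, G z w & A z w (ptX i)].
  elim: s x => [//|z s IH] x /= /andP[g gs] _; rewrite -cat_cons mem_cat => /orP[ix|iz].
    exists x, z; rewrite !inE !eqxx ?orbT; split=> //.
    by have /allP/(_ _ ix)/asboolP := idx_over _ _ g.
  have s0 : s != [::] by move: iz; case: (s).
  have iz' : i \in iv z :: idxp z s by rewrite inE iz orbT.
  have [a [b [az bz gab Aab]]] := IH z gs s0 iz'.
  by exists a, b; rewrite inE az orbT inE bz orbT.
have idxp_some x s : all isSome (iv x :: idxp x s).
  elim: s x => [//|z s IH] x; have := IH z.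
  rewrite /= all_cat /idx all_rcons all_map /= => ->; rewrite andbT.
  exact/allP.
have chP (t : V * seq V) : exists s' : seq (I * bool), path G t.1 t.2 ->
   [/\ map fst s' = idxp t.1 t.2, all (fun a => a.2 ==> tw) s' &
    path (step e P) (iv t.1, false) s'].
  case: (boolP (path G t.1 t.2)) => [g|_]; last by exists [::].
  have nt : false -> tw by [].
  by have [s' sP] := lift_signs Ppt nt (idxp_near _ _ g); exists s'.
have /choice[ch {}chP] := chP.
exists I, P, iv, None, (fun x s => (last (iv x, false) (ch (x, s))).2), (fun x s => ch (x, s)).
have stepE x s : path G x s -> stepwise (@fst I bool) (iv x, false) (ch (x, s)).
  move=> g; have [c1 c2 c3] := chP (x, s) g.
  by rewrite /stepwise -(@path_map _ _ (@fst I bool) (fun i j => i != j)) c1; apply: idxp_step.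
have keysE x s : path G x s -> map (@fst I bool) ((iv x, false) :: ch (x, s)) = iv x :: idxp x s.
  by move=> g; have [c1 c2 c3] := chP (x, s) g; rewrite /= c1.
have signs x s : path G x s -> all (fun a : I * bool => a.2 ==> tw) ((iv x, false) :: ch (x, s)).
  by move=> g; have [c1 c2 c3] := chP (x, s) g; rewrite /= c2.
split=> // [x z []//|x s g|x s x' s' g g' s0 s'0 dj].
  have [c1 c2 c3] := chP (x, s) g; split.
  - by apply/implyP; exact: (all_last (signs x s g)).
  - have : (last (iv x, false) (ch (x, s))).1 = iv (last x s).
      by rewrite -(last_map (@fst I bool)) c1 /= idxp_last.
    by case: (last _ _) => i [] /= ->.
  - exact: stepE.
  - rewrite /keydisj /= andbT.
    have := idxp_some x s; rewrite -(keysE x s g) all_map => /andP[_].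
    by apply: sub_all => -[[i|] b].
have farE i j : i \in iv x :: idxp x s -> j \in iv x' :: idxp x' s' -> hsep tw (d / 8) (pt i) (pt j).
  move=> /(idxp_over _ _ _ g s0)[z [w [zs ws gzw Ai]]] /(idxp_over _ _ _ g' s'0)[z' [w' [zs' ws' gzw' Aj]]].
  apply: unit_hsep; rewrite ?lift_unit //.
  apply: (far z w z' w') => //; apply: contra dj => /hasP[u uz' uz]; apply/hasP.
  by exists u; [move: uz'|move: uz]; rewrite /= !inE => /orP[] /eqP ->.
have farS a b : a \in (iv x, false) :: ch (x, s) -> b \in (iv x', false) :: ch (x', s') ->
    hsep tw (d / 8) (pt a.1) (pt b.1).
  by move=> ha hb; apply: farE; rewrite -keysE // map_f.
have kd : keydisj (@fst I bool) ((iv x, false) :: ch (x, s)) ((iv x', false) :: ch (x', s')).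
  apply/allP => a ha; apply/allP => b hb; apply/eqP => ab.
  have nt : false -> tw by [].
  have := farS a b ha hb false nt 1 ltr01; rewrite ab /= scale1r subrr normr0.
  by rewrite leNgt divr_gt0.
split=> //; have [c1 c2 c3] := chP (x, s) g; have [c1' c2' c3'] := chP (x', s') g'.
apply: (@cross_far _ _ _ _ pt_le pt_ge _ _ e0 e48 Ppt genP _ _ _ _ (d / 8)) => //.
- exact: stepE.
- exact: stepE.
Qed.

End Drawing.

(** * K_5 on the sphere, K_{3,5} and K_7 on the projective plane *)

Local Close Scope quotient_scope.
Local Close Scope ring_scope.
Local Close Scope classical_set_scope.

Definition indep (e e' : nat * nat) :=
  ~~ has (mem [:: e.1; e.2]) [:: e'.1; e'.2].

(** A subdivision in G of the graph with vertices vs and edges es. The vertices are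
    numbers, so that finite checks on the graph can be computed; p e lists the vertices
    of the path after its first one. Paths of edges with a common end may meet anywhere,
    since only independent edges enter the parity argument. *)
Record subdivision (V : finType) (G : sgraph V) (vs : seq nat) (es : seq (nat * nat))
    (f : nat -> V) (p : nat * nat -> seq V) : Prop := Subdivision {
  subdivision_uniq : uniq (map f vs);
  subdivision_path : forall e, e \in es -> path G (f e.1) (p e);
  subdivision_last : forall e, e \in es -> last (f e.1) (p e) = f e.2;
  subdivision_disjoint : forall e e', e \in es -> e' \in es -> indep e e' ->
    ~~ has (mem (f e.1 :: p e)) (f e'.1 :: p e') }.

Definition K5_edges := [seq e <- [seq (i, j) | i <- iota 0 5, j <- iota 0 5] | e.1 < e.2].
Definition K33_edges := [seq (i, j) | i <- iota 0 3, j <- iota 3 3].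
Definition K35_edges := [seq (i, j) | i <- iota 0 5, j <- iota 5 3].

Definition K5_pairs :=
  [:: ((0, 1), (2, 3)); ((0, 2), (1, 3)); ((0, 3), (1, 2));
      ((0, 1), (2, 4)); ((0, 2), (1, 4)); ((0, 4), (1, 2));
      ((0, 1), (3, 4)); ((0, 3), (1, 4)); ((0, 4), (1, 3));
      ((0, 2), (3, 4)); ((0, 3), (2, 4)); ((0, 4), (2, 3));
      ((1, 2), (3, 4)); ((1, 3), (2, 4)); ((1, 4), (2, 3))].

Definition K33_pairs :=
  [:: ((0, 3), (1, 4)); ((0, 4), (1, 3)); ((0, 3), (1, 5)); ((0, 5), (1, 3));
      ((0, 4), (1, 5)); ((0, 5), (1, 4));
      ((0, 3), (2, 4)); ((0, 4), (2, 3)); ((0, 3), (2, 5)); ((0, 5), (2, 3));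
      ((0, 4), (2, 5)); ((0, 5), (2, 4));
      ((1, 3), (2, 4)); ((1, 4), (2, 3)); ((1, 3), (2, 5)); ((1, 5), (2, 3));
      ((1, 4), (2, 5)); ((1, 5), (2, 4))].

Section Obstruction.
Variables (K : realType) (tw : bool) (V : finType) (G : sgraph V).

(** In an embedded subdivision, the bits y of the paths predict the crossings of a
    geodesic drawing of the graph. *)
Lemma drawing_parity : embeds K G (crosscap_surface K tw) ->
  exists (y : V -> seq V -> bool), (forall x s, path G x s -> y x s -> tw) /\
   forall vs es f p (L : seq ((nat * nat) * (nat * nat))),
    subdivision G vs es f p ->
    all (fun q => [&& q.1 \in es, q.2 \in es & indep q.1 q.2]) L ->
    perm_eq (ends L) (undup (ends L) ++ undup (ends L)) ->
    all (fun e => [&& e.1 \in vs, e.2 \in vs & e.1 != e.2]) es ->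
  exists (I : eqType) (P : I -> 'rV[K]_3) (v : nat -> I * bool),
    [/\ forall i j k, uniq [:: i; j; k] -> det3 (P i) (P j) (P k) != 0%R,
        uniq (map (fun i => (v i).1) vs) &
    \big[addb/false]_(q <- L) (y (f q.1.1) (p q.1) && y (f q.2.1) (p q.2)) =
    \big[addb/false]_(q <- L) Xtw (@sopp I) (schi P) tw (v q.1.1) (v q.1.2) (v q.2.1) (v q.2.2)].
Proof.
move=> emb; have [x0 _|V0] := pickP (@predT V); last first.
  exists (fun _ _ => false); split=> // vs es f; by have := V0 (f 0).
have [I [P [iv [oo [y [ch [genP ivI chP sepP]]]]]]] := drawing x0 emb.
exists y; split=> [x s g|vs es f p L [fu fp fl fd] /allP hL hE /allP hes].
  by have [] := chP x s g.
exists I, P, (fun i => (iv (f i), false)); split=> //.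
  by rewrite (map_comp iv f) map_inj_uniq.
have fI i j : i \in vs -> j \in vs -> i != j -> f i != f j.
  move=> iv' jv; apply: contra => /eqP fij.
  have := nth_index 0 iv'; have := nth_index 0 jv => jE iE.
  have si : index i vs < size (map f vs) by rewrite size_map index_mem.
  have sj : index j vs < size (map f vs) by rewrite size_map index_mem.
  have := nth_uniq (f 0) si sj fu; rewrite !(nth_map 0) ?index_mem // iE jE fij eqxx.
  by move=> /esym/eqP h; rewrite -iE -jE h.
have p0 e : e \in es -> p e != [::].
  move=> ee; have /and3P[e1 e2 e12] := hes _ ee; apply: contraNneq (fI _ _ e1 e2 e12) => pe.
  by rewrite -(fl _ ee) pe.
apply: (@parity I _ fst (@sopp I) (schi P) _ (schiC genP) (schiA genP) (schiN genP) (schiGP genP)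
   tw (fun i => (iv (f i), false)) (fun e => ch (f e.1) (p e)) (fun e => y (f e.1) (p e)) (oo, false) es L (undup (ends L))) => //.
  move=> e ee; have [h1 h2 h3 h4] := chP _ _ (fp _ ee); split=> //.
    by rewrite h2 (fl _ ee).
  have /and3P[e1 e2 e12] := hes _ ee.
  by rewrite /= (inj_eq ivI) fI.
move=> q /hL/and3P[q1 q2 q12]; split=> //.
  by have [] := sepP _ _ _ _ (fp _ q1) (fp _ q2) (p0 _ q1) (p0 _ q2) (fd _ _ q1 q2 q12).
by have [] := sepP _ _ _ _ (fp _ q1) (fp _ q2) (p0 _ q1) (p0 _ q2) (fd _ _ q1 q2 q12).
Qed.

End Obstruction.

Section Kuratowski.
Variables (K : realType) (V : finType) (G : sgraph V).

(** The bits vanish on the sphere, against XS_K5. *)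
Lemma K5_not_spherical f p : subdivision G (iota 0 5) K5_edges f p ->
  ~ embeds K G (crosscap_surface K 0).
Proof.
move=> sub emb.
have [y [y0 H]] := @drawing_parity K false V G emb.
have [//|//|//|I [P [v [genP vu]]]] := H _ _ _ _ K5_pairs sub.
have yf e : e \in K5_edges -> y (f e.1) (p e) = false.
  by move=> ee; apply/negP => /(y0 _ _ (subdivision_path sub ee)).
rewrite big1_seq; last by move=> q /andP[_ qL]; rewrite yf //; move: q qL; apply/allP.
under eq_bigr do rewrite /Xtw addbF.
have := XS_K5 (schiC genP) (schiA genP) (schiGP genP) (a := v 0) (b := v 1)
  (c := v 2) (d := v 3) (e := v 4) vu.
by rewrite !big_cons !big_nil => ->.
Qed.

Lemma K33_projective : embeds K G (crosscap_surface K 1) ->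
  exists y : V -> seq V -> bool, forall f p,
    subdivision G (iota 0 6) K33_edges f p ->
    \big[addb/false]_(q <- K33_pairs) (y (f q.1.1) (p q.1) && y (f q.2.1) (p q.2)).
Proof.
move=> emb; have [y [_ H]] := @drawing_parity K true V G emb.
exists y => f p sub; have [//|//|//|I [P [v [genP vu ->]]]] := H _ _ _ _ K33_pairs sub.
have := @Xtw_K33 I _ fst (@sopp I) (schi P) (fun=> erefl) (schiC genP) (schiA genP) (schiN genP)
  (schiGP genP) true (v 0) (v 1) (v 2) (v 3) (v 4) (v 5) isT vu.
by rewrite !big_cons !big_nil.
Qed.

(** If the first two rows of the bits differ by a constant, then the sum over
    independent pairs of edges is even, whatever the third row. *)
Lemma K33_parallel_rows : embeds K G (crosscap_surface K 1) ->
  exists y : V -> seq V -> bool, forall f p,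
    subdivision G (iota 0 6) K33_edges f p ->
    let d j := y (f 0) (p (0, j)) (+) y (f 1) (p (1, j)) in
    ~ (d 3 = d 4 /\ d 4 = d 5).
Proof.
move=> /K33_projective[y H]; exists y => f p /H {H} /= + [].
rewrite !big_cons big_nil /=.
move: (y _ (p (0, 3))) (y _ (p (0, 4))) (y _ (p (0, 5))).
move: (y _ (p (1, 3))) (y _ (p (1, 4))) (y _ (p (1, 5))).
move: (y _ (p (2, 3))) (y _ (p (2, 4))) (y _ (p (2, 5))).
by do 3![case]; do 3![case]; do 3![case].
Qed.

(** The edge e of K_{3,3} as an edge of the larger graph, its vertices being listed in
    l. *)
Definition sel (l : seq nat) (e : nat * nat) := (nth 0 l e.1, nth 0 l e.2).

Lemma subdivision_sel (l : seq nat) vs es es' f p :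
    subdivision G vs es f p -> uniq l -> {subset l <= vs} ->
    all (fun e => sel l e \in es) es' ->
    all (fun e => all (fun e' => indep e e' ==> indep (sel l e) (sel l e')) es') es' ->
  subdivision G (iota 0 (size l)) es' (fun i => f (nth 0 l i)) (fun e => p (sel l e)).
Proof.
move=> [fu fp fl fd] ul lvs /allP hE /allP hI; split.
- rewrite (map_comp f) [map (nth 0 l) _](mkseq_nth 0 l) map_inj_in_uniq // => i j il jl fij.
  have iv := lvs _ il; have jv := lvs _ jl.
  have si : index i vs < size (map f vs) by rewrite size_map index_mem.
  have sj : index j vs < size (map f vs) by rewrite size_map index_mem.
  have := nth_uniq (f 0) si sj fu; rewrite !(nth_map 0) ?index_mem // !nth_index // fij eqxx.
  by move=> /esym/eqP h; rewrite -(nth_index 0 iv) -(nth_index 0 jv) h.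
- by move=> e /hE; exact: fp.
- by move=> e /hE; exact: fl.
- move=> e e' ee ee' ind.
  apply: (fd (sel l e) (sel l e') (hE _ ee) (hE _ ee')).
  by have /allP/(_ _ ee')/implyP := hI _ ee; apply.
Qed.

(** Two rows of K_{3,5}, and a third one to complete a K_{3,3}. *)
Definition row_choices := [:: (0, 1, 2); (0, 2, 1); (0, 3, 1); (0, 4, 1); (1, 2, 0);
  (1, 3, 0); (1, 4, 0); (2, 3, 0); (2, 4, 0); (3, 4, 0)].

(** Two bits take four values, and there are five rows. *)
Lemma five_pigeons (a b : nat -> bool) :
  has (fun q => (a q.1.1 == a q.1.2) && (b q.1.1 == b q.1.2)) row_choices.
Proof.
rewrite /=; move: (a 0) (a 1) (a 2) (a 3) (a 4) (b 0) (b 1) (b 2) (b 3) (b 4).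
by do 10![case].
Qed.

(** Up to complement, a row of three bits takes four values, so two of the five rows
    differ by a constant. *)
Lemma K35_not_projective f p : subdivision G (iota 0 8) K35_edges f p ->
  ~ embeds K G (crosscap_surface K 1).
Proof.
move=> sub /K33_parallel_rows[y H].
pose r (i j : nat) := y (f i) (p (i, j)).
have /hasP[[[i i'] i''] iR /andP[/eqP k1 /eqP k2]] :=
  five_pigeons (fun i => r i 5 (+) r i 6) (fun i => r i 6 (+) r i 7).
pose l (q : nat * nat * nat) := [:: q.1.1; q.1.2; q.2; 5; 6; 7].
have good q : q \in row_choices -> [&& uniq (l q), all (mem (iota 0 8)) (l q),
    all (fun e => sel (l q) e \in K35_edges) K33_edges &
    all (fun e => all (fun e' => indep e e' ==> indep (sel (l q) e) (sel (l q) e'))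
      K33_edges) K33_edges].
  by move: q; apply/allP.
have /and4P[h1 /allP h2 h3 h4] := good _ iR.
case: (H _ _ (subdivision_sel sub h1 h2 h3 h4)); rewrite /sel /= -/(r _ _).
rewrite /= -!/(r _ _) in k1 k2 *.
move: k1 k2; do 6![case: (r _ _)]; by [].
Qed.

(** The three columns to be taken among the five vertices after the first two. *)
Definition K7_choices := [:: (2, 3, 4); (2, 3, 5); (2, 3, 6); (2, 4, 5); (2, 4, 6);
  (2, 5, 6); (3, 4, 5); (3, 4, 6); (3, 5, 6); (4, 5, 6)].

Definition K7_edges := [seq e <- [seq (i, j) | i <- iota 0 7, j <- iota 0 7] | e.1 != e.2].

Lemma five_in_two (a : nat -> bool) :
  has (fun q => (a q.1.1 == a q.1.2) && (a q.1.2 == a q.2)) K7_choices.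
Proof.
rewrite /=; move: (a 2) (a 3) (a 4) (a 5) (a 6).
by do 5![case].
Qed.

(** Of the five other vertices, three see the first two vertices with the same
    difference of bits; a fourth serves as the third row. *)
Lemma K7_not_projective f p : subdivision G (iota 0 7) K7_edges f p ->
  ~ embeds K G (crosscap_surface K 1).
Proof.
move=> sub /K33_parallel_rows[y H].
pose r (i j : nat) := y (f i) (p (i, j)).
have /hasP[[[i i'] i''] iR /andP[/eqP k1 /eqP k2]] :=
  five_in_two (fun j => r 0 j (+) r 1 j).
pose l (q : nat * nat * nat) :=
  [:: 0; 1; head 0 [seq j <- iota 2 5 | j \notin [:: q.1.1; q.1.2; q.2]]; q.1.1; q.1.2; q.2].
have good q : q \in K7_choices -> [&& uniq (l q), all (mem (iota 0 7)) (l q),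
    all (fun e => sel (l q) e \in K7_edges) K33_edges &
    all (fun e => all (fun e' => indep e e' ==> indep (sel (l q) e) (sel (l q) e'))
      K33_edges) K33_edges].
  by move: q; apply/allP.
have /and4P[h1 /allP h2 h3 h4] := good _ iR.
by case: (H _ _ (subdivision_sel sub h1 h2 h3 h4)); split.
Qed.

End Kuratowski.

(** * Points of the surface given by directions *)

Local Open Scope classical_set_scope.
Local Open Scope ring_scope.
Local Open Scope quotient_scope.

Section Rays.
Variables (K : realType) (tw : bool).
Let X := crosscap_surface K tw.
Implicit Types (u v w : 'rV[K]_3) (x z : X).

(** An open set of the quotient that contains x contains all points whose lift is close
    to that of x up to sign. On the rim the neighbourhoods of both lifts count; off the
    rim the antipode of the lift is outside the hemisphere and far from every lift. *)
Lemma nbhs_lclose x (U : set X) : nbhs x U ->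
  exists2 e : K, 0 < e & forall z, lclose e x z -> U z.
Proof.
rewrite nbhsE; case=> B [Bop Bx] BU.
have [W oW WE] : open (\pi_X @^-1` B) := Bop.
have inW z (s : bool) : (s -> tw) -> holed_sphere tw (sgv s (slift z)) ->
    B z <-> W (sgv s (slift z)).
  move=> hs hz; pose p : holed_sphere (K := K) tw := exist (fun q : 'rV[K]_3 => q \in holed_sphere (K := K) tw) _ (mem_set hz).
  have pz : \pi_X p = z.
    rewrite -[z]reprK; apply/eqmodP; apply/gluedP; exists s; split => //.
  have <- : (set_val @^-1` W) p <-> W (sgv s (slift z)) by [].
  by rewrite WE /= pz.
have hl z : holed_sphere tw (slift z) by apply: set_mem; exact: valP.
have nf : false -> tw by [].
have W1 : W (slift x) := (inW x false nf (hl x)).1 Bx.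
have [e1 e10 H1] : exists2 e : K, 0 < e & ball (slift x) e `<=` W.
  by have /nbhs_ballP[e /= e0 H] := open_nbhs_nbhs (conj oW W1); exists e.
have nW z : W (slift z) -> B z := (inW z false nf (hl z)).2.
have [htw|htw] := eqVneq tw true; last first.
  exists e1 => // z [s [hs hz]]; apply/BU/nW/H1.
  rewrite -ball_normE /=; case: s hs hz => //= /(_ isT) h.
  by case/eqP: htw.
have /holedP[_ /(_ htw)] := hl x; rewrite le_eqVlt => /predU1P[x0|x0].
  have W2 : W (- slift x).
    apply: (inW x true _ _).1 => //; apply/holedP; split=> /= [|_]; last by rewrite mxE x0 oppr0.
    by rewrite -(lift_unit x) !dotE !mxE !mulrNN.
  have [e2 e20 H2] : exists2 e : K, 0 < e & ball (- slift x) e `<=` W.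
    by have /nbhs_ballP[e /= e0 H] := open_nbhs_nbhs (conj oW W2); exists e.
  exists (Num.min e1 e2); first by rewrite lt_min e10.
  move=> z [[] [_]]; rewrite lt_min => /andP[h1 h2]; apply/BU/nW.
    by apply: H2; rewrite -ball_normE /= -opprD normrN; move: h2; rewrite /= opprK.
  by apply: H1; rewrite -ball_normE.
exists (Num.min e1 (- slift x 0 0)); first by rewrite lt_min e10 oppr_gt0.
move=> z [[] [_]]; rewrite lt_min => /andP[h1 h2]; last first.
  by apply/BU/nW/H1; rewrite -ball_normE.
exfalso; have /holedP[_ /(_ htw) z0] := hl z.
have [_ /(_ 0)] := (mx_norm_ltP _ _).1 h2; rewrite /= !mxE opprK.
by rewrite ltr_norml opprK ltrDl ltNge z0.
Qed.

Lemma dot_gt0 v : v != 0 -> 0 < dot v v.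
Proof.
move=> v0; rewrite lt_neqAle; apply/andP; split; last first.
  by rewrite dotE -!expr2 !addr_ge0 ?sqr_ge0.
apply: contraNneq v0; rewrite dotE -!expr2 => /esym/eqP.
rewrite !paddr_eq0 ?addr_ge0 ?sqr_ge0 // !sqrf_eq0 => /andP[/andP[/eqP h0 /eqP h1] /eqP h2].
by apply/eqP/row3P; rewrite mxE.
Qed.

Definition unitize v := (Num.sqrt (dot v v))^-1 *: v.

Lemma dotZ (a : K) v : dot (a *: v) (a *: v) = a ^+ 2 * dot v v.
Proof. by rewrite !dotE !mxE; ring. Qed.

Lemma unitize_unit v : v != 0 -> dot (unitize v) (unitize v) = 1.
Proof.
move=> /dot_gt0 h; rewrite /unitize dotZ exprVn sqr_sqrtr ?ltW //.
by rewrite mulVf ?lt0r_neq0.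
Qed.

Lemma unitizeZ (c : K) v : v != 0 -> 0 < c -> unitize (c *: v) = unitize v.
Proof.
move=> /dot_gt0 h c0; rewrite /unitize dotZ sqrtrM ?sqr_ge0 // sqrtr_sqr gtr0_norm //.
by rewrite scalerA invfM mulrAC mulVf ?mul1r ?lt0r_neq0.
Qed.

Lemma unitizeN v : unitize (- v) = - unitize v.
Proof. by rewrite /unitize scalerN !dotE !mxE !mulrNN. Qed.

Definition axis : 'rV[K]_3 := \row_j [:: -1; 0; 0]`_j.

Lemma axis0 : axis != 0.
Proof. by apply/eqP => /rowP/(_ 0); rewrite !mxE /= => /eqP; rewrite oppr_eq0 oner_eq0. Qed.

(** The direction v meets the sphere in a point which, possibly after a change of sign,
    lies in the hemisphere. *)
Lemma ray_ex v : exists x, v != 0 ->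
  exists s : bool, (s -> tw) /\ slift x = sgv s (unitize v).
Proof.
suff nz w : w != 0 -> exists x, exists s : bool, (s -> tw) /\ slift x = sgv s (unitize w).
  have [->|/nz[x xP]] := eqVneq v 0; last by exists x.
  by have [x _] := nz _ axis0; exists x.
move=> w0; pose s := tw && (0 < unitize w 0 0).
have hs : holed_sphere tw (sgv s (unitize w)).
  apply/holedP; split; first by rewrite -(unitize_unit w0); case: (s); rewrite //= !dotE !mxE !mulrNN.
  move=> htw; rewrite /s htw /=; case: ltP => //= h; by rewrite mxE oppr_le0 ltW.
pose p : holed_sphere (K := K) tw := exist (fun q : 'rV[K]_3 => q \in holed_sphere (K := K) tw) _ (mem_set hs).
exists (\pi_X p); have [s' [hs' E]] := lift_pi p; exists (s' (+) s); split.
  by move: hs'; rewrite /s; case: s' {E} => //= h; case: (tw) h.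
by rewrite E /= -sgvK.
Qed.

Definition ray : 'rV[K]_3 -> X := projT1 (choice ray_ex).

Lemma rayP v : v != 0 -> exists s : bool, (s -> tw) /\ slift (ray v) = sgv s (unitize v).
Proof. exact: (projT2 (choice ray_ex) v). Qed.

Lemma rayZ (c : K) v : v != 0 -> 0 < c -> ray (c *: v) = ray v.
Proof.
move=> v0 c0; have cv0 : c *: v != 0 by rewrite scaler_eq0 negb_or lt0r_neq0.
have [s [hs E]] := rayP v0; have [s' [hs' E']] := rayP cv0.
apply: (@slift_inj K tw _ _ (s (+) s')).
  by case: s s' hs hs' {E E'} => [] [] //= h1 h2 _; auto.
by rewrite E E' unitizeZ // sgvK; case: (s) (s') => [] [].
Qed.

Lemma rayN v : tw -> v != 0 -> ray (- v) = ray v.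
Proof.
move=> htw v0; have nv0 : - v != 0 by rewrite oppr_eq0.
have [s [hs E]] := rayP v0; have [s' [hs' E']] := rayP nv0.
apply: (@slift_inj K tw _ _ (~~ (s (+) s'))) => [_ //|].
rewrite E E' unitizeN -[- unitize v]/(sgv true _) !sgvK.
by case: (s) (s') => [] [].
Qed.

Lemma ray_inj v w : v != 0 -> w != 0 -> ray v = ray w ->
  exists2 c : K, c != 0 & v = c *: w.
Proof.
move=> v0 w0 E; have [s [_ E1]] := rayP v0; have [s' [_ E2]] := rayP w0.
have {E E1 E2} : sgv s (unitize v) = sgv s' (unitize w) by rewrite -E1 -E2 E.
have v1 : Num.sqrt (dot v v) != 0 by rewrite sqrtr_eq0 -ltNge dot_gt0.
have w1 : (Num.sqrt (dot w w))^-1 != 0 by rewrite invr_eq0 sqrtr_eq0 -ltNge dot_gt0.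
move=> /(congr1 (sgv s)); rewrite !sgvK addbb /= /unitize => E.
have -> : v = Num.sqrt (dot v v) *: ((Num.sqrt (dot v v))^-1 *: v).
  by rewrite scalerA mulfV // scale1r.
rewrite E sgvZ scalerA.
case: (s (+) s') => /=; last by eexists; last reflexivity; rewrite mulf_neq0.
by rewrite scalerN -scaleNr; eexists; last reflexivity; rewrite oppr_eq0 mulf_neq0.
Qed.

Lemma dot_continuous : continuous (fun w : 'rV[K]_3 => dot w w).
Proof.
have cc (j : 'I_3) : continuous (fun w : 'rV[K]_3 => w 0 j : K) by exact: coord_continuous.
have cm (j : 'I_3) : continuous (fun w : 'rV[K]_3 => w 0 j * w 0 j).
  by move=> v; apply: (@continuousM _ _ (fun w : 'rV[K]_3 => w 0 j) (fun w : 'rV[K]_3 => w 0 j) v); exact: cc.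
apply: continuous_big; first exact: add_continuous.
by move=> j _; exact: cm.
Qed.

Lemma unitize_continuous v : v != 0 -> {for v, continuous unitize}.
Proof.
move=> v0; have s0 : Num.sqrt (dot v v) != 0 by rewrite sqrtr_eq0 -ltNge dot_gt0.
have dc : {for v, continuous (fun w : 'rV[K]_3 => dot w w)} by exact: dot_continuous.
have sc : {for v, continuous (fun w : 'rV[K]_3 => Num.sqrt (dot w w))}.
  by apply: (@continuous_comp _ _ _ (fun w : 'rV[K]_3 => dot w w) Num.sqrt v dc); exact: sqrt_continuous.
have ic : {for v, continuous (fun w : 'rV[K]_3 => (Num.sqrt (dot w w))^-1)}.
  by apply: (@continuousV _ _ (fun w : 'rV[K]_3 => Num.sqrt (dot w w)) v).
have idc : {for v, continuous (fun w : 'rV[K]_3 => w)} by exact: cvg_id.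
have := @continuousZ _ _ _ (fun w : 'rV[K]_3 => (Num.sqrt (dot w w))^-1) (fun w : 'rV[K]_3 => w) v ic idc.
exact.
Qed.

Lemma ray_continuous (p : K -> 'rV[K]_3) : {within `[0, 1], continuous p} ->
  (forall t : K, 0 <= t <= 1 -> p t != 0) -> {within `[0, 1], continuous (fun t => ray (p t))}.
Proof.
move=> pc p0; apply/subspace_continuousP => t tI U Unb.
have t01 : 0 <= t <= 1 by move: tI; rewrite /= in_itv.
have [e e0 HU] := nbhs_lclose Unb.
have /subspace_continuousP/(_ _ tI) pct := pc.
have : (unitize \o p) @ (within `[0, 1] (nbhs t)) --> unitize (p t).
  by apply: continuous_cvg; [apply: unitize_continuous; exact: p0|exact: pct].
move=> /cvgrPdist_lt/(_ e e0); rewrite near_withinE => H.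
suff : \forall s \near t, `[0, 1]%classic s -> U (ray (p s)) by [].
apply: filterS H => s + sI => /(_ sI) /= sP.
have s01 : 0 <= s <= 1 by move: sI; rewrite /= in_itv.
apply: HU; have [a [ha aE]] := rayP (p0 _ t01); have [b [hb bE]] := rayP (p0 _ s01).
exists (a (+) b); split; first by case: a b ha hb {aE bE} => [] [] //= h1 h2 _; auto.
by rewrite aE bE sgvK -addbA addbb addbF -sgvB normr_sgv.
Qed.

End Rays.

(** * Geodesic drawings *)

(** Vertices in the directions P x; the sign s x y selects one of the two segments
    between two points of the projective plane. The hypothesis crossP says that, of two
    independent edges, one lies strictly on one side of the great circle of the other. *)
Section Geodesic.
Variables (K : realType) (tw : bool) (V : finType) (G : sgraph V).
Let X := crosscap_surface K tw.
Variables (P : V -> 'rV[K]_3) (s : V -> V -> bool).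
Hypothesis sC : forall x y, s x y = s y x.
Hypothesis stw : forall x y, s x y -> tw.
Hypothesis crP : forall x y, x != y -> cross_prod (P x) (P y) != 0.
Hypothesis genP : forall x y z, uniq [:: x; y; z] -> det3 (P x) (P y) (P z) != 0.
Hypothesis crossP : forall x y z w, G x y -> G z w -> uniq [:: x; y; z; w] ->
  (0 < det3 (P x) (P z) (P w) * det3 (sgv (s x y) (P y)) (P z) (P w)) ||
  (0 < det3 (P z) (P x) (P y) * det3 (sgv (s z w) (P w)) (P x) (P y)).

Local Notation comb l x m y := (l *: P x + m *: sgv (s x y) (P y)).

Definition seg x y : set X :=
  [set ray tw (comb l.1 x l.2 y) | l in [set l : K * K | [/\ 0 <= l.1, 0 <= l.2 & 0 < l.1 + l.2]]].

Lemma det3_comb (a b c d : 'rV[K]_3) (l m : K) :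
  det3 (l *: a + m *: b) c d = l * det3 a c d + m * det3 b c d.
Proof. by rewrite /det3 !mxE; ring. Qed.

Lemma det3Zl (a c d : 'rV[K]_3) (l : K) : det3 (l *: a) c d = l * det3 a c d.
Proof. by rewrite /det3 !mxE; ring. Qed.

Lemma det3_same1 (a c : 'rV[K]_3) : det3 a a c = 0.
Proof. by rewrite /det3; ring. Qed.

Lemma det3_same2 (a c : 'rV[K]_3) : det3 a c a = 0.
Proof. by rewrite /det3; ring. Qed.

Lemma det3_sgv b (a c d : 'rV[K]_3) : (det3 (sgv b a) c d == 0) = (det3 a c d == 0).
Proof. by case: b => //=; rewrite det3N oppr_eq0. Qed.

Lemma cr_lin (p q : 'rV[K]_3) (l m : K) : cross_prod p q != 0 -> l *: p + m *: q = 0 -> l = 0 /\ m = 0.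
Proof.
move=> pq E.
have h1 : l *: cross_prod p q = cross_prod (l *: p + m *: q) q.
  by apply: row3P; rewrite !mxE /=; ring.
have h2 : m *: cross_prod p q = cross_prod p (l *: p + m *: q).
  by apply: row3P; rewrite !mxE /=; ring.
have z1 (w : 'rV[K]_3) : cross_prod 0 w = 0 by apply: row3P; rewrite !mxE /=; ring.
have z2 (w : 'rV[K]_3) : cross_prod w 0 = 0 by apply: row3P; rewrite !mxE /=; ring.
move: h1 h2; rewrite E z1 z2 => /eqP + /eqP.
by rewrite !scaler_eq0 (negPf pq) !orbF => /eqP-> /eqP->.
Qed.

Lemma cr_sgv b (p q : 'rV[K]_3) : cross_prod p q != 0 -> cross_prod p (sgv b q) != 0.
Proof.
case: b => //=; apply: contra => /eqP h; apply/eqP.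
have -> : cross_prod p q = - cross_prod p (- q) by apply: row3P; rewrite !mxE /=; ring.
by rewrite h oppr0.
Qed.

Lemma comb_neq0 x y (l m : K) : x != y -> 0 <= l -> 0 <= m -> 0 < l + m -> comb l x m y != 0.
Proof.
move=> xy l0 m0 lm; apply/eqP => /(cr_lin (cr_sgv _ (crP xy)))[lE mE].
by rewrite lE mE addr0 ltxx in lm.
Qed.

Lemma P0 x y : x != y -> P x != 0.
Proof.
move=> xy; have := @comb_neq0 x y 1 0 xy ler01 (lexx _).
by rewrite scale0r addr0 scale1r addr0 ltr01; apply.
Qed.

Lemma seg_sub x y : x != y -> seg x y `<=` seg y x.
Proof.
move=> xy u [[l m] [/= l0 m0 lm] <-]; exists (m, l); first by rewrite /= addrC; split.
have yx : y != x by rewrite eq_sym.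
have lm' : 0 < m + l by rewrite addrC.
rewrite /= sC; case: (boolP (s x y)) => [sxy|nsxy] /=; last by rewrite addrC.
have htw := stw sxy.
rewrite -[RHS]rayN //; last by have := comb_neq0 xy l0 m0 lm; rewrite sxy.
by rewrite opprD !scalerN opprK addrC.
Qed.

Lemma segC x y : x != y -> seg x y = seg y x.
Proof. by move=> xy; apply/seteqP; split; apply: seg_sub => //; rewrite eq_sym. Qed.

Lemma ray_sgv (b : bool) (p : 'rV[K]_3) : (b -> tw) -> p != 0 -> ray tw (sgv b p) = ray tw p.
Proof. by case: b => //= h p0; rewrite rayN // h. Qed.

Lemma seg_arc x y : x != y -> simple_arc K (ray tw (P x)) (ray tw (P y)) (seg x y).
Proof.
move=> xy; pose w (t : K) := comb (1 - t) x t y.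
have w0 t : 0 <= t <= 1 -> w t != 0.
  by case/andP => t0 t1; apply: comb_neq0 => //; rewrite ?subr_ge0 // subrK ltr01.
exists (fun t => ray tw (w t)); split.
- apply: ray_continuous => //.
  apply: continuous_subspaceT => t; rewrite /w.
  apply: cvgD.
    by apply: cvgZr_tmp; apply: cvgB; [exact: cvg_cst|exact: cvg_id].
  by apply: cvgZr_tmp; exact: cvg_id.
- move=> t t' /set_mem; rewrite /= in_itv /= => t01 /set_mem; rewrite /= in_itv /= => t01' E.
  have [c c0] := ray_inj (w0 _ t01) (w0 _ t01') E; rewrite /w => wE.
  have : (1 - t - c * (1 - t')) *: P x + (t - c * t') *: sgv (s x y) (P y) = 0.
    rewrite !scalerBl -!scalerA addrACA -opprD -scalerDr -wE !scalerBl ?subrr //.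
  move/(cr_lin (cr_sgv _ (crP xy))) => [h1 h2].
  have cE : c = 1 by lra.
  by rewrite cE in h2; lra.
- by rewrite /w subr0 scale1r scale0r addr0.
- rewrite /w subrr scale0r add0r scale1r ray_sgv //; first exact: stw.
  by apply: (@P0 _ x); rewrite eq_sym.
apply/seteqP; split => u /=.
  move=> [t]; rewrite /= in_itv /= => /andP[t0 t1] <-; exists (1 - t, t) => //=.
  by rewrite subr_ge0 t0 t1 subrK ltr01.
move=> [[l m] [/= l0 m0 lm] <-]; exists (m / (l + m)).
  by rewrite /= in_itv /= (divr_ge0 m0 (ltW lm)) ler_pdivrMr // mul1r lerDr.
have -> : w (m / (l + m)) = (l + m)^-1 *: comb l x m y.
  rewrite /w scalerDr !scalerA [m / _]mulrC; congr (_ *: _ + _).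
  by field; rewrite lt0r_neq0.
by apply: rayZ; rewrite ?invr_gt0 //; apply: comb_neq0.
Qed.

Lemma det3_comb0 x y (l m : K) : det3 (comb l x m y) (P x) (P y) = 0.
Proof.
rewrite det3_comb det3_same1 mulr0 add0r.
by case: (s x y); rewrite /= ?det3N det3_same2 ?oppr0 mulr0.
Qed.

Lemma seg_vertex x y z : x != y -> seg x y (ray tw (P z)) -> z = x \/ z = y.
Proof.
move=> xy [[l m] [/= l0 m0 lm] E].
have [->|zx] := eqVneq z x; first by left.
have [->|zy] := eqVneq z y; first by right.
have [c c0 zE] := ray_inj (comb_neq0 xy l0 m0 lm) (P0 zx) E; exfalso.
have u : uniq [:: z; x; y] by rewrite /= !inE negb_or zx zy xy.
have := det3_comb0 x y l m; rewrite zE det3Zl => /eqP.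
by rewrite mulf_eq0 (negPf c0) (negPf (genP u)).
Qed.

(** Two segments from x lie on different great circles, which meet in the directions of
    x and of its antipode only. *)
Lemma seg_share x y w : uniq [:: x; y; w] -> seg x y `&` seg x w `<=` [set ray tw (P x)].
Proof.
move=> u; have [xy xw yw] : [/\ x != y, x != w & y != w].
  by move: u; rewrite /= !inE negb_or andbT => /andP[/andP[-> ->] ->].
move=> p [[[l m] [/= l0 m0 lm] <-] [[l' m'] [/= l0' m0' lm'] E]].
have [c c0 zE] := ray_inj (comb_neq0 xw l0' m0' lm') (comb_neq0 xy l0 m0 lm) E.
have := congr1 (fun v => det3 v (P x) (P y)) zE; rewrite det3Zl det3_comb0 mulr0.
rewrite det3_comb det3_same1 mulr0 add0r => /eqP.
have u' : uniq [:: w; x; y] by rewrite /= !inE negb_or xy ![w == _]eq_sym xw yw.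
rewrite mulf_eq0 det3_sgv (negPf (genP u')) orbF => /eqP m'0.
rewrite -E /= m'0 scale0r addr0 rayZ //; first exact: P0 xy.
by move: lm'; rewrite m'0 addr0.
Qed.

(** A common direction lies on the great circles of both segments, so a segment on one
    side of the other's circle excludes it. *)
Lemma seg_disjoint x y z w : G x y -> G z w -> uniq [:: x; y; z; w] ->
  seg x y `&` seg z w `<=` set0.
Proof.
move=> g g' u p [[[l m] [/= l0 m0 lm] <-] [[l' m'] [/= l0' m0' lm'] E]].
have [xy zw] : x != y /\ z != w.
  by move: u; rewrite /= !inE !negb_or => /and4P[/and3P[-> _ _] _ -> _].
have [c c0 zE] := ray_inj (comb_neq0 zw l0' m0' lm') (comb_neq0 xy l0 m0 lm) E.
have pos (a b d e : K) : 0 <= a -> 0 <= b -> 0 < a + b -> 0 < d * e -> a * d + b * e != 0.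
  move=> a0 b0 ab de; have d0 : d != 0 by apply: contraTneq de => ->; rewrite mul0r ltxx.
  apply: contraTneq ab => h; rewrite -leNgt.
  have h1 : a * d ^+ 2 + b * (d * e) = 0.
    by rewrite (_ : _ + _ = d * (a * d + b * e)); [rewrite h mulr0|ring].
  have a1 : 0 <= a * d ^+ 2 by rewrite mulr_ge0 ?sqr_ge0.
  have b1 : 0 <= b * (d * e) by rewrite mulr_ge0 // ltW.
  have /eqP : a * d ^+ 2 = 0 by lra.
  rewrite mulf_eq0 sqrf_eq0 (negPf d0) orbF => /eqP aE.
  have /eqP : b * (d * e) = 0 by lra.
  by rewrite mulf_eq0 (negPf (lt0r_neq0 de)) orbF => /eqP bE; rewrite aE bE addr0.
case/orP: (crossP g g' u) => H.
  have := congr1 (fun v => det3 v (P z) (P w)) zE; rewrite det3Zl det3_comb0 => /esym/eqP.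
  by rewrite mulf_eq0 (negPf c0) det3_comb (negPf (pos _ _ _ _ l0 m0 lm H)).
have := congr1 (fun v => det3 v (P x) (P y)) zE; rewrite det3Zl det3_comb0 mulr0 det3_comb.
by move/eqP; rewrite (negPf (pos _ _ _ _ l0' m0' lm' H)).
Qed.

Lemma geodesic_embedding : embeds K G X.
Proof.
have irr x y : G x y -> x != y by move=> g; apply/eqP => xy; rewrite xy adj_irrefl in g.
exists (fun x => ray tw (P x)).
exists (fun x y => if x == y then set0 else seg x y); split.
- move=> x y E; apply/eqP; apply/negPn/negP => xy.
  have yx : y != x by rewrite eq_sym.
  have [c c0 cE] := ray_inj (P0 xy) (P0 yx) E.
  have /(cr_lin (crP xy))[/eqP] : 1 *: P x + (- c) *: P y = 0.
    by rewrite scale1r cE scaleNr subrr.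
  by rewrite oner_eq0.
- by move=> x y; rewrite eq_sym; case: eqVneq => // yx; apply: segC; rewrite eq_sym.
- by move=> x y /irr xy; rewrite (negPf xy); apply: seg_arc.
- by move=> x y z /irr xy; rewrite (negPf xy); apply: seg_vertex.
move=> x y z w g g'; have xy := irr _ _ g; have zw := irr _ _ g'.
rewrite (negPf xy) (negPf zw) => ne.
have sub a b d : uniq [:: a; b; d] -> seg a b `&` seg a d `<=` range (fun x => ray tw (P x)).
  by move=> u p /(seg_share u) ->; exists a.
have [xz|xz] := eqVneq x z.
  rewrite -xz in zw ne *; have [yw|yw] := eqVneq y w; first by rewrite yw in ne.
  by apply: sub; rewrite /= !inE negb_or xy zw yw.
have [xw|xw] := eqVneq x w.
  rewrite (segC zw) -xw; rewrite -xw in zw ne; have [yz|yz] := eqVneq y z.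
    by case: ne; rewrite yz setUC.
  by apply: sub; rewrite /= !inE negb_or xy eq_sym zw yz.
have [yz|yz] := eqVneq y z.
  rewrite (segC xy) -yz; rewrite -yz in zw ne.
  by apply: sub; rewrite /= !inE negb_or eq_sym xy zw xw.
have [yw|yw] := eqVneq y w.
  rewrite (segC xy) (segC zw) -yw; rewrite -yw in zw ne.
  by apply: sub; rewrite /= !inE negb_or ![y == _]eq_sym xy zw xz.
by move=> p /(seg_disjoint g g'); case; rewrite /= !inE !negb_or xy xz xw yz yw zw.
Qed.

End Geodesic.

(** * Drawings with integer coordinates *)

Local Close Scope quotient_scope.
Local Close Scope classical_set_scope.

Section Tables.

Definition det3z (a b c : int * int * int) : int :=
  a.1.1 * (b.1.2 * c.2 - b.2 * c.1.2)
  - a.1.2 * (b.1.1 * c.2 - b.2 * c.1.1)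
  + a.2 * (b.1.1 * c.1.2 - b.1.2 * c.1.1).

(** The hypotheses on a geodesic drawing with vertices at the integer vectors T, in a
    form decided by computation; s lists the edges that pass through the antipode. *)
Definition drawing_ok (n : nat) (T : seq (int * int * int)) (s : seq (nat * nat))
    (e : rel nat) :=
  let P i := nth (0, 0, 0) T i in
  let sg x y := ((x, y) \in s) || ((y, x) \in s) in
  let ns a b c := det3z (P a) (P b) (P c) < 0 in
  all (fun x => all (fun y => all (fun z => uniq [:: x; y; z] ==>
    (det3z (P x) (P y) (P z) != 0)) (iota 0 n)) (iota 0 n)) (iota 0 n)
  && all (fun x => all (fun y => e x y ==> all (fun z => all (fun w =>
    (e z w && uniq [:: x; y; z; w]) ==>
    ((ns x z w == sg x y (+) ns y z w) || (ns z x y == sg z w (+) ns w x y)))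
    (iota 0 n)) (iota 0 n)) (iota 0 n)) (iota 0 n).

Variables (K : realType) (tw : bool).

Definition vecz (t : int * int * int) : 'rV[K]_3 :=
  \row_j ([:: t.1.1; t.1.2; t.2]`_j)%:~R.

Lemma det3_vecz a b c : det3 (vecz a) (vecz b) (vecz c) = (det3z a b c)%:~R.
Proof.
by rewrite /det3 /det3z !mxE /= !rmorphD /= !rmorphN /= !rmorphM /= !rmorphB /= !rmorphM.
Qed.

Lemma table_embedding n (T : seq (int * int * int)) (s : seq (nat * nat)) (e : rel nat)
    (G : sgraph 'I_n.+3) :
  (forall x y, G x y -> e x y) -> (s != [::] -> tw) -> drawing_ok n.+3 T s e ->
  embeds K G (crosscap_surface K tw).
Proof.
move=> Ge stw /andP[/allP gen /allP cross].
pose P (i : 'I_n.+3) := vecz (nth (0, 0, 0) T i).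
pose sg (x y : 'I_n.+3) := ((val x, val y) \in s) || ((val y, val x) \in s).
have mem (x : 'I_n.+3) : val x \in iota 0 n.+3 by rewrite mem_iota /= ltn_ord.
have vu (l : seq 'I_n.+3) : uniq (map val l) = uniq l by rewrite map_inj_uniq //; exact: val_inj.
have genz (x y z : 'I_n.+3) : uniq [:: x; y; z] ->
    det3z (nth (0, 0, 0) T (val x)) (nth (0, 0, 0) T (val y)) (nth (0, 0, 0) T (val z)) != 0.
  move=> u; have /allP/(_ _ (mem y))/allP/(_ _ (mem z))/implyP := gen _ (mem x).
  by rewrite -[uniq [:: x; y; z]](vu [:: x; y; z]) in u; exact.
have genP (x y z : 'I_n.+3) : uniq [:: x; y; z] -> det3 (P x) (P y) (P z) != 0.
  by move=> /genz u; rewrite det3_vecz intr_eq0.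
apply: (@geodesic_embedding K tw _ G P sg) => //.
- by move=> x y; rewrite /sg orbC.
- by move=> x y; rewrite /sg; case: (s) stw => [|a l] // h _; exact: h.
- move=> x y xy.
  have [z xyz] : exists z, uniq [:: x; y; z].
    case: (pickP (fun z => (z != x) && (z != y))) => [z /andP[zx zy]|h].
      by exists z; rewrite /= !inE negb_or xy ![_ == z]eq_sym zx zy.
    have : #|pred2 x y| = #|'I_n.+3|.
      apply: eq_card => z; rewrite inE /=; have := h z.
      by rewrite -negb_or => /negbFE ->.
    by rewrite card2 card_ord xy.
  have := genP _ _ _ xyz; rewrite det3_cr; apply: contraNneq => ->.
  by rewrite !dotE !mxE !mul0r !addr0.
move=> x y z w g g' u.
have pos (a b : int) (t : bool) : a != 0 -> b != 0 -> (a < 0) = t (+) (b < 0) ->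
    0 < (a%:~R : K) * (if t then - b%:~R else b%:~R).
  move=> a0 b0 h; have -> : (a%:~R : K) * (if t then - b%:~R else b%:~R) =
    (a * (if t then - b else b))%:~R by case: (t); rewrite intrM ?rmorphN.
  rewrite ltr0z; move: h; have [an|ap] := ltP a 0; have [bn|bp] := ltP b 0; case: t => //= _.
  - by rewrite nmulr_rgt0.
  - by rewrite nmulr_rgt0 // oppr_lt0 lt_neqAle eq_sym b0.
  - by rewrite pmulr_rgt0 ?oppr_gt0 // lt_neqAle eq_sym a0.
  - by rewrite pmulr_rgt0 // lt_neqAle eq_sym ?b0 ?a0.
have det_sg (t : bool) a b c : det3 (sgv t (vecz a)) (vecz b) (vecz c) =
    if t then - (det3z a b c)%:~R else (det3z a b c)%:~R.
  by case: t => /=; rewrite ?det3N det3_vecz.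
have [u1 u2 u3 u4] : [/\ uniq [:: x; z; w], uniq [:: y; z; w], uniq [:: z; x; y] & uniq [:: w; x; y]].
  move: u; rewrite /= !inE !negb_or ![z == _]eq_sym ![w == _]eq_sym.
  by case/and4P => /and3P[-> -> ->] /andP[-> ->] ->.
have := cross _ (mem x) => /allP/(_ _ (mem y))/implyP/(_ (Ge _ _ g)).
move=> /allP/(_ _ (mem z))/allP/(_ _ (mem w))/implyP.
rewrite (Ge _ _ g') -(vu [:: x; y; z; w]) in u *.
move=> /(_ u); rewrite !det3_vecz !det_sg.
by case/orP => /eqP h; apply/orP; [left|right]; apply: pos; rewrite ?genz.
Qed.

End Tables.

Section Models.
Variable K : realType.

(** The join of an edge and a path with six vertices. *)
Definition fan_rel (i j : nat) := (i != j) && [|| i < 2, j < 2, i == j.+1 | j == i.+1]%N.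

Lemma fan_spherical (G : sgraph 'I_8) : (forall x y, G x y -> fan_rel x y) ->
  embeds K G (crosscap_surface K 0).
Proof.
move=> h; apply: (@table_embedding K false 5 [:: (-4, 0, 1); (4, 0, 1); (1, 1, 1); (-1, 2, 1);
  (-1, 3, 1); (0, 5, 1); (0, 7, 1); (1, 9, 1)] [::] fan_rel) => //.
Qed.

(** The complete graph on six vertices, with two more vertices of degree two. *)
Definition K6_plus_rel (i j : nat) := (i != j) && [|| i < 2, j < 2 | (i < 6) && (j < 6)]%N.

Lemma K6_plus_projective (G : sgraph 'I_8) : (forall x y, G x y -> K6_plus_rel x y) ->
  embeds K G (crosscap_surface K 1).
Proof.
move=> h; apply: (@table_embedding K true 5 [:: (-1, 1, 2); (0, 0, 3); (1, 3, 0); (-1, 2, -1);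
  (3, 1, 1); (-2, 0, 1); (2, 2, 6); (-3, 1, 6)] [:: (1, 2); (1, 3); (2, 5); (3, 4); (4, 5)]%N
  K6_plus_rel) => //.
Qed.

Lemma embeds_inj (V W : finType) (G : sgraph V) (H : sgraph W) (X : topologicalType) (f : V -> W) :
  injective f -> (forall x y, G x y -> H (f x) (f y)) -> embeds K H X -> embeds K G X.
Proof.
move=> fI fG [v [A [vI As arc ends meet]]].
exists (v \o f), (fun x y => A (f x) (f y)); split.
- exact: inj_comp.
- by move=> x y; apply: As.
- by move=> x y /fG; apply: arc.
- by move=> x y z /fG g /(ends _ _ _ g)[/fI|/fI]; [left|right].
move=> x y z w g g' ne p [p1 p2].
have ne' : ([set f x; f y] <> [set f z; f w])%classic.
  move=> E; apply: ne; apply/seteqP; split => t /= ht.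
    have : [set f z; f w]%classic (f t) by rewrite -E; case: ht => ->; [left|right].
    by case=> /fI ->; [left|right].
  have : [set f x; f y]%classic (f t) by rewrite E; case: ht => ->; [left|right].
  by case=> /fI ->; [left|right].
have [u _ uE] := meet _ _ _ _ (fG _ _ g) (fG _ _ g') ne' p (conj p1 p2).
have p1' := p1; rewrite -uE in p1'; case: (ends _ _ _ (fG _ _ g) p1') => E.
  by exists x; rewrite //= -E.
by exists y; rewrite //= -E.
Qed.

End Models.

(** * Co-maximality and rings of prime order *)

Lemma ring_isomorphic_inv (R S : nzRingType) (g : S -> R) :
  bijective g -> g 1 = 1 -> {morph g : x y / x + y} -> {morph g : x y / x * y} ->
  ring_isomorphic R S.
Proof.
move=> [f gK fK] g1 gD gM.
have fD : {morph f : x y / x + y} by move=> x y; rewrite -{1}(fK x) -{1}(fK y) -gD gK.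
have f0 : f 0 = 0 by apply: (addrI (f 0)); rewrite -fD !addr0.
have fN x : f (- x) = - f x by apply: (addrI (f x)); rewrite -fD !subrr f0.
have fB : zmod_morphism f by move=> x y; rewrite fD fN.
have fM : monoid_morphism f.
  by split=> [|x y]; [rewrite -g1 gK|rewrite -{1}(fK x) -{1}(fK y) -gM gK].
pose F : {rmorphism R -> S} := HB.pack f (GRing.isZmodMorphism.Build R S f fB)
  (GRing.isMonoidMorphism.Build R S f fM).
by exists F; exists g.
Qed.

Section Basics.
Variable R : finComNzRingType.
Implicit Types x y : R.

Lemma comaximalP x y : reflect (exists a b, a * x + b * y = 1) (comaximal x y).
Proof.
apply: (iffP forallP) => [/(_ 1)/existsP[a /existsP[b /eqP E]]|[a [b E]] z].
  by exists a, b.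
by apply/existsP; exists (z * a); apply/existsP; exists (z * b); rewrite -!mulrA -mulrDr E mulr1.
Qed.

Lemma comaximalC x y : comaximal x y -> comaximal y x.
Proof. by move=> /comaximalP[a [b E]]; apply/comaximalP; exists b, a; rewrite addrC. Qed.

Definition unitb x := [exists y, x * y == 1].

Lemma unitP x : reflect (exists y, x * y = 1) (unitb x).
Proof. by apply: (iffP existsP) => -[y /eqP]; exists y => //; apply/eqP. Qed.

Lemma unit_comaximal x y : unitb x -> comaximal x y.
Proof. by move=> /unitP[z xz]; apply/comaximalP; exists z, 0; rewrite mul0r addr0 mulrC. Qed.

Lemma card_natr : #|R|%:R = 0 :> R.
Proof.
have : \sum_(x : R) x = \sum_(x : R) x + \sum_(x : R) 1.
  rewrite -big_split /= (reindex_inj (addIr 1)) //.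
by rewrite -[LHS]addr0 sumr_const => /addrI <-.
Qed.

Lemma coprime_natr m n : coprime m n -> m%:R = 0 :> R -> n%:R <> 0 :> R.
Proof.
move=> cmn m0 n0; have [m00|m_gt0] := posnP m.
  by move: cmn n0; rewrite m00 /coprime gcd0n => /eqP -> /eqP; rewrite oner_eq0.
case: (egcdnP n m_gt0) => km kn /(congr1 (fun k => k%:R : R)).
rewrite natrD !natrM m0 n0 !mulr0 (eqP cmn) add0r => /esym/eqP.
by rewrite oner_eq0.
Qed.

(** If enough multiples of 1 are nonzero then they exhaust the ring. *)
Lemma natr_bij p : #|R| = p -> (forall d, (0 < d < p)%N -> d%:R != 0 :> R) ->
  bijective (fun i : 'I_p => i%:R : R).
Proof.
move=> Rp nz; apply: inj_card_bij; last by rewrite card_ord Rp.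
have H (i j : 'I_p) : (i < j)%N -> i%:R <> j%:R :> R.
  move=> ij E; have d0 : (0 < j - i < p)%N.
    by rewrite subn_gt0 ij (leq_ltn_trans (leq_subr _ _)).
  by have := nz _ d0; rewrite natrB ?(ltnW ij) // E subrr eqxx.
move=> i j E; apply: val_inj => /=; have [ij|ji|//] := ltngtP i j.
  by case: (H _ _ ij).
by case: (H _ _ ji).
Qed.

Lemma prime_natr p d : prime p -> #|R| = p -> (0 < d < p)%N -> d%:R != 0 :> R.
Proof.
move=> pp Rp /andP[d0 dp]; apply/eqP; apply: (@coprime_natr p); last by rewrite -Rp card_natr.
by rewrite prime_coprime // gtnNdvd.
Qed.

(** A ring of prime order is a field, whose co-maximal graph is complete. *)
Lemma prime_complete p x y : prime p -> #|R| = p -> x != y -> comaximal x y.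
Proof.
move=> pp Rp xy; have [f fK gK] := natr_bij Rp (fun d => @prime_natr p d pp Rp).
have p0 : p%:R = 0 :> R by rewrite -Rp card_natr.
have un z : z != 0 -> unitb z.
  move=> z0; have zE := gK z.
  have i0 : (0 < f z)%N by rewrite lt0n; apply: contraNneq z0 => fz; rewrite -zE fz.
  case: (egcdnP p i0) => km kn E _; apply/unitP; exists km%:R.
  rewrite -zE -natrM mulnC E natrD natrM p0 mulr0 add0r.
  have : coprime (f z) p by rewrite coprime_sym prime_coprime // gtnNdvd // ltn_ord.
  by rewrite /coprime => /eqP ->.
have [x0|x0] := eqVneq x 0; last by apply: unit_comaximal; apply: un.
by apply: comaximalC; apply: unit_comaximal; apply: un; rewrite -x0 eq_sym.
Qed.

Lemma Z5_iso : #|R| = 5 -> ring_isomorphic R 'Z_5.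
Proof.
move=> R5; have bij := natr_bij R5 (fun d => @prime_natr 5 d isT R5).
have := card_natr; rewrite R5 => c5.
have md n : (n %% 5)%:R = n%:R :> R by rewrite [in RHS](divn_eq n 5) natrD natrM c5 mulr0 add0r.
apply: (@ring_isomorphic_inv R ('Z_5) (fun i => (i : nat)%:R)) => //.
- by move=> i j; rewrite -natrD -[RHS]md.
- by move=> i j; rewrite -natrM -[RHS]md.
Qed.

End Basics.

(** * Co-maximal graphs with few vertices *)

(** A subdivision of the graph e on T, as a boolean: when equality on T can be computed,
    so can this. *)
Definition subdivision_ok (T : eqType) (e : rel T) (vs : seq nat)
    (es : seq (nat * nat)) (f : nat -> T) (p : nat * nat -> seq T) :=
  [&& uniq (map f vs),
      all (fun a => path e (f a.1) (p a) && (last (f a.1) (p a) == f a.2)) es &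
      all (fun a => all (fun b => indep a b ==>
        ~~ has (mem (f a.1 :: p a)) (f b.1 :: p b)) es) es].

Lemma subdivision_map (T : eqType) (e : rel T) (V : finType) (G : sgraph V) (h : T -> V)
    vs es f p : injective h -> (forall x y, e x y -> G (h x) (h y)) ->
    subdivision_ok e vs es f p ->
  subdivision G vs es (h \o f) (fun a => map h (p a)).
Proof.
move=> hI he /and3P[u /allP pl /allP d]; split.
- by rewrite map_comp map_inj_uniq.
- move=> a /pl/andP[pa _] /=; rewrite path_map; apply: sub_path pa => x y; exact: he.
- by move=> a /pl/andP[_ /eqP la] /=; rewrite last_map la.
move=> a b aes bes ab; have /allP/(_ _ bes)/implyP/(_ ab) := d _ aes.
apply: contra; rewrite -[(h \o f) b.1 :: _]/(map h (f b.1 :: p b)) has_map.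
apply: sub_has => x /=; rewrite -[(h \o f) a.1 :: _]/(map h (f a.1 :: p a)).
by rewrite mem_map.
Qed.

Section Torsion.
Import all_fingroup all_solvable.

Lemma coprime_natr_neq0 (R : finComNzRingType) p q :
  prime p -> (p %| #|R|)%N -> coprime p q -> q%:R != 0 :> R.
Proof.
move=> pp pR cpq; apply/eqP => q0.
have [|x _ xp] := @Cauchy _ p [set: R]%G pp; first by rewrite cardsT.
have : (#[x]%g %| q)%N by rewrite order_dvdn FinRing.zmodXgE -mulr_natr q0 mulr0.
by rewrite xp => pq; move: cpq; rewrite prime_coprime // pq.
Qed.

End Torsion.

Section Graphs.
Variables (K : realType) (R : finComNzRingType).
Local Notation G := (comaximal_graph R).

Lemma adjP (x y : R) : G x y = (x != y) && comaximal x y.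
Proof. by []. Qed.

Lemma fan_sym : symmetric (fun i j : 'I_8 => fan_rel i j).
Proof. by move=> i j; rewrite /fan_rel eq_sym; congr andb; rewrite orbCA; congr [|| _, _ | _]; rewrite orbC. Qed.

Lemma fan_irr : irreflexive (fun i j : 'I_8 => fan_rel i j).
Proof. by move=> i; rewrite /fan_rel eqxx. Qed.

Lemma K6_plus_sym : symmetric (fun i j : 'I_8 => K6_plus_rel i j).
Proof. by move=> i j; rewrite /K6_plus_rel eq_sym; congr andb; rewrite orbCA [(i < 6)%N && _]andbC. Qed.

Lemma K6_plus_irr : irreflexive (fun i j : 'I_8 => K6_plus_rel i j).
Proof. by move=> i; rewrite /K6_plus_rel eqxx. Qed.

Lemma code_spherical (code : R -> nat) : injective code -> (forall x, code x < 8)%N ->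
    (forall x y, x != y -> comaximal x y -> fan_rel (code x) (code y)) ->
  embeds K G (crosscap_surface K 0).
Proof.
move=> cI c8 cG.
apply: (@embeds_inj K _ _ _ (SGraph fan_sym fan_irr) _ (fun x => Ordinal (c8 x))).
- by move=> x y /(congr1 val)/cI.
- by move=> x y /andP[]; exact: cG.
exact: fan_spherical.
Qed.

Lemma code_projective (code : R -> nat) : injective code -> (forall x, code x < 8)%N ->
    (forall x y, x != y -> comaximal x y -> K6_plus_rel (code x) (code y)) ->
  embeds K G (crosscap_surface K 1).
Proof.
move=> cI c8 cG.
apply: (@embeds_inj K _ _ _ (SGraph K6_plus_sym K6_plus_irr) _ (fun x => Ordinal (c8 x))).
- by move=> x y /(congr1 val)/cI.
- by move=> x y /andP[]; exact: cG.
exact: K6_plus_projective.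
Qed.

Lemma card_le4_spherical : (#|R| <= 4)%N -> embeds K G (crosscap_surface K 0).
Proof.
move=> R4; apply: (@code_spherical (fun x => enum_rank x)).
- by move=> x y /val_inj/enum_rank_inj.
- by move=> x; rewrite (leq_trans (ltn_ord _)) // (leq_trans R4).
move=> x y xy _; have : (enum_rank x : nat) != enum_rank y.
  by apply: contra xy => /eqP/val_inj/enum_rank_inj ->.
have := leq_trans (ltn_ord (enum_rank x)) R4; have := leq_trans (ltn_ord (enum_rank y)) R4.
by move: (nat_of_ord _) (nat_of_ord _) => [|[|[|[|]]]] [|[|[|[|]]]].
Qed.

(** In a ring of order six 2 and 3 are not zero, by Cauchy's theorem, so the multiples
    of 1 exhaust it. Neither do two even multiples generate the unit ideal nor do two
    multiples of 3, which leaves a planar graph. *)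
Lemma card6_spherical : #|R| = 6 -> embeds K G (crosscap_surface K 0).
Proof.
move=> R6; have := @card_natr R; rewrite R6 => c6.
have tors p q : prime p -> (p %| 6)%N -> coprime p q -> q%:R != 0 :> R.
  by move=> pp p6; apply: coprime_natr_neq0 => //; rewrite R6.
have n2 : 2%:R != 0 :> R by apply: (@tors 3).
have n3 : 3%:R != 0 :> R by apply: (@tors 2).
have nz d : (0 < d < 6)%N -> d%:R != 0 :> R.
  case: d => [|[|[|[|[|[|d]]]]]] // _.
  - exact: oner_neq0.
  - by apply: (@tors 3).
  - by apply/eqP; apply: (@coprime_natr _ 6).
have [f fK gK] := natr_bij R6 nz.
(* A nonzero multiple of 1 that annihilates two elements shows that they generate a
   proper ideal. *)
have both k (i j : 'I_6) : k%:R != 0 :> R -> (6 %| k * i)%N -> (6 %| k * j)%N ->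
    ~~ comaximal (i%:R : R) j%:R.
  move=> k0 /dvdnP[u ui] /dvdnP[v vj]; apply/comaximalP => -[a [b E]].
  have : k%:R = a * (k * i)%N%:R + b * (k * j)%N%:R :> R.
    by rewrite !natrM ![_ * (k%:R * _)]mulrCA -mulrDr E mulr1.
  rewrite ui vj !natrM c6 !mulr0 addr0; exact/eqP.
pose tab := [:: 5; 0; 2; 3; 4; 1]%N.
apply: (@code_spherical (fun x => nth 0%N tab (f x))).
- move=> x y /eqP; rewrite nth_uniq // => /eqP/val_inj E; exact: (can_inj gK).
- by move=> x; case: (f x) => -[|[|[|[|[|[|]]]]]].
move=> x y xy; rewrite -{1}[x]gK -{1}[y]gK.
have : f x != f y by apply: contra xy => /eqP/(can_inj gK) ->.
move: (f x) (f y) => i j ij cij.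
have := both 3 i j n3; have := both 2 i j n2; rewrite cij.
case: i j ij {cij} => -[|[|[|[|[|[|//]]]]]] ? [[|[|[|[|[|[|//]]]]]] ?] //= _ h2 h3;
  by [have := h2 isT isT | have := h3 isT isT].
Qed.

Lemma K35_complete (r c : seq R) : size r = 5 -> size c = 3 -> uniq (r ++ c) ->
    (forall x y, x \in r -> y \in c -> comaximal x y) ->
  ~ embeds K G (crosscap_surface K 1).
Proof.
move=> r5 c3 u rc.
pose h (i : 'I_8) := nth 0 (r ++ c) i.
pose e (i j : 'I_8) := ((i < 5) != (j < 5))%N.
have sz : size (r ++ c) = 8 by rewrite size_cat r5 c3.
have hI : injective h.
  by move=> i j /eqP; rewrite nth_uniq ?sz ?ltn_ord // => /eqP/val_inj.
have hr (i : 'I_8) : (i < 5)%N -> h i \in r by move=> i5; rewrite /h nth_cat r5 i5 mem_nth ?r5.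
have hc (i : 'I_8) : ~~ (i < 5)%N -> h i \in c.
  by move=> i5; rewrite /h nth_cat r5 (negPf i5) mem_nth ?c3 // ltn_subLR ?ltn_ord // leqNgt.
have he i j : e i j -> G (h i) (h j).
  move=> eij; rewrite adjP (inj_eq hI); apply/andP; split.
    by apply: contraTneq eij => ->; rewrite /e eqxx.
  move: eij; rewrite /e; case: (boolP (i < 5)%N) => i5; case: (boolP (j < 5)%N) => j5 // _.
    by apply: rc; [exact: hr|exact: hc].
  by apply: comaximalC; apply: rc; [exact: hr|exact: hc].
pose ord8 i : 'I_8 := Ordinal (ltn_pmod i (isT : 0 < 8)%N).
apply: (@K35_not_projective K _ _ (h \o ord8) (fun a => map h [:: ord8 a.2])).
exact: (subdivision_map hI he).
Qed.

Lemma complete7_not_projective : #|R| = 7 -> ~ embeds K G (crosscap_surface K 1).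
Proof.
move=> R7; pose h (i : 'I_7) : R := enum_val (cast_ord (esym R7) i).
have hI : injective h by move=> i j /enum_val_inj/cast_ord_inj.
have he i j : i != j -> G (h i) (h j).
  by move=> ij; rewrite adjP (inj_eq hI) ij (@prime_complete _ 7) // (inj_eq hI).
pose o7 i : 'I_7 := Ordinal (ltn_pmod i (isT : 0 < 7)%N).
apply: (@K7_not_projective K _ _ (h \o o7) (fun a => map h [:: o7 a.2])).
exact: (subdivision_map hI he).
Qed.

End Graphs.

(** * The graph of the product of F_2 and a local ring of order four with two units *)

Section FrameDef.
Variable S : comNzRingType.

Definition bit3 := (bool * bool * bool)%type.

Definition fcode (e f n : S) (t : bit3) : S := e *+ t.1.1 + f *+ t.1.2 + n *+ t.2.

(** The ring is the direct product of eR = {0, e} and fR = {0, f, n, f + n}, where n is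
    nilpotent. For k = true the second factor is Z / 4, with n = 2 f, and for k = false
    it is the ring of dual numbers over F_2. *)
Record frame (k : bool) (e f n : S) : Prop := Frame {
  frame1 : e + f = 1;
  frame_ef : e * f = 0;
  frame_fn : f * n = n;
  frame_nn : n * n = 0;
  frame_e0 : e != 0;
  frame_n0 : n != 0;
  frame_2e : e + e = 0;
  frame_2n : n + n = 0;
  frame_2f : f + f = n *+ k;
  frame_cov : forall x, exists t, x = fcode e f n t }.

Variables (k : bool) (e f n : S).
Hypothesis F : frame k e f n.

Let ee : e * e = e.
Proof. by rewrite -[RHS]mulr1 -(frame1 F) mulrDr (frame_ef F) addr0. Qed.
Let ff : f * f = f.
Proof. by rewrite -[RHS]mul1r -(frame1 F) mulrDl (frame_ef F) add0r. Qed.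
Let en : e * n = 0.
Proof. by rewrite -(frame_fn F) mulrA (frame_ef F) mul0r. Qed.

Lemma fcodeM_e t : e * fcode e f n t = e *+ t.1.1.
Proof. by rewrite /fcode !mulrDr !mulrnAr ee (frame_ef F) en !mul0rn !addr0. Qed.

Lemma fcodeM_f t : f * fcode e f n t = f *+ t.1.2 + n *+ t.2.
Proof. by rewrite /fcode !mulrDr !mulrnAr ff [f * e]mulrC (frame_ef F) (frame_fn F) mul0rn add0r. Qed.

Lemma fcodeM_n t : n * fcode e f n t = n *+ t.1.2.
Proof.
rewrite /fcode !mulrDr !mulrnAr [n * e]mulrC en [n * f]mulrC (frame_fn F) (frame_nn F).
by rewrite !mul0rn add0r addr0.
Qed.

Lemma fcode_inj : injective (fcode e f n).
Proof.
move=> [[a b] c] [[a' b'] c'] E.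
have [nz1 nz2] := (frame_e0 F, frame_n0 F).
have H (x : S) (u v : bool) : x != 0 -> x *+ u = x *+ v -> u = v.
  by case: u v => [] [] // /eqP h /=; rewrite ?mulr1n ?mulr0n => // hh; case: h.
have aE : a = a' by apply: (H e) => //; have := fcodeM_e (a, b, c); rewrite E fcodeM_e.
have bE : b = b' by apply: (H n) => //; have := fcodeM_n (a, b, c); rewrite E fcodeM_n.
suff -> : c = c' by rewrite aE bE.
apply: (H n) => //; apply: (addrI (f *+ b)).
by have := fcodeM_f (a, b, c); rewrite E fcodeM_f /= bE.
Qed.

Lemma fcodeD t t' : fcode e f n t + fcode e f n t' =
  fcode e f n (t.1.1 (+) t'.1.1, t.1.2 (+) t'.1.2,
    t.2 (+) t'.2 (+) [&& k, t.1.2 & t'.1.2]).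
Proof.
case: t t' => [[a b] c] [[a' b'] c']; rewrite /fcode /=.
have D (x : S) (u v : bool) : x + x = 0 -> x *+ u + x *+ v = x *+ (u (+) v).
  by move=> xx; case: u v => [] []; rewrite /= ?mulr1n ?mulr0n ?addr0 ?add0r.
have Df (u v : bool) : f *+ u + f *+ v = f *+ (u (+) v) + n *+ [&& k, u & v].
  by case: u v => [] []; rewrite /= ?andbT ?andbF ?mulr1n ?mulr0n ?addr0 ?add0r // (frame_2f F).
rewrite addrACA [e *+ a + f *+ b + _]addrACA (D e) ?(frame_2e F) // Df (D n) ?(frame_2n F) //.
by rewrite -!addrA; congr (_ + (_ + _)); rewrite (D n) ?(frame_2n F) // addbC.
Qed.

Lemma fcodeM t t' : fcode e f n t * fcode e f n t' =
  fcode e f n (t.1.1 && t'.1.1, t.1.2 && t'.1.2, (t.1.2 && t'.2) (+) (t.2 && t'.1.2)).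
Proof.
rewrite {1}/fcode !mulrDl !mulrnAl fcodeM_e fcodeM_f fcodeM_n.
case: t t' => [[a b] c] [[a' b'] c']; rewrite /fcode /=.
have M (x : S) (u v : bool) : x *+ u *+ v = x *+ (v && u).
  by case: u v => [] []; rewrite /= ?mulr1n ?mulr0n ?mul0rn.
have D (u v : bool) : n *+ u + n *+ v = n *+ (u (+) v).
  by case: u v => [] []; rewrite /= ?mulr1n ?mulr0n ?addr0 ?add0r // (frame_2n F).
by rewrite mulrnDl !M -addrA -addrA D addrA.
Qed.

Lemma fcode1 : fcode e f n (true, true, false) = 1.
Proof. by rewrite /fcode /= !mulr1n mulr0n addr0 (frame1 F). Qed.

End FrameDef.

(** Sums and products of codes depend on k only. *)
Lemma frame_iso (R S : comNzRingType) k (e f n : R) (e' f' n' : S) :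
  frame k e f n -> frame k e' f' n' -> ring_isomorphic R S.
Proof.
move=> F F'; have [c cP] := choice (frame_cov F'); have [c' cP'] := choice (frame_cov F).
have cK t : c (fcode e' f' n' t) = t by apply: (fcode_inj F'); rewrite -cP.
have cK' t : c' (fcode e f n t) = t by apply: (fcode_inj F); rewrite -cP'.
apply: (@ring_isomorphic_inv _ _ (fun x => fcode e f n (c x))).
- exists (fun x => fcode e' f' n' (c' x)) => x; first by rewrite cK' -cP.
  by rewrite cK -cP'.
- by rewrite -(fcode1 F') cK (fcode1 F).
- by move=> x y; rewrite {1}[x]cP {1}[y]cP (fcodeD F') cK (fcodeD F).
- by move=> x y; rewrite {1}[x]cP {1}[y]cP (fcodeM F') cK (fcodeM F).
Qed.

Lemma frame_transport (R S : comNzRingType) k (e f n : S) :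
  ring_isomorphic R S -> frame k e f n -> exists e' f' n' : R, frame k e' f' n'.
Proof.
move=> [phi [psi phiK psiK]] F; have phiI := can_inj phiK.
exists (psi e), (psi f), (psi n).
split; do ?[by apply: phiI; rewrite ?rmorphD ?rmorphM ?rmorph1 ?rmorph0 ?rmorphMn ?psiK;
  case: F].
- by apply: contra (frame_e0 F) => /eqP E; rewrite -[e]psiK E rmorph0.
- by apply: contra (frame_n0 F) => /eqP E; rewrite -[n]psiK E rmorph0.
move=> x; have [t tE] := frame_cov F (phi x); exists t.
by apply: phiI; rewrite tE /fcode !rmorphD !rmorphMn /= !psiK.
Qed.

Section FrameGraph.
Variables (K : realType) (R : finComNzRingType) (k : bool) (e f n : R).
Hypothesis F : frame k e f n.
Local Notation G := (comaximal_graph R).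

Definition bit3_adj (t t' : bit3) := (t != t') && (t.1.1 || t'.1.1) && (t.1.2 || t'.1.2).

(** Co-maximality can be tested modulo the nilradical, where the ring is F_2 x F_2. *)
Lemma frame_adj t t' : G (fcode e f n t) (fcode e f n t') = bit3_adj t t'.
Proof.
rewrite adjP (inj_eq (fcode_inj F)) /bit3_adj -andbA; congr (_ && _).
apply/comaximalP/idP => [[a [b E]]|].
  have H (x : R) (u v : bool) : x != 0 -> x = a * (x *+ u) + b * (x *+ v) -> u || v.
    by move=> x0; case: u v => [] [] //; rewrite !mulr0n !mulr0 addr0 => /eqP; rewrite (negPf x0).
  apply/andP; split; [apply: (H e)|apply: (H n)]; rewrite ?(frame_e0 F) ?(frame_n0 F) //.
    by rewrite -!(fcodeM_e F) ![_ * (e * _)]mulrCA -mulrDr E mulr1.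
  by rewrite -!(fcodeM_n F) ![_ * (n * _)]mulrCA -mulrDr E mulr1.
case: t t' => [[a b] c] [[a' b'] c'] /= /andP[aa bb].
exists (fcode e f n (a, b, b && c)), (fcode e f n (~~ a, ~~ b, ~~ b && c')).
rewrite !(fcodeM F) (fcodeD F) -(fcode1 F); congr (fcode e f n (_, _, _)) => /=.
- by case: a a' aa => [] [].
- by case: b b' bb => [] [].
- by case: (k) b c b' c' bb => [] [] [] [] [].
Qed.

(** The two units and e, f, f + n span a K_5 minus the edge from f to f + n, and these
    two have the common neighbour e + n besides. *)
Lemma frame_not_spherical : ~ embeds K G (crosscap_surface K 0).
Proof.
pose vs : seq bit3 := [:: (true, true, false); (true, true, true); (false, true, false);
  (true, false, false); (false, true, true)].
pose p (a : nat * nat) : seq bit3 :=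
  if a == (2, 4)%N then [:: (true, false, true); (false, true, true)]
  else [:: nth (true, true, false) vs a.2].
apply: (@K5_not_spherical K _ _ (fcode e f n \o nth (true, true, false) vs)
  (fun a => map (fcode e f n) (p a))).
apply: (subdivision_map (e := bit3_adj)) => //; first exact: fcode_inj F.
by move=> t t'; rewrite frame_adj.
Qed.

Lemma frame_projective : projective K G.
Proof.
split; last by case=> // /frame_not_spherical.
have [c cP] := choice (frame_cov F).
have [tab tabP] : exists tab : bit3 -> nat, [/\ injective tab, forall t, (tab t < 8)%N &
    forall t t', bit3_adj t t' -> K6_plus_rel (tab t) (tab t')].
  (* The two units become 0 and 1, and the two nilpotent elements, which are adjacent
     to units only, become 6 and 7. *)
  exists (fun t : bit3 => (~~ t.1.2) * 4 + (~~ t.1.1) * 2 + t.2)%N; split.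
  - by move=> [[[] []] []] [[[] []] []].
  - by move=> [[[] []] []].
  - by move=> [[[] []] []] [[[] []] []].
case: tabP => tI t8 tadj; apply: (@code_projective _ _ (tab \o c)).
- by apply: inj_comp => // x y E; rewrite [x]cP [y]cP E.
- by move=> x; exact: t8.
move=> x y xy cxy; apply: tadj; rewrite -frame_adj -!cP adjP xy //.
Qed.

End FrameGraph.

(** * The two rings of order eight *)

Lemma Z2xZ4_frame : @frame ('Z_2 * 'Z_4)%type true (1, 0) (0, 1) (0, 2%:R).
Proof.
split; try by apply/eqP.
case=> -[[|[|//]] ia] [[|[|[|[|//]]]] ib];
 [exists (false, false, false)|exists (false, true, false)|exists (false, false, true)
 |exists (false, true, true)|exists (true, false, false)|exists (true, true, false)
 |exists (true, false, true)|exists (true, true, true)]; by apply/eqP.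
Qed.

Lemma Z2xdual_frame :
  @frame ('Z_2 * {poly %/ ('X^2 : {poly 'Z_2})})%type false (1, 0) (0, 1) (0, 'qX).
Proof.
have mX : mk_monic ('X^2 : {poly 'Z_2}) = 'X^2 by rewrite mk_monic_Xn.
have qXE : ('qX : {poly %/ ('X^2 : {poly 'Z_2})}) = 'X :> {poly 'Z_2}.
  by apply: qpolyXE; rewrite ?size_polyXn ?monicXn.
have p2 (x : {poly 'Z_2}) : x + x = 0.
  by apply/polyP => i; rewrite coefD coef0; case: (x`_i) => -[|[|//]] ? ; apply/eqP.
have q2 (x : {poly %/ ('X^2 : {poly 'Z_2})}) : x + x = 0.
  by apply: val_inj; exact: (p2 (polyn x)).
have z2 (x : 'Z_2) : x + x = 0 by case: x => -[|[|//]] ?; apply/eqP.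
split.
- by congr pair; rewrite ?addr0 ?add0r.
- by congr pair; rewrite ?mulr0 ?mul0r.
- by congr pair; rewrite ?mul0r ?mul1r.
- congr pair; first by rewrite mulr0.
  have E := @poly_of_qpolyM _ ('X^2 : {poly 'Z_2}) 'qX 'qX.
  have Z : Pdiv.CommonRing.rmodp ('X * 'X) (mk_monic ('X^2 : {poly 'Z_2})) = 0.
    by rewrite mX -expr2 Pdiv.RingMonic.rmodpp ?monicXn.
  apply: val_inj; apply: etrans E _; apply: etrans Z.
  by congr (Pdiv.CommonRing.rmodp (_ * _) _); exact: qXE.
- by apply/eqP => /(congr1 fst)/eqP.
- apply/eqP => /(congr1 (fun p : 'Z_2 * {poly %/ ('X^2 : {poly 'Z_2})} => polyn p.2)) E.
  by have /eqP := etrans (esym qXE) E; rewrite polyX_eq0.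
- by congr pair; rewrite ?z2 ?q2.
- by congr pair; rewrite ?z2 ?q2.
- by congr pair; rewrite ?z2 ?q2.
case=> a q; exists (a != 0, (q : {poly _})`_0 != 0, (q : {poly _})`_1 != 0).
have bit (x : 'Z_2) : x = 1 *+ (x != 0) by case: x => -[|[|//]] ?; apply/eqP.
have fE (u v w : bool) : fcode ((1, 0) : 'Z_2 * {poly %/ ('X^2 : {poly 'Z_2})})
    (0, 1) (0, 'qX) (u, v, w) = (1 *+ u, 1 *+ v + 'qX *+ w).
  by case: u v w => [] [] []; rewrite /fcode /= ?mulr1n ?mulr0n; congr pair;
    rewrite /= ?addr0 ?add0r.
rewrite fE -bit; congr pair.
have sq : (size (polyn q) <= 2)%N.
  have s2 : (size (mk_monic ('X^2 : {poly 'Z_2}))).-1 = 2 by rewrite mX size_polyXn.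
  exact: leq_trans (size_npoly q) (eq_leq s2).
have cE (v w : bool) : polyn (1 *+ v + 'qX *+ w : {poly %/ ('X^2 : {poly 'Z_2})}) =
    1 *+ v + 'X *+ w.
  rewrite -[X in _ = _ + X *+ _]qXE.
  by case: v w => [] []; rewrite ?mulr1n ?mulr0n ?addr0 ?add0r.
apply: val_inj; apply: etrans (esym (cE _ _)); apply/polyP => i.
rewrite coefD !coefMn coef1 coefX; case: i => [|[|i]] /=.
- by rewrite mul0rn addr0 -bit.
- by rewrite mul0rn add0r -bit.
- by rewrite !mul0rn addr0 nth_default // (leq_trans sq).
Qed.

(** * Corners of a finite ring *)

Section Corners.
Variable R : finComNzRingType.
Implicit Types g h x y : R.

(** The ring gR, for an idempotent g. *)
Definition corner g : pred R := [pred x | g * x == x].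

(** The units of gR, whose identity is g. *)
Definition cunit g : pred R :=
  [pred x | (g * x == x) && [exists y, (g * y == y) && (x * y == g)]].

Lemma cunitP g x : reflect (g * x = x /\ exists y, g * y = y /\ x * y = g) (cunit g x).
Proof.
apply: (iffP andP) => [[/eqP gx /existsP[y /andP[/eqP gy /eqP xy]]]|[gx [y [gy xy]]]].
  by split=> //; exists y.
by split; [apply/eqP|apply/existsP; exists y; rewrite gy xy !eqxx].
Qed.

(** The corner of a sum of orthogonal idempotents is the product of their corners;
    stated for subsets so as to apply to all elements and to units. *)
Lemma corner_cards g h (A B C : pred R) : g * g = g -> h * h = h -> g * h = 0 ->
    (forall x, A x -> g * x = x) -> (forall x, B x -> h * x = x) ->
    (forall x, C x = ((g + h) * x == x) && A (g * x) && B (h * x)) ->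
  #|C| = (#|A| * #|B|)%N.
Proof.
move=> gg hh gh Ag Bh CE; rewrite -cardX.
rewrite -(card_in_image (f := fun x => (g * x, h * x)) (A := C)); last first.
  move=> x y; rewrite !unfold_in !CE => /andP[/andP[/eqP Ex _] _] /andP[/andP[/eqP Ey _] _] [E1 E2].
  by rewrite -Ex -Ey !mulrDl E1 E2.
apply: eq_card => -[u v]; rewrite !inE /=; apply/fintype.imageP/andP => [[x]|[Au Bv]].
  by rewrite unfold_in CE => /andP[/andP[_ Ax] Bx] [-> ->].
have gu := Ag _ Au; have hv := Bh _ Bv.
have hu : h * u = 0 by rewrite -gu mulrA [h * g]mulrC gh mul0r.
have gv : g * v = 0 by rewrite -hv mulrA gh mul0r.
exists (u + v); last by rewrite !mulrDr gu gv hu hv addr0 add0r.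
by rewrite unfold_in CE mulrDl !mulrDr gu gv hu hv addr0 add0r eqxx; apply/andP.
Qed.

Lemma card_corner g h : g * g = g -> h * h = h -> g * h = 0 ->
  #|corner (g + h)| = (#|corner g| * #|corner h|)%N.
Proof.
move=> gg hh gh; apply: (corner_cards gg hh gh) => [x /eqP|x /eqP|x] //.
by rewrite /corner /= !mulrA gg hh !eqxx !andbT.
Qed.

Lemma card_cunit g h : g * g = g -> h * h = h -> g * h = 0 ->
  #|cunit (g + h)| = (#|cunit g| * #|cunit h|)%N.
Proof.
move=> gg hh gh; apply: (corner_cards gg hh gh) => [x /cunitP[]|x /cunitP[]|x] //.
have hg : h * g = 0 by rewrite mulrC.
apply/cunitP/andP => [[gx [y [gy xy]]]|[/andP[/eqP gx /cunitP[_ [y [gy xy]]]] /cunitP[_ [z [hz xz]]]]].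
  rewrite gx eqxx /=; split; apply/cunitP.
    split; first by rewrite mulrA gg.
    by exists (g * y); split; [rewrite mulrA gg|rewrite mulrACA xy gg mulrDr gg gh addr0].
  split; first by rewrite mulrA hh.
  by exists (h * y); split; [rewrite mulrA hh|rewrite mulrACA xy hh mulrDr hh hg add0r].
split=> //; exists (y + z).
have hy : h * y = 0 by rewrite -gy mulrA hg mul0r.
have gz : g * z = 0 by rewrite -hz mulrA gh mul0r.
split; first by rewrite mulrDl !mulrDr gy gz hy hz addr0 add0r.
by rewrite mulrDr -{1}gy -{1}hz !mulrA [x * g]mulrC [x * h]mulrC xy xz.
Qed.

Lemma card_corner1 : #|corner 1| = #|R|.
Proof. by apply: eq_card => x; rewrite !inE mul1r eqxx. Qed.

Lemma cunit1 x : cunit 1 x = unitb x.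
Proof.
apply/cunitP/unitP => [[_ [y [_ xy]]]|[y xy]]; first by exists y.
by rewrite mul1r; split => //; exists y; rewrite mul1r.
Qed.

(** The powers of x are eventually periodic, and an exponent that is a multiple of the
    period and large enough gives an idempotent. *)
Lemma idem_power x : exists2 k, (0 < k)%N & x ^+ k * x ^+ k = x ^+ k.
Proof.
have /injectivePn[i [j ij E]] : ~~ injectiveb (fun i : 'I_#|R|.+1 => x ^+ i).
  by apply/negP => /injectiveP/leq_card; rewrite card_ord ltnn.
wlog lij : i j ij E / (i < j)%N => [wl|].
  have [lt|lt|/val_inj eq] := ltngtP i j; [exact: (wl i j)| |by rewrite eq eqxx in ij].
  by apply: (wl j i) => //; rewrite eq_sym.
pose p := (j - i)%N; have p0 : (0 < p)%N by rewrite subn_gt0.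
have per m : (i <= m)%N -> x ^+ (m + p) = x ^+ m.
  move=> im; have -> : (m + p = (m - i) + j)%N by rewrite /p; lia.
  by rewrite exprD -E -exprD subnK.
have pers m t : (i <= m)%N -> x ^+ (m + p * t) = x ^+ m.
  elim: t => [|t IH] im; first by rewrite muln0 addn0.
  by rewrite mulnS addnCA addnC per ?IH // (leq_trans im) // leq_addr.
exists (p * i.+1)%N; first by rewrite muln_gt0 p0.
by rewrite -exprD pers // (leq_trans (leqnSn i)) // leq_pmull.
Qed.

(** Inverse by the geometric series. *)
Lemma nilpotent_cunit g x k : g * g = g -> g * x = x -> x ^+ k = 0 -> cunit g (g + x).
Proof.
move=> gg gx xk; apply/cunitP; split; first by rewrite mulrDr gg gx.
pose s := \sum_(i < k) (- x) ^+ i.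
have E : (1 + x) * s = 1.
  have := subrX1 (- x) k; rewrite exprNn xk mulr0 sub0r -opprD [x + 1]addrC mulNr.
  by move=> /oppr_inj <-.
exists (g * s); split; first by rewrite mulrA gg.
by rewrite -[x in g + x]gx -{1}[g]mulr1 -mulrDr mulrACA gg E mulr1.
Qed.

Lemma power_cunit g x k : g * x = x -> x ^+ k.+1 = g -> cunit g x.
Proof.
move=> gx xk; apply/cunitP; split=> //; exists (g * x ^+ k).
have gg : g * g = g by rewrite -{2}xk exprS mulrA gx -exprS.
split; first by rewrite mulrA gg.
by rewrite mulrCA -exprS xk.
Qed.

(** Let e be an idempotent power of x. Then x is a unit of eR, which extends by g - e to
    a unit of gR, so x e = e; and x - e is nilpotent, so g + (x - e) is a unit as well. *)
Lemma corner_boolean g x : g * g = g -> #|cunit g| = 1%N -> g * x = x -> x * x = x.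
Proof.
move=> gg g1 gx.
have one y : cunit g y -> y = g.
  have gu : cunit g g by apply/cunitP; split => //; exists g.
  move=> yu; have /card_le1_eqP : (#|cunit g| <= 1)%N by rewrite g1.
  by move=> /(_ _ _ yu gu).
have [[|k] // _ ee] := idem_power x; set e := x ^+ k.+1 in ee.
have ge : g * e = e by rewrite /e exprS mulrA gx.
have xeE : x * e = e.
  suff /one E : cunit g (x * e + (g - e)).
    by apply/eqP; rewrite -subr_eq0; apply/eqP; rewrite -[RHS](subrr g) -{1}E; ring.
  apply/cunitP; split; first by rewrite mulrDr mulrBr gg ge mulrA gx.
  exists (g * x ^+ k * e + (g - e)); split.
    by rewrite mulrDr mulrBr !mulrA gg ge.
  have xk : x * x ^+ k = e by rewrite /e exprS.
  have -> : (x * e + (g - e)) * (g * x ^+ k * e + (g - e)) =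
     (g * (x * x ^+ k)) * (e * e) + x * (g * e - e * e) + g * x ^+ k * (g * e - e * e)
     + (g * g - g * e - (g * e - e * e)) by ring.
  rewrite xk ge ee (subrr e) !mulr0 !addr0 ee gg subr0.
  by rewrite addrC subrK.
have nil : (x - e) ^+ k.+1 = 0.
  have -> : x - e = x * (g - e) by rewrite mulrBr [x * g]mulrC gx xeE.
  rewrite exprMn -/e exprS mulrA mulrBr [e * g]mulrC ge ee subrr mul0r //.
have /one/eqP : cunit g (g + (x - e)).
  by apply: nilpotent_cunit nil => //; rewrite mulrBr gx ge.
by rewrite -subr_eq0 addrAC subrr add0r subr_eq0 => /eqP ->.
Qed.

End Corners.

(** * Rings with two units *)

Lemma card_gt_pick (T : finType) (A : pred T) (s : seq T) :
  (size s < #|A|)%N -> exists2 x, A x & x \notin s.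
Proof.
move=> h; case: (pickP (fun x => A x && (x \notin s))) => [x /andP[]|none]; first by exists x.
have : (#|A| <= #|s|)%N.
  apply: subset_leq_card; apply/fintype.subsetP => x Ax.
  by have := none x; rewrite -[A x]/(x \in A) Ax /= => /negbFE.
by move=> /leq_trans/(_ (card_size s)); rewrite leqNgt h.
Qed.

Lemma uniq_take_enum (T : finType) (A : pred T) n : (n <= #|A|)%N ->
  exists s, [/\ size s = n, uniq s & {subset s <= A}].
Proof.
move=> h; exists (take n (enum A)); rewrite size_take -cardE; split.
- by case: ltngtP h => // ->.
- exact/take_uniq/enum_uniq.
- by move=> x /mem_take; rewrite mem_enum.
Qed.

Lemma mem_size_le (T : finType) (A : pred T) s : uniq s -> {subset s <= A} -> (size s <= #|A|)%N.
Proof.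
by move=> us sA; rewrite -(card_uniqP us); apply: subset_leq_card; apply/fintype.subsetP.
Qed.

Lemma full_seq (T : finType) (A : pred T) s x :
  uniq s -> {subset s <= A} -> (#|A| <= size s)%N -> A x -> x \in s.
Proof.
move=> us sA As Ax; apply/negPn/negP => xs.
have : (size (x :: s) <= #|A|)%N.
  apply: mem_size_le; first by rewrite /= xs.
  by move=> y; rewrite inE => /predU1P[->|/sA].
by rewrite ltnNge As.
Qed.

Lemma card_cover (T : finType) (A B C : pred T) :
  (forall x, A x -> B x || C x) -> (#|A| <= #|B| + #|C|)%N.
Proof.
move=> h; rewrite -cardUI; apply: leq_trans (leq_addr _ _).
by apply: subset_leq_card; apply/fintype.subsetP => x /h; rewrite !inE.
Qed.

Lemma card_remove (T : finType) (A B : pred T) :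
  (#|A| - #|B| <= #|[pred x | A x && ~~ B x]|)%N.
Proof.
rewrite leq_subLR; apply: card_cover => x Ax /=; rewrite Ax /=; exact: orbN.
Qed.

Section Classify.
Variables (K : realType) (R : finComNzRingType).
Local Notation G := (comaximal_graph R).
Implicit Types x y g h e f : R.

Hypothesis emb : embeds K G (crosscap_surface K 1).

Lemma units_le2 : (8 <= #|R|)%N -> (#|@unitb R| <= 2)%N.
Proof.
move=> R8; rewrite leqNgt; apply/negP => /uniq_take_enum[c [c3 uc cU]].
have : (5 <= #|[predC c]|)%N.
  have := cardC (mem c); rewrite (card_uniqP uc) c3 => E.
  by rewrite -(leq_add2l 3) E.
move=> /uniq_take_enum[r [r5 ur rC]].
apply: (@K35_complete K R r c) => //.
  rewrite cat_uniq ur uc andbT; apply/hasPn => x xc; apply/negP => /rC.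
  by rewrite inE xc.
by move=> x y _ /cU yU; apply: comaximalC; apply: unit_comaximal.
Qed.

(** Units multiply over orthogonal idempotents, so of two complementary corners exactly
    one has two units. The smallest such corner fR contains no idempotent but 0 and f,
    hence each of its elements is a unit or nilpotent, and the translate by f of a
    nilpotent element is one of the two units: fR has at most four elements. The other
    corner eR is Boolean, and has at most two elements by the obstruction K_{3,5}. *)
Lemma two_units_frame : (8 <= #|R|)%N -> #|@unitb R| = 2%N ->
  exists k e f n, @frame R k e f n.
Proof.
move=> R8 U2.
pose Pf f := (f * f == f) && (#|cunit f| == 2%N).
have P1 : Pf 1.
  by rewrite /Pf mulr1 eqxx /= -U2; apply/eqP; apply: eq_card => x; exact: cunit1.
case: (arg_minnP (fun f => #|corner f|) P1) => f /andP[/eqP ff /eqP f2] fmin.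
pose e := 1 - f.
have ee : e * e = e by rewrite /e mulrBl mul1r mulrBr mulr1 ff subrr subr0.
have ef : e * f = 0 by rewrite /e mulrBl mul1r ff subrr.
have e1 : e + f = 1 by rewrite /e subrK.
have ce : #|cunit e| = 1%N.
  have := card_cunit ee ff ef; rewrite e1 f2.
  have -> : #|cunit (1 : R)| = 2%N by rewrite -U2; apply: eq_card => x; exact: cunit1.
  by lia.
have f0 : f != 0.
  apply/eqP => f0; have : (#|cunit f| <= #|[:: 0%R : R]|)%N.
    apply: subset_leq_card; apply/fintype.subsetP => x /cunitP[+ _].
    by rewrite f0 mul0r inE eq_sym => ->.
  by rewrite f2 => /leq_trans/(_ (card_size _)).
have idf g : g * g = g -> f * g = g -> g = 0 \/ g = f.
  move=> gg fg; have gf : g * f = g by rewrite mulrC.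
  pose h := f - g.
  have hh : h * h = h by rewrite /h mulrBl !mulrBr ff fg gf gg subrr subr0.
  have gh : g * h = 0 by rewrite /h mulrBr gf gg subrr.
  have ghE : g + h = f by rewrite /h addrC subrK.
  have hg : h * g = 0 by rewrite mulrC.
  (* A proper part of f with two units would have a smaller corner than f. *)
  have small a b : a * a = a -> b * b = b -> a * b = 0 -> a + b = f -> #|cunit a| = 2%N -> b = 0.
    move=> aa bb ab abf a2; have := fmin a; rewrite /Pf aa a2 !eqxx => /(_ isT).
    rewrite -abf (card_corner aa bb ab) => le.
    have a0 : (0 < #|corner a|)%N by apply/card_gt0P; exists a; rewrite unfold_in /= aa.
    have /card_le1_eqP : (#|corner b| <= 1)%N by move: le; rewrite -{2}[#|_|]muln1 leq_pmul2l.
    by apply; rewrite unfold_in /= ?bb ?mulr0.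
  have := card_cunit gg hh gh; rewrite ghE f2 => E.
  have : #|cunit g| = 2%N \/ #|cunit h| = 2%N.
    by move: E; case: #|cunit g| => [|[|[|a]]]; case: #|cunit h| => [|[|[|b]]] => //; lia.
  case=> [g2|h2].
    by right; rewrite -ghE (small g h) // addr0.
  by left; apply: (small h g) => //; rewrite addrC.
have dich x : f * x = x -> cunit f x \/ exists k, x ^+ k.+1 = 0.
  move=> fx; have [[|k] // _ kk] := idem_power x.
  case: (idf (x ^+ k.+1)) => // [|k0|kf].
  - by rewrite exprS mulrA fx.
  - by right; exists k.
  - by left; apply: power_cunit kf.
have f4 : (#|corner f| <= 4)%N.
  have : (#|corner f| <= #|cunit f| + #|[pred x | cunit f (f + x)%R]|)%N.
    apply: card_cover => x /eqP fx /=.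
    by case: (dich x fx) => [->//|[k xk]]; apply/orP; right; apply: nilpotent_cunit xk.
  move=> /leq_trans; apply; rewrite f2 -[4%N]/(2 + 2)%N leq_add2l -f2.
  rewrite -(@fintype.card_image _ _ (fun x => f + x) (addrI f)).
  by apply: subset_leq_card; apply/fintype.subsetP => y /fintype.imageP[x xU ->].
have Rcard : #|R| = (#|corner e| * #|corner f|)%N.
  by rewrite -card_corner1 -e1 (card_corner ee ff ef).
have ve x : e * x = x -> x * x = x by exact: corner_boolean ce.
have em : (#|corner e| <= 3)%N.
  rewrite leqNgt; apply/negP => m4.
  (* The elements with a unit in the second component: each is co-maximal with e and
     with the units. Those that are not units give the five rows of a K_{3,5}, whose
     columns are e and the two units. *)
  pose Y := [pred y | cunit f (f * y)].
  have Ycard : #|Y| = (#|corner e| * 2)%N.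
    rewrite -f2; apply: (corner_cards ee ff ef) => [x /eqP|x /cunitP[]|x] //.
    by rewrite e1 mul1r eqxx /= /corner /= mulrA ee eqxx.
  have UY x : unitb x -> Y x.
    rewrite -cunit1 -e1 => /cunitP[_ [y [_ xy]]]; apply/cunitP.
    split; first by rewrite mulrA ff.
    exists (f * y); split; first by rewrite mulrA ff.
    by rewrite mulrACA ff xy e1 mulr1.
  have : (5 <= #|[pred x | Y x && ~~ unitb x]|)%N.
    by apply: leq_trans (card_remove _ _); rewrite Ycard U2; move: m4; lia.
  move=> /uniq_take_enum[r [r5 ur rY]].
  have eY : ~~ Y e.
    apply/cunitP => -[_ [y [_]]]; rewrite mulrC [f * e]mulrC ef mulr0 => /esym/eqP.
    by rewrite (negPf f0).
  have [u [u2 uu uU]] : exists s, [/\ size s = 2%N, uniq s & {subset s <= @unitb R}].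
    by apply: uniq_take_enum; rewrite U2.
  have uUP x : x \in u -> unitb x by move=> /uU.
  apply: (@K35_complete K R r (e :: u)) => //; first by rewrite /= u2.
    rewrite cat_uniq ur /= uu andbT negb_or -andbA; apply/and3P; split => //.
    - by apply/negP => /rY/andP[Ye _]; case/negP: eY.
    - by apply/hasPn => x /uUP ux; apply/negP => /rY/andP[_ nx]; case/negP: nx.
    - by apply/negP => /uUP/UY Ye; case/negP: eY.
  move=> x y /rY/andP[Yx _]; rewrite inE => /predU1P[->|/uUP yU]; last first.
    by apply: comaximalC; apply: unit_comaximal.
  have /cunitP[_ [v [fv xv]]] := Yx.
  apply/comaximalP; exists v, 1.
  by rewrite mul1r -{1}fv mulrAC xv addrC.
have Rbig : (8 <= #|corner e| * #|corner f|)%N by rewrite -Rcard.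
have c0 (a : R) : corner a 0 by rewrite /corner /= mulr0.
have cc (a : R) : a * a = a -> corner a a by rewrite /corner /= => ->.
have e0 : e != 0.
  apply/eqP => e0; have : (#|corner e| <= #|[:: 0%R : R]|)%N.
    by apply: subset_leq_card; apply/fintype.subsetP => x; rewrite !inE /= e0 mul0r eq_sym.
  by move=> /leq_trans/(_ (card_size _)) /=; nia.
(* A Boolean ring cannot have three elements: 0, e, g and e - g are distinct. *)
have em2 : #|corner e| = 2%N.
  have : #|corner e| != 3%N.
    apply/negP => /eqP e3; have [g /eqP eg] : exists2 g, corner e g & g \notin [:: 0; e].
      by apply: card_gt_pick; rewrite e3.
    rewrite !inE negb_or => /andP[g0 ge]; have gg := ve g eg.
    have : (size [:: 0; e; g; e - g]%R <= #|corner e|)%N.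
      apply: mem_size_le.
        rewrite /= !inE !negb_or ![0 == _]eq_sym e0 g0 subr_eq0 [e == g]eq_sym ge /=.
        rewrite -[e == e - g]subr_eq0 opprB addrCA subrr addr0 g0 andbT /=.
        apply: contra g0 => /eqP/(congr1 (fun z => g * z)).
        by rewrite mulrBr gg [g * e]mulrC eg subrr => <-.
      move=> x; rewrite !inE => /or4P[] /eqP ->; rewrite -?[_ \in _]/(corner e _).
      - exact: c0.
      - exact: cc.
      - exact/eqP.
      - by rewrite /corner /= mulrBr ee eg.
    by rewrite e3.
  by nia.
have fm4 : #|corner f| = 4%N by nia.
have eE x : e * x = 0 \/ e * x = e.
  suff : e * x \in [:: 0; e] by rewrite !inE => /orP[] /eqP; [left|right].
  apply: (@full_seq _ (corner e)); rewrite ?em2 //= ?inE 1?eq_sym ?e0 //.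
    by move=> y; rewrite !inE => /orP[] /eqP ->; [exact: c0|exact: cc].
  by rewrite /corner /= mulrA ee.
have fu : cunit f f by apply/cunitP; split => //; exists f.
have [n /andP[/eqP fn nu] n0] :
    exists2 n, corner f n && ~~ cunit f n & n \notin [:: 0].
  by apply: card_gt_pick; apply: leq_trans (card_remove _ _); rewrite fm4 f2.
rewrite inE in n0.
have divU x : cunit f (n * x) -> False.
  move=> /cunitP[fx [z [fz nz]]]; case/negP: nu; apply/cunitP; split => //.
  by exists (f * (x * z)); rewrite mulrA ff; split=> //; rewrite mulrCA [n * _]mulrA nz ff.
have [//|[k nk]] := dich n fn; first by move=> nU; case/negP: nu.
have fnu : cunit f (f + n) by exact: nilpotent_cunit nk.
have fE x : f * x = x -> [\/ x = 0, x = n, x = f | x = f + n].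
  move=> fx; suff : x \in [:: 0; n; f; f + n] by rewrite !inE => /or4P[] /eqP;
    [constructor 1|constructor 2|constructor 3|constructor 4].
  apply: (@full_seq _ (corner f)); rewrite ?fm4 //=; last exact/eqP.
    have nf : n != f by apply: contraNneq nu => ->.
    rewrite !inE !negb_or /= ![0 == _]eq_sym n0 f0 nf /= andbT.
    apply/and3P; split.
    - apply/eqP => z; have := fnu; rewrite z => /cunitP[_ [y [_]]].
      by rewrite mul0r => /esym/eqP; rewrite (negPf f0).
    - by rewrite -subr_eq0 opprD addrCA subrr addr0 oppr_eq0.
    - by rewrite -subr_eq0 opprD addrA subrr sub0r oppr_eq0.
  move=> y; rewrite !inE => /or4P[] /eqP ->; rewrite -?[_ \in _]/(corner f _).
  - exact: c0.
  - exact/eqP.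
  - exact: cc.
  - by rewrite /corner /= mulrDr ff fn.
have nil x : f * x = x -> (exists y, x = n * y) -> x = 0 \/ x = n.
  move=> fx [y xE]; have xU : ~ cunit f x by rewrite xE => /divU.
  case: (fE x fx) => [->|->|E|E]; [by left|by right| |]; by case: xU; rewrite E.
have nn : n * n = 0.
  case: (nil (n * n)); [by rewrite mulrA fn|by exists n|by []|] => nnE.
  have : n ^+ k.+1 = n by elim: (k) => [|j IH]; rewrite ?expr1 // exprS IH.
  by rewrite nk => nE; rewrite nE eqxx in n0.
have n2 : n + n = 0.
  case: (nil (n + n)); [by rewrite mulrDr fn|exists 2%:R|by []|].
    by rewrite mulr_natr.
  by move/eqP; rewrite -subr_eq0 addrK (negPf n0).
exists (f + f == n), e, f, n; split=> //.
- have := eE (e + e); rewrite mulrDr ee => -[//|/eqP].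
  by rewrite -subr_eq0 addrK (negPf e0).
- case: (fE (f + f)); first by rewrite mulrDr ff.
  + by move=> ->; rewrite eq_sym (negPf n0).
  + by move=> ->; rewrite eqxx mulr1n.
  + by move/eqP; rewrite -subr_eq0 addrK (negPf f0).
  + by move/addrI => E; case/negP: nu; rewrite -E.
move=> x; have [a aE] : exists a : bool, e * x = e *+ a.
  by case: (eE x) => ->; [exists false|exists true].
have [b [c bcE]] : exists b c : bool, f * x = f *+ b + n *+ c.
  case: (fE (f * x)); first by rewrite mulrA ff.
  - by move=> ->; exists false, false; rewrite !mulr0n addr0.
  - by move=> ->; exists false, true; rewrite !mulr0n add0r mulr1n.
  - by move=> ->; exists true, false; rewrite !mulr1n addr0.
  - by move=> ->; exists true, true; rewrite !mulr1n.
by exists (a, b, c); rewrite /fcode /= -addrA -bcE -aE -mulrDl e1 mul1r.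
Qed.

End Classify.

(** * Boolean rings *)

Section Boolean.
Variables (K : realType) (R : finComNzRingType).
Local Notation G := (comaximal_graph R).
Implicit Types (x y : R) (s : seq R).

Hypothesis idem : forall x, x * x = x.

Definition orthogonal_pieces s :=
  [/\ \sum_(x <- s) x = 1, all (fun x => x != 0) s & pairwise (fun x y => x * y == 0) s].

Lemma pieces_card s : pairwise (fun x y => x * y == 0) s ->
  #|corner (\sum_(x <- s) x)| = (\prod_(x <- s) #|corner x|)%N.
Proof.
elim: s => [_|a s IH /= /andP[/allP as0 /IH E]].
  rewrite !big_nil -[RHS](card1 (0 : R)); apply: eq_card => x.
  by rewrite !inE /= mul0r eq_sym.
rewrite !big_cons card_corner // ?E //.
by rewrite mulr_sumr big1_seq // => x /andP[_ /as0/eqP].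
Qed.

(** An idempotent a is the orthogonal sum of any b in its corner and of a - b, which
    splits it unless b is 0 or a. *)
Lemma split_piece s : orthogonal_pieces s ->
  (exists2 s', orthogonal_pieces s' & size s' = (size s).+1) \/
  forall a x, a \in s -> a * x = 0 \/ a * x = a.
Proof.
move=> [s1 s0 sp]; have [/hasP[a]|] := boolP (has (fun a => 2 < #|corner a|)%N s).
  move=> as_ a3; left.
  have [b /eqP ab] : exists2 b, corner a b & b \notin [:: 0; a] by apply: card_gt_pick.
  rewrite !inE negb_or => /andP[b0 ba].
  case/splitPr: as_ s1 s0 sp => s1 s2.
  rewrite big_cat big_cons all_cat pairwise_cat /= allrel_consr.
  move=> sum1 /and3P[nz1 _ nz2] /and3P[/andP[q1 q12] p1 /andP[q2 p2]].
  exists (s1 ++ [:: b, a - b & s2]); last by rewrite !size_cat /= !addnS.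
  split.
  - by rewrite big_cat !big_cons -sum1 /=; ring.
  - by rewrite all_cat nz1 /= b0 subr_eq0 eq_sym ba.
  rewrite pairwise_cat /= !allrel_consr q12 p1 p2 /= !andbT.
  have ob x : x * a = 0 -> x * b = 0 by rewrite -ab mulrA => ->; rewrite mul0r.
  rewrite -!andbA; apply/and5P; split.
  - by apply: sub_all q1 => x /eqP xa; rewrite ob.
  - by apply: sub_all q1 => x /eqP xa; rewrite mulrBr xa ob // subrr.
  - by rewrite mulrBr [b * a]mulrC ab idem subrr.
  - by apply: sub_all q2 => x /eqP; rewrite mulrC => /ob; rewrite mulrC => ->.
  apply: sub_all q2 => x /eqP xa; rewrite mulrBl xa sub0r oppr_eq0 mulrC ob //.
  by rewrite mulrC.
rewrite -all_predC => /allP h; right=> a x as_; have /= := h a as_; rewrite -leqNgt => a2.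
have a0 : a != 0 by apply: (allP s0).
suff : a * x \in [:: 0; a] by rewrite !inE => /orP[] /eqP; [left|right].
apply: (@full_seq _ (corner a)) => //=; rewrite ?inE 1?eq_sym ?a0 //.
  by move=> y; rewrite !inE => /orP[] /eqP ->; rewrite ?mulr0 ?idem.
by rewrite /corner /= mulrA idem.
Qed.

(** If no piece can be split then every corner has two elements, so fewer than three
    pieces would leave at most four elements in the ring. *)
Lemma pieces3 : (8 <= #|R|)%N -> exists2 s, orthogonal_pieces s & size s = 3%N.
Proof.
move=> R8.
have grow s : orthogonal_pieces s -> (size s < 3)%N ->
    exists2 s', orthogonal_pieces s' & size s' = (size s).+1.
  move=> sP s3; case: (split_piece sP) => // h; exfalso.
  have [s1 s0 sp] := sP; move: R8; rewrite -card_corner1 -s1 pieces_card // leqNgt; case/negP.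
  apply: (@leq_ltn_trans (\prod_(x <- s) 2)%N); last first.
    by rewrite big_const_seq count_predT iter_muln_1; case: (size s) s3 => [|[|[]]].
  rewrite big_seq [leqRHS]big_seq; apply: leq_prod => a as_.
  apply: leq_trans (card_size [:: 0; a]%R); apply: subset_leq_card; apply/fintype.subsetP => x.
  by move=> /eqP ax; rewrite !inE; case: (h a x as_); rewrite ax => ->; rewrite eqxx ?orbT.
have [||s2 s2P s22] := @grow [:: 1].
- by split; rewrite ?big_seq1 //= oner_eq0.
- by [].
by have [|s3 s3P s33] := grow _ s2P; [rewrite s22|exists s3; rewrite ?s33 ?s22].
Qed.

(** The ring is F_2^3. Co-maximal elements have supports that cover the three
    coordinates, and these pairs lie in a join of an edge and a path. *)
Lemma three_pieces_spherical a b c : orthogonal_pieces [:: a; b; c] ->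
    (forall p x, p \in [:: a; b; c] -> p * x = 0 \/ p * x = p) ->
  embeds K G (crosscap_surface K 0).
Proof.
rewrite /orthogonal_pieces !big_cons big_nil addr0 /= !andbT.
move=> [sum1 /and3P[a0 b0 c0] _] h.
pose bits x := (a * x != 0, b * x != 0, c * x != 0).
have part p x : p \in [:: a; b; c] -> p * x = p *+ (p * x != 0).
  by move=> ps; case: (h p x ps) => ->; rewrite ?eqxx ?mulr0n //; case: eqVneq => [->|].
have bitsE x : x = a *+ (bits x).1.1 + (b *+ (bits x).1.2 + c *+ (bits x).2).
  by rewrite /= -!part ?inE ?eqxx ?orbT // -!mulrDl sum1 mul1r.
pose tab (t : bool * bool * bool) :=
  nth 0%N [:: 7; 2; 3; 5; 6; 4; 1; 0]%N (t.1.1 * 4 + t.1.2 * 2 + t.2)%N.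
apply: (@code_spherical K R (tab \o bits)).
- apply: inj_comp => [[[u v] w] [[u' v'] w']|x y E]; last by rewrite [x]bitsE [y]bitsE E.
  by case: u v w u' v' w' => [] [] [] [] [] [].
- by move=> x; rewrite /= /tab; case: (bits x) => [[[] []] []].
move=> x y xy /comaximalP[u [v uv]].
have cov p : p != 0 -> (p * x != 0) || (p * y != 0).
  apply: contraR; rewrite negb_or !negbK => /andP[/eqP px /eqP py].
  by rewrite -[p]mulr1 -uv mulrDr !(mulrCA p) px py !mulr0 addr0.
have := cov a a0; have := cov b b0; have := cov c c0.
have bxy : bits x != bits y by apply: contra xy => /eqP E; rewrite [x]bitsE [y]bitsE E.
move: bxy; rewrite -[a * x != 0]/(bits x).1.1 -[b * x != 0]/(bits x).1.2 -[c * x != 0]/(bits x).2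
  -[a * y != 0]/(bits y).1.1 -[b * y != 0]/(bits y).1.2 -[c * y != 0]/(bits y).2.
rewrite -[(tab \o bits) x]/(tab (bits x)) -[(tab \o bits) y]/(tab (bits y)).
by case: (bits x) (bits y) => [[[] []] []] [[[] []] []].
Qed.

(** The ring contains F_2^4, in which elements are adjacent if their supports cover the
    four coordinates. *)
Lemma four_pieces_not_projective a b c d : orthogonal_pieces [:: a; b; c; d] ->
  ~ embeds K G (crosscap_surface K 1).
Proof.
rewrite /orthogonal_pieces !big_cons big_nil addr0 /= !andbT => -[sum1 /and4P[a0 b0 c0 d0]].
move=> /and3P[/and3P[/eqP ab /eqP ac /eqP ad] /andP[/eqP bc /eqP bd] /eqP cd].
pose T := (bool * bool * bool * bool)%type.
pose S (t : T) := a *+ t.1.1.1 + b *+ t.1.1.2 + c *+ t.1.2 + d *+ t.2.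
have aS t : a * S t = a *+ t.1.1.1.
  by rewrite /S !mulrDr !mulrnAr idem ab ac ad !mul0rn !addr0.
have bS t : b * S t = b *+ t.1.1.2.
  by rewrite /S !mulrDr !mulrnAr idem [b * a]mulrC ab bc bd !mul0rn !addr0 add0r.
have cS t : c * S t = c *+ t.1.2.
  by rewrite /S !mulrDr !mulrnAr idem [c * a]mulrC [c * b]mulrC ac bc cd !mul0rn !addr0 !add0r.
have dS t : d * S t = d *+ t.2.
  by rewrite /S !mulrDr !mulrnAr idem ![d * _]mulrC ?idem ad bd cd !mul0rn !add0r.
have bitI (p : R) (u v : bool) : p != 0 -> p *+ u = p *+ v -> u = v.
  by move=> p0; case: u v => [] [] // /eqP; rewrite ?mulr1n ?mulr0n ?[0 == _]eq_sym (negPf p0).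
have SI : injective S.
  move=> t t' E; have Ea := aS t; have Eb := bS t; have Ec := cS t; have Ed := dS t.
  move: Ea Eb Ec Ed; rewrite E aS bS cS dS.
  move=> /esym/(bitI _ _ _ a0) Ea /esym/(bitI _ _ _ b0) Eb /esym/(bitI _ _ _ c0) Ec.
  move=> /esym/(bitI _ _ _ d0) Ed; case: t t' Ea Eb Ec Ed {E} => [[[? ?] ?] ?] [[[? ?] ?] ?] /=.
  by move=> -> -> -> ->.
pose neg (t : T) : T := (~~ t.1.1.1, ~~ t.1.1.2, ~~ t.1.2, ~~ t.2).
pose e (t t' : T) := [&& t != t', t.1.1.1 || t'.1.1.1, t.1.1.2 || t'.1.1.2,
  t.1.2 || t'.1.2 & t.2 || t'.2].
have he t t' : e t t' -> G (S t) (S t').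
  move=> /and5P[tt' ea eb ec ed]; rewrite adjP (inj_eq SI) tt' /=.
  apply/comaximalP; exists 1, (S (neg t)); rewrite mul1r.
  have one (p : R) (u v : bool) : u || v -> p *+ u + p *+ v *+ ~~ u = p.
    by case: u v => [] [] //=; rewrite ?mulr0n ?mulr1n ?mul0rn ?addr0 ?add0r.
  set z := S t + _; rewrite -[z]mul1r -sum1 !mulrDl.
  have -> : a * z = a by rewrite mulrDr mulrA !aS mulrnAl aS; apply: one.
  have -> : b * z = b by rewrite mulrDr mulrA !bS mulrnAl bS; apply: one.
  have -> : c * z = c by rewrite mulrDr mulrA !cS mulrnAl cS; apply: one.
  by have -> : d * z = d by rewrite mulrDr mulrA !dS mulrnAl dS; apply: one.
(* Five rows followed by three columns, as subsets of the four pieces. Only the rows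
   {1,3} and {1,4} together with the column {1,3,4} fail to cover; they are joined
   through {2,4} and {2,3}. *)
pose vs : seq T := [:: (true, true, false, false); (true, true, true, false);
  (true, true, false, true); (true, false, true, false); (true, false, false, true);
  (true, true, true, true); (false, true, true, true); (true, false, true, true)].
pose vx i := nth (true, true, true, true) vs i.
pose p (q : nat * nat) : seq T :=
  if q == (3, 7)%N then [:: (false, true, false, true); vx 7]
  else if q == (4, 7)%N then [:: (false, true, true, false); vx 7]
  else [:: vx q.2].
apply: (@K35_not_projective K _ _ (S \o vx) (fun q => map S (p q))).
exact: (subdivision_map SI he).
Qed.

End Boolean.

(** * The classification *)

Lemma boolean_not_projective (K : realType) (R : finComNzRingType) :
  (8 <= #|R|)%N -> (forall x : R, x * x = x) -> ~ projective K (comaximal_graph R).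
Proof.
move=> R8 idem [emb minimal]; have [[|a [|b [|c [|//]]]] // sP _] := pieces3 idem R8.
have [[[|a' [|b' [|c' [|d' [|//]]]]] // s'P _]|h] := split_piece idem sP.
  exact: (four_pieces_not_projective idem s'P emb).
by have := minimal 0%N (three_pieces_spherical K sP h).
Qed.

Lemma card5_projective (K : realType) (R : finComNzRingType) :
  #|R| = 5%N -> projective K (comaximal_graph R).
Proof.
move=> R5; split.
  apply: (@code_projective K R (fun x => enum_rank x)).
  - by move=> x y /val_inj/enum_rank_inj.
  - by move=> x; rewrite (leq_trans (ltn_ord _)) // R5.
  move=> x y xy _; rewrite /K6_plus_rel.
  have -> : (enum_rank x : nat) != enum_rank y.
    by apply: contra xy => /eqP/val_inj/enum_rank_inj ->.
  have lt6 (z : R) : (enum_rank z < 6)%N by rewrite (leq_trans (ltn_ord _)) // R5.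
  by rewrite !lt6 !orbT.
case=> // emb; exfalso.
pose h (i : 'I_5) : R := enum_val (cast_ord (esym R5) i).
have hI : injective h by move=> i j /enum_val_inj/cast_ord_inj.
have he i j : i != j -> comaximal_graph R (h i) (h j).
  by move=> ij; rewrite adjP (inj_eq hI) ij (@prime_complete _ 5) // (inj_eq hI).
pose o5 i : 'I_5 := Ordinal (ltn_pmod i (isT : 0 < 5)%N).
apply: (@K5_not_spherical K _ _ (h \o o5) (fun a => map h [:: o5 a.2])) emb.
exact: (subdivision_map hI he).
Qed.

Theorem theorem5p5 (K : realType) (R : finComNzRingType) :
  projective K (comaximal_graph R) <->
  [\/ ring_isomorphic R ('Z_2 * 'Z_4)%type,
      ring_isomorphic R ('Z_2 * {poly %/ ('X^2 : {poly 'Z_2})})%type |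
      ring_isomorphic R 'Z_5].
Proof.
split=> [proj|[iso|iso|[f fB]]]; last 1 first.
- by apply: card5_projective; rewrite (bij_eq_card fB) card_ord.
- have [emb minimal] := proj.
  have nonplanar : ~ embeds K (comaximal_graph R) (crosscap_surface K 0).
    by move=> /minimal.
  have [R8|] := leqP 8 #|R|; last first.
    rewrite leq_eqVlt ltnS leq_eqVlt ltnS leq_eqVlt ltnS leq_eqVlt ltnS.
    case/orP=> [/eqP[R7]|/orP[/eqP[R6]|/orP[/eqP[R5]|/orP[/eqP[R4]|R4]]]].
    - by case: (complete7_not_projective R7 emb).
    - by case: nonplanar; exact: card6_spherical.
    - by constructor 3; exact: Z5_iso.
    - by case: nonplanar; apply: card_le4_spherical; rewrite R4.
    - by case: nonplanar; apply: card_le4_spherical; exact: ltnW.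
  have := units_le2 emb R8; rewrite leq_eqVlt => /orP[/eqP U2|U1].
    have [[] [e [f [n F]]]] := two_units_frame emb R8 U2.
      by constructor 1; exact: frame_iso F Z2xZ4_frame.
    by constructor 2; exact: frame_iso F Z2xdual_frame.
  exfalso; apply: (boolean_not_projective R8) proj => x.
  apply: (@corner_boolean _ 1); rewrite ?mul1r //.
  have -> : #|cunit (1 : R)| = #|@unitb R| by apply: eq_card => y; exact: cunit1.
  apply/eqP; rewrite eqn_leq -ltnS U1; apply/card_gt0P; exists 1.
  by apply/unitP; exists 1; rewrite mulr1.
- by have [e [f [n F]]] := frame_transport iso Z2xZ4_frame; exact: frame_projective F.
- by have [e [f [n F]]] := frame_transport iso Z2xdual_frame; exact: frame_projective F.
Qed.
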